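(* Let $s>1/2$. A solution $\vec u=(\eta,v)$ of $$\eta_t-\eta_{txx}+v_x+(\eta v)_x=0,\qquad v_t-v_{txx}+\eta_x+vv_x=0,\qquad x\in\mathbb R,\ t\ge0,$$ with initial data $\vec u_0\in X^s$ blows up in finite time $T<\infty$ if and only if $$\liminf_{t\to T}\Big[\inf_{x\in\mathbb R}\eta(t,x)\Big]=-\infty .$$
   Context: $X^s=H^s(\mathbb R)\times H^s(\mathbb R)$ with norm $\|(\eta,v)\|_s=\|\eta\|_{H^s}+\|v\|_{H^s}$. The system is locally well-posed in $X^s$: for each $\vec u_0\in X^s$ there is a unique solution, continuous in time with values in $X^s$, on a maximal interval of existence. In the statement the solution is considered on $[0,T)$ (i.e. $\vec u\in C([0,T),X^s)$), and ''blows up in finite time $T<\infty$'' means that $T$ is its maximal existence time in $X^s$, equivalently $\limsup_{t\to T^-}\|\vec u(t)\|_s=\infty$. The limit is taken as $t\to T$ from below. *)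

(* Defs.v *)
From HB Require Import structures.
From mathcomp Require Import all_boot all_order all_algebra.
From mathcomp Require Import all_classical all_reals all_analysis.

Set Implicit Arguments.
Unset Strict Implicit.
Unset Printing Implicit Defensive.

Import Order.TTheory GRing.Theory Num.Theory.
Import numFieldNormedType.Exports.

Local Open Scope classical_set_scope.
Local Open Scope ring_scope.

(* A complex-valued function is encoded by the pair of its real and imaginary
   parts; here it is (2 pi)^(-1/2) * int_{-n}^{n} f(x) e^(-i x xi) dx for a
   real-valued f. *)
Definition truncated_fourier (R : realType) (f : R -> R) (n : nat) :
    (R -> R) * (R -> R) :=
  let mu := @lebesgue_measure R in
  let c := (Num.sqrt (2 * pi))^-1 in
  (fun xi => c * \int[mu]_(x in `[- n%:R, n%:R]) (f x * cos (x * xi)),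
   fun xi => - (c * \int[mu]_(x in `[- n%:R, n%:R]) (f x * sin (x * xi)))).

(* Plancherel's definition of the Fourier transform on L^2(R): the limit in L^2
   of the truncated transforms. *)
Definition is_fourier (R : realType) (f : R -> R)
    (g : (R -> R) * (R -> R)) : Prop :=
  let mu := @lebesgue_measure R in
  [/\ measurable_fun setT g.1, measurable_fun setT g.2,
      Lnorm mu 2%:E (fun xi => ((truncated_fourier f n).1 xi - g.1 xi)%:E)
        @[n --> \oo] --> 0%E &
      Lnorm mu 2%:E (fun xi => ((truncated_fourier f n).2 xi - g.2 xi)%:E)
        @[n --> \oo] --> 0%E].

(* For f in L^2(R), a transform exists and is unique almost everywhere; for
   other f this may be the junk value 0. *)
Definition fourier (R : realType) (f : R -> R) : (R -> R) * (R -> R) :=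
  xget (cst 0, cst 0) [set g | is_fourier f g].

Definition Hs_norm (R : realType) (s : R) (f : R -> R) : \bar R :=
  ((\int[@lebesgue_measure R]_xi
      ((1 + xi ^+ 2) `^ s *
         ((fourier f).1 xi ^+ 2 + (fourier f).2 xi ^+ 2))%:E) `^ 2^-1)%E.

(* H^s(R) for s >= 0, where it is a subspace of L^2(R). *)
Definition Hs (R : realType) (s : R) (f : R -> R) : Prop :=
  f \in Lfun (@lebesgue_measure R) 2%:E /\ (Hs_norm s f < +oo)%E.

Definition Xs (R : realType) (s : R) (eta v : R -> R) : Prop :=
  Hs s eta /\ Hs s v.

Definition Xs_norm (R : realType) (s : R) (eta v : R -> R) : \bar R :=
  (Hs_norm s eta + Hs_norm s v)%E.

(* (eta, v) is in C([0,T), X^s). *)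
Definition continuous_Xs (R : realType) (s T : R) (eta v : R -> R -> R) : Prop :=
  forall t : R, t \in `[0, T[ ->
    Xs s (eta t) (v t) /\
    Xs_norm s (eta t' \- eta t) (v t' \- v t)
      @[t' --> within [set` `[0, T[] (nbhs t)] --> 0%E.

Definition test_function (R : realType) (phi : R -> R) : Prop :=
  (forall (n : nat) (x : R), derivable (derive1n n phi) x 1) /\
  exists M : R, forall x, M < `|x| -> phi x = 0.

(* The two equations in the sense of distributions: after pairing with
   phi(x) in C_c^oo(R) and integrating by parts in x,
     d/dt int eta (phi - phi'') = int (v + eta v) phi',
     d/dt int v (phi - phi'') = int (eta + v^2/2) phi'. *)
Definition weak_equations (R : realType) (T : R) (eta v : R -> R -> R) : Prop :=
  let mu := @lebesgue_measure R in
  forall (phi : R -> R) (t : R), test_function phi -> t \in `]0, T[ ->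
    is_derive t 1
      (fun t' => \int[mu]_x (eta t' x * (phi x - derive1n 2 phi x)))
      (\int[mu]_x ((v t x + eta t x * v t x) * derive1 phi x)) /\
    is_derive t 1
      (fun t' => \int[mu]_x (v t' x * (phi x - derive1n 2 phi x)))
      (\int[mu]_x ((eta t x + v t x ^+ 2 / 2) * derive1 phi x)).

(* A solution in C([0,T), X^s) with initial data (eta0, v0).  Elements of
   H^s(R) are functions up to equality almost everywhere; since s > 1/2 below,
   each eta(t) and v(t) is taken to be its continuous representative, so that
   its pointwise values (and its infimum) make sense. *)
Record solution (R : realType) (s T : R) (eta0 v0 : R -> R)
    (eta v : R -> R -> R) : Prop := Solution {
  solution_continuous_Xs : continuous_Xs s T eta v ;
  solution_representative :
    forall t : R, t \in `[0, T[ -> continuous (eta t) /\ continuous (v t) ;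
  solution_initial :
    {ae @lebesgue_measure R, forall x, eta 0 x = eta0 x /\ v 0 x = v0 x} ;
  solution_equations : weak_equations T eta v }.

(* T is the maximal existence time in X^s of the solution (eta, v) on [0,T). *)
Definition blows_up_at (R : realType) (s T : R) (eta0 v0 : R -> R)
    (eta v : R -> R -> R) : Prop :=
  ~ exists (T' : R) (eta' v' : R -> R -> R),
      [/\ T < T', solution s T' eta0 v0 eta' v' &
          forall t : R, t \in `[0, T[ -> eta' t = eta t /\ v' t = v t].

(* Main.v *)
Require Import Defs.
From HB Require Import structures.
From mathcomp Require Import all_boot all_order all_algebra.
From mathcomp Require Import all_classical all_reals all_analysis.
From mathcomp Require Import measurable_realfun ring lra.

(** Write A for the operator - d/dx (1 - d^2/dx^2)^-1. The system reads
      eta_t = A (v + eta v),    v_t = A (eta + v^2 / 2),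
    which is an ordinary differential equation for the bounded operator A. On the space
    E of bounded, continuous, square integrable functions, A and the product
    have norm at most one, so that the local existence time depends on the E norm of the data
    only (local_existence). For s > 1/2 the space H^s embeds into E (sobolev) and is an
    algebra (Hbd_mul), and A gains one derivative (Hbd_Aop); therefore a solution
    whose data are in H^s stays in H^s as long as it is bounded in E (persistence). A
    solution in X^s that is bounded in E up to time T hence extends beyond T
    (extension): restart it shortly before T, and glue by uniqueness in E
    (flow_unique).

    If eta is bounded below near T, then the solution is bounded in E (apriori). The
    energy, the integral of eta^2 + (1 + eta) v^2, is conserved because A is
    antisymmetric; with eta >= - M it bounds the L2 norm of eta by that of v. To bound
    v, let w be the increment of v since a time t0. It has one more derivative than v,
    and in the time derivative of the H^1 norm of w the cubic term, the integral of
    w^2 w_x, vanishes, so that Gronwall's inequality applies (v_growth). Two bounds on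
    A, from L2 and from L1 to the bounded functions, then give the supremum norms.
    Conversely, an extension beyond T is continuous at T with values in E, so eta is
    bounded near T.

    The equations are given in the sense of distributions. They are turned into
    differentiability in E by testing against phi = chi G rho, where
    G = (1 - d^2/dx^2)^-1, rho is a bump and chi a wide cutoff (resolvent_dual,
    Ederiv_of_weak).

    All Fourier analysis is done with the Hartley transform, of kernel
    cos + sin, which is a real isometry of L2 (plancherel_tame, hartley_nsq); its
    even and odd parts give the complex Fourier transform (fourier_ae), whence the
    H^s norms (Hs_norm_le). Plancherel's theorem is obtained by damping the inversion
    integral with exp (- e |z|), which amounts to smoothing with the Poisson kernel. *)

Set Implicit Arguments.
Unset Strict Implicit.
Unset Printing Implicit Defensive.

Import Order.TTheory GRing.Theory Num.Theory.
Import numFieldNormedType.Exports.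

Local Open Scope classical_set_scope.
Local Open Scope ring_scope.

(** * Integrable functions on the line *)

Section Integrable.
Context {R : realType}.
Local Notation mu := (@lebesgue_measure R).
Implicit Types f g b : R -> R.

Lemma aeS (P Q : R -> Prop) : (forall x, P x -> Q x) ->
  {ae mu, forall x, P x} -> {ae mu, forall x, Q x}.
Proof.
by move=> PQ; apply: filterS => //; exact: (ae_filter_ringOfSetsType mu).
Qed.

Lemma aeI (P Q : R -> Prop) : {ae mu, forall x, P x} -> {ae mu, forall x, Q x} ->
  {ae mu, forall x, P x /\ Q x}.
Proof.
by move=> hP hQ; apply: filterI => //; exact: (ae_filter_ringOfSetsType mu).
Qed.

Definition intR f : R := Rintegral mu setT f.
Definition L1 f : Prop := mu.-integrable setT (EFin \o f).

Lemma L1_measurable f : L1 f -> measurable_fun setT f.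
Proof. by move=> /measurable_int /measurable_EFinP. Qed.

Lemma L1_le f g : measurable_fun setT f -> L1 g ->
  (forall x, `|f x| <= g x) -> L1 f.
Proof.
move=> mf ig fg; apply: (le_integrable measurableT _ _ ig).
  exact/measurable_EFinP.
by move=> x _ /=; rewrite lee_fin (le_trans (fg x)) ?ler_norm.
Qed.

Lemma L1_eq f g : f =1 g -> L1 f -> L1 g.
Proof. by move=> /funext ->. Qed.

Lemma L1D f g : L1 f -> L1 g -> L1 (fun x => f x + g x).
Proof. by move=> hf hg; exact: (integrableD measurableT hf hg). Qed.

Lemma L1Z k f : L1 f -> L1 (fun x => k * f x).
Proof. by move=> hf; exact: (integrableZl measurableT k hf). Qed.

Lemma L1N f : L1 f -> L1 (fun x => - f x).
Proof. by move=> hf; exact: (integrableN hf). Qed.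

Lemma L1B f g : L1 f -> L1 g -> L1 (fun x => f x - g x).
Proof. by move=> hf hg; apply: L1D => //; exact: L1N. Qed.

Lemma L1_abs f : L1 f -> L1 (fun x => `|f x|).
Proof. by move=> hf; exact: (integrable_norm hf). Qed.

Lemma L1_0 : L1 (fun=> 0).
Proof. exact: integrable0. Qed.

Lemma L1_boundedM b f M : measurable_fun setT b -> (forall x, `|b x| <= M) ->
  L1 f -> L1 (fun x => b x * f x).
Proof.
move=> mb bM hf; apply: (@L1_le _ (fun x => M * `|f x|)).
- by apply: measurable_funM => //; exact: L1_measurable.
- by apply: L1Z; exact: L1_abs.
- by move=> x; rewrite normrM ler_wpM2r.
Qed.

Lemma eq_intR f g : f =1 g -> intR f = intR g.
Proof. by move=> /funext ->. Qed.

Lemma intRD f g : L1 f -> L1 g -> intR (fun x => f x + g x) = intR f + intR g.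
Proof. by move=> hf hg; exact: RintegralD. Qed.

Lemma intRB f g : L1 f -> L1 g -> intR (fun x => f x - g x) = intR f - intR g.
Proof. by move=> hf hg; exact: RintegralB. Qed.

Lemma intRZ k f : L1 f -> intR (fun x => k * f x) = k * intR f.
Proof. by move=> hf; exact: RintegralZl. Qed.

Lemma intRN f : L1 f -> intR (fun x => - f x) = - intR f.
Proof.
by move=> hf; rewrite -mulN1r -intRZ//; apply: eq_intR => x; rewrite mulN1r.
Qed.

Lemma intR0 : intR (fun=> 0) = 0.
Proof. by rewrite /intR /Rintegral integral0. Qed.

Lemma intR_ge0 f : (forall x, 0 <= f x) -> 0 <= intR f.
Proof. by move=> f0; exact: Rintegral_ge0. Qed.

Lemma intR_le f g : L1 f -> L1 g -> (forall x, f x <= g x) -> intR f <= intR g.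
Proof. by move=> hf hg fg; apply: le_Rintegral. Qed.

Lemma intR_norm_le f g : L1 f -> L1 g -> (forall x, `|f x| <= g x) ->
  `|intR f| <= intR g.
Proof.
move=> hf hg fg; apply: (le_trans (le_normr_Rintegral measurableT hf)).
by apply: intR_le => //; exact: L1_abs.
Qed.

Lemma EFin_intR f : L1 f -> (\int[mu]_x (f x)%:E)%E = (intR f)%:E.
Proof. by move=> hf; rewrite /intR /Rintegral fineK//; exact: integrable_fin_num. Qed.

Lemma intR_ae_eq f g : measurable_fun setT f -> measurable_fun setT g ->
  {ae mu, forall x, f x = g x} -> intR f = intR g.
Proof.
move=> mf mg fg; rewrite /intR /Rintegral; congr fine.
apply: ae_eq_integral => //; [exact/measurable_EFinP|exact/measurable_EFinP|].
by apply: (aeS _ fg) => x /= ->.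
Qed.

Lemma L1_ae_eq f g : measurable_fun setT f -> measurable_fun setT g ->
  {ae mu, forall x, f x = g x} -> L1 f -> L1 g.
Proof.
move=> mf mg fg /integrableP[_ hf]; apply/integrableP; split.
  exact/measurable_EFinP.
apply: le_lt_trans hf; rewrite le_eqVlt; apply/orP; left; apply/eqP.
apply: ae_eq_integral => //.
- by apply: measurableT_comp => //; exact/measurable_EFinP.
- by apply: measurableT_comp => //; exact/measurable_EFinP.
- by apply: (aeS _ fg) => x /= ->.
Qed.

Lemma ge0_L1P f (M : R) : measurable_fun setT f -> (forall x, 0 <= f x) ->
  (\int[mu]_x (f x)%:E <= M%:E)%E -> L1 f /\ intR f <= M.
Proof.
move=> mf f0 fM.
have hf : L1 f.
  apply/integrableP; split; first exact/measurable_EFinP.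
  apply: le_lt_trans (ltry M); apply: le_trans fM.
  by under eq_integral do rewrite /= ger0_norm//.
by split => //; rewrite -lee_fin -EFin_intR.
Qed.

Lemma intR_dominated (f_ : nat -> R -> R) f g :
  (forall n, measurable_fun setT (f_ n)) -> measurable_fun setT f ->
  {ae mu, forall x, f_ n x @[n --> \oo] --> f x} ->
  L1 g -> (forall n x, `|f_ n x| <= g x) ->
  L1 f /\ intR (f_ n) @[n --> \oo] --> intR f.
Proof.
move=> mf_ mf ff hg fg.
have [] := @dominated_convergence _ _ _ mu _ measurableT
  (fun n => EFin \o f_ n) (EFin \o f) (EFin \o g).
- by move=> n; apply/measurable_EFinP; exact: mf_.
- exact/measurable_EFinP.
- by apply: (aeS _ ff) => x h _; apply: cvg_EFin => //; exact: nearW.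
- exact: hg.
- by apply: aeW => x n _ /=; rewrite lee_fin.
move=> hf _ cv; split => //.
have := fine_cvg; rewrite /intR /Rintegral; apply.
by rewrite fineK //; exact: integrable_fin_num.
Qed.

Lemma intR_fatou (f_ : nat -> R -> R) f (M : R) :
  (forall n, L1 (f_ n)) -> (forall n x, 0 <= f_ n x) ->
  measurable_fun setT f -> (forall x, 0 <= f x) ->
  {ae mu, forall x, f_ n x @[n --> \oo] --> f x} ->
  (forall n, intR (f_ n) <= M) -> L1 f /\ intR f <= M.
Proof.
move=> hf_ f_0 mf f0 ff fM; apply: ge0_L1P => //.
have mfn n : measurable_fun setT (EFin \o f_ n).
  by apply/measurable_EFinP; exact: L1_measurable.
have := @fatou _ _ _ mu _ measurableT (fun n => EFin \o f_ n) mfn.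
move=> /(_ (fun n x _ => f_0 n x)) h.
have -> : (\int[mu]_x (f x)%:E =
    \int[mu]_x limn_einf (fun n => (f_ n x)%:E))%E.
  apply: ae_eq_integral => //; first exact/measurable_EFinP.
    rewrite [X in measurable_fun _ X](_ : _ =
      (fun x => - limn_esup (fun n => - (f_ n x)%:E))%E).
      apply: measurableT_comp => //; apply: measurable_fun_limn_esup => n.
      exact: (measurableT_comp _ (mfn n)).
    by [].
  apply: (aeS _ ff) => x h' _ /=; apply/esym.
  apply: (cvg_limn_einf_sup _).1.
  by apply: cvg_EFin => //; exact: nearW.
apply: (le_trans h); rewrite limn_einf_lim; apply: lime_le.
  exact: is_cvg_einfs.
apply: nearW => n; apply: (@le_trans _ _ (\int[mu]_x (f_ n x)%:E)%E).
  by apply: ereal_inf_lbound; exists n => /=.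
by rewrite EFin_intR// lee_fin.
Qed.

Section Fubini.
Variables (F : R -> R -> R) (a c : R -> R).
Hypothesis mF : measurable_fun setT (fun z : R * R => F z.1 z.2).
Hypotheses (ha : L1 a) (hc : L1 c).
Hypothesis Fac : forall x y, `|F x y| <= a x * c y.

Let mE : measurable_fun setT (fun z : R * R => (F z.1 z.2)%:E).
Proof. exact/measurable_EFinP. Qed.

Let mF1 (x : R) : measurable_fun setT (F x).
Proof. exact: (measurableT_comp mF (pair1_measurable x)). Qed.

Let mF2 (y : R) : measurable_fun setT (F ^~ y).
Proof. exact: (measurableT_comp mF (pair2_measurable y)). Qed.

Let i12 : (mu \x mu)%E.-integrable setT (fun z : R * R => (F z.1 z.2)%:E).
Proof.
have mA : measurable_fun setT (fun z : R * R => `|(F z.1 z.2)%:E|%E).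
  exact: measurableT_comp.
  apply/integrable12ltyP => //=.
  apply: (@le_lt_trans _ _ (\int[mu]_x (`|a x| * intR (fun y => `|c y|))%:E)%E).
    apply: ge0_le_integral => //=.
    - by move=> x _; apply: integral_ge0.
    - have := @measurable_fun_fubini_tonelli_F _ _ (measurableTypeR R)
        (measurableTypeR R) R mu (fun z => `|(F z.1 z.2)%:E|%E).
      by move=> /(_ mA); apply.
    - apply/measurable_EFinP; apply: measurable_funM => //.
      by apply: measurableT_comp => //; exact: L1_measurable.
    - move=> x _; rewrite EFinM -EFin_intR; last exact: L1_abs.
      rewrite -ge0_integralZl//; last first.
        apply/measurable_EFinP; apply: measurableT_comp => //.
        exact: L1_measurable.
      apply: ge0_le_integral => //=.
      + by apply/measurable_EFinP; apply: measurableT_comp => //; exact: mF1.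
      + apply/measurable_EFinP; apply: measurable_funM => //.
        by apply: measurableT_comp => //; exact: L1_measurable.
      + move=> y _; rewrite lee_fin (le_trans (Fac _ _))// -normrM.
        exact: ler_norm.
  rewrite (@EFin_intR (fun x => _ * _)) ?ltry//.
  under eq_fun do rewrite mulrC; apply: L1Z; exact: L1_abs.
Qed.

Lemma L1_section1 x : L1 (F x).
Proof. by apply: (@L1_le _ (fun y => a x * c y)) => //; exact: L1Z. Qed.

Lemma L1_section2 y : L1 (F ^~ y).
Proof.
apply: (@L1_le _ (fun x => c y * a x)); [exact: mF2|exact: L1Z|].
by move=> x; rewrite mulrC.
Qed.

Let EF : fubini_F mu (fun z : R * R => (F z.1 z.2)%:E) =
  EFin \o (fun x => intR (F x)).
Proof.
by apply/funext => x /=; rewrite /fubini_F/= EFin_intR//; exact: L1_section1.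
Qed.

Let EG : fubini_G mu (fun z : R * R => (F z.1 z.2)%:E) =
  EFin \o (fun y => intR (F ^~ y)).
Proof.
by apply/funext => x /=; rewrite /fubini_G/= EFin_intR//; exact: L1_section2.
Qed.

Lemma L1_intR_section1 : L1 (fun x => intR (F x)).
Proof. by rewrite /L1 -EF; exact: (integrable_fubini_F i12). Qed.

Let fubini_EFin : (\int[mu]_x (intR (F x))%:E = \int[mu]_y (intR (F ^~ y))%:E)%E.
Proof.
transitivity (\int[mu]_x fubini_F mu (fun z : R * R => (F z.1 z.2)%:E) x)%E.
  by rewrite EF.
transitivity (\int[mu]_y fubini_G mu (fun z : R * R => (F z.1 z.2)%:E) y)%E.
  exact: (Fubini i12).
by rewrite EG.
Qed.

(** The domination by a product of integrable functions makes the kernel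
    integrable on the plane. *)
Lemma intR_fubini : intR (fun x => intR (F x)) = intR (fun y => intR (F ^~ y)).
Proof. by rewrite /intR/Rintegral; congr fine; exact: fubini_EFin. Qed.

End Fubini.

Lemma lebesgue_measure_translation (c : R) (A : set R) : measurable A ->
  pushforward mu ((fun x => x + c) : _ -> measurableTypeR R) A = mu A.
Proof.
have mt : measurable_fun setT ((fun x : R => x + c) : _ -> measurableTypeR R).
  exact: measurable_funD.
pose nu := pushforward mu ((fun x => x + c) : _ -> measurableTypeR R).
move=> mA; apply/esym/(@lebesgue_measure_unique R nu) => //.
move=> _ [[a b]] _ <-; rewrite /nu /pushforward.
rewrite /= [X in _ = mu X](_ : _ = `](a - c), (b - c)]%classic); last first.
  by apply/seteqP; split => x /=; rewrite !in_itv/= ltrBlDr lerBrDr.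
rewrite !lebesgue_measure_itv/= !lte_fin ltrD2r.
by case: ifP => // _; congr EFin; lra.
Qed.

Lemma ge0_integral_translation (f : R -> \bar R) (c : R) :
  measurable_fun setT f -> (forall x, 0 <= f x)%E ->
  (\int[mu]_x f (x + c)%R = \int[mu]_x f x)%E.
Proof.
move=> mf f0.
have mt : measurable_fun setT ((fun x : R => x + c) : _ -> measurableTypeR R).
  exact: measurable_funD.
transitivity (\int[pushforward mu ((fun x => (x + c)%R) : _ -> measurableTypeR R)]_x
   f x)%E; first by rewrite ge0_integral_pushforward.
by apply: eq_measure_integral => A mA _; exact: lebesgue_measure_translation.
Qed.

Lemma ge0_integral_opp (f : R -> \bar R) :
  measurable_fun setT f -> (forall x, 0 <= f x)%E ->
  (\int[mu]_x f (- x)%R = \int[mu]_x f x)%E.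
Proof.
move=> mf f0.
have mt : measurable_fun setT ((fun x : R => - x) : _ -> measurableTypeR R).
  exact: measurable_funN.
transitivity (\int[pushforward mu ((fun x => (- x)%R) : _ -> measurableTypeR R)]_x
   f x)%E; first by rewrite ge0_integral_pushforward.
by apply: eq_measure_integral => A mA _; exact: lebesgue_measureN.
Qed.

End Integrable.

(** * Square-integrable functions *)

Section L2.
Context {R : realType}.
Local Notation mu := (@lebesgue_measure R).
Implicit Types f g h b : R -> R.

Lemma le_sqr_norm (x y : R) : `|x| <= `|y| -> x ^+ 2 <= y ^+ 2.
Proof.
move=> xy; rewrite -(real_normK (num_real x)) -(real_normK (num_real y)).
by rewrite lerXn2r ?nnegrE.
Qed.

Lemma L1_opp f : L1 f -> L1 (fun x => f (- x)).
Proof.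
move=> /integrableP[mf hf]; apply/integrableP; split.
  exact: (measurableT_comp mf (@oppr_measurable R setT)).
rewrite (_ : (\int[mu]_x _)%E = \int[mu]_x `|(EFin \o f) x|)%E//.
rewrite -[RHS]ge0_integral_opp//; exact: measurableT_comp.
Qed.

Lemma intR_opp f : L1 f -> intR (fun x => f (- x)) = intR f.
Proof.
move=> hf; have mf := L1_measurable hf.
have -> : f = fun x => (`|f x| + f x) - `|f x| by apply/funext => x; lra.
have m2 : measurable_fun setT (fun x => `|f x| + f x).
  by apply: measurable_funD => //; exact: measurableT_comp.
have hE g : measurable_fun setT g -> (forall x, 0 <= g x) ->
    intR (fun x => g (- x)) = intR g.
  move=> mg g0; rewrite /intR /Rintegral; congr fine.
  rewrite (ge0_integral_opp (f := EFin \o g))//; exact/measurable_EFinP.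
have ha := L1_abs hf.
rewrite intRB//; last 2 first.
- exact: (L1D (L1_opp ha) (L1_opp hf)).
- exact: (L1_opp ha).
rewrite intRB//; last exact: L1D.
rewrite (hE (fun x => `|f x| + f x))//; last first.
  by move=> x; have := ler_norm (- f x); rewrite normrN; lra.
rewrite (hE (fun x => `|f x|))//.
exact: measurableT_comp.
Qed.

Definition L2 f := measurable_fun setT f /\ L1 (fun x => f x ^+ 2).

Lemma sq_L1_of_le f g : measurable_fun setT f -> L2 g ->
  (forall x, `|f x| <= `|g x|) -> L2 f.
Proof.
move=> mf [mg hg] fg; split => //.
apply: (L1_le _ hg); first exact: measurable_funX.
by move=> x; rewrite ger0_norm ?sqr_ge0// le_sqr_norm.
Qed.

Lemma L2_mul f g : L2 f -> L2 g -> L1 (fun x => f x * g x).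
Proof.
move=> [mf hf] [mg hg]; apply: (@L1_le _ _ (fun x => f x ^+ 2 + g x ^+ 2)).
- exact: measurable_funM.
- exact: L1D.
- move=> x; rewrite ler_norml; apply/andP; split.
    by have := sqr_ge0 (f x + g x); have := sqr_ge0 (f x); have := sqr_ge0 (g x); nra.
  by have := sqr_ge0 (f x - g x); have := sqr_ge0 (f x); have := sqr_ge0 (g x); nra.
Qed.

Lemma L2_measurable f : L2 f -> measurable_fun setT f. Proof. by case. Qed.
Lemma L2_sq f : L2 f -> L1 (fun x => f x ^+ 2). Proof. by case. Qed.

Lemma L2Z k f : L2 f -> L2 (fun x => k * f x).
Proof.
move=> [mf hf]; split; first exact: measurable_funM.
by apply: L1_eq (L1Z (k ^+ 2) hf) => x; rewrite exprMn.
Qed.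

Lemma L2D f g : L2 f -> L2 g -> L2 (fun x => f x + g x).
Proof.
move=> hf hg; have [mf f2] := hf; have [mg g2] := hg.
split; first exact: measurable_funD.
apply: L1_eq (L1D (L1D f2 (L1Z 2 (L2_mul hf hg))) g2) => x; ring.
Qed.

Lemma L2N f : L2 f -> L2 (fun x => - f x).
Proof. by move=> /(L2Z (-1)); under eq_fun do rewrite mulN1r. Qed.

Lemma L2B f g : L2 f -> L2 g -> L2 (fun x => f x - g x).
Proof. by move=> hf hg; apply: L2D => //; exact: L2N. Qed.

Lemma L2_opp f : L2 f -> L2 (fun x => f (- x)).
Proof.
move=> [mf hf]; split; last exact: (L1_opp hf).
exact: (measurableT_comp mf (@oppr_measurable R setT)).
Qed.

Lemma L2_abs f : L2 f -> L2 (fun x => `|f x|).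
Proof.
move=> hf; apply: (sq_L1_of_le _ hf) => [|x]; last by rewrite normr_id.
by apply: measurableT_comp => //; exact: L2_measurable.
Qed.

Lemma L2_0 : L2 (fun=> 0).
Proof. by split => //; apply: L1_eq (@L1_0 R) => x; rewrite expr0n. Qed.

Lemma L2_boundedM b f M : measurable_fun setT b -> (forall x, `|b x| <= M) ->
  L2 f -> L2 (fun x => b x * f x).
Proof.
move=> mb bM hf; apply: (sq_L1_of_le _ (L2Z M hf)).
  by apply: measurable_funM => //; exact: L2_measurable.
move=> x; rewrite !normrM ler_wpM2r// (le_trans (bM x))//.
by rewrite ger0_norm// (le_trans _ (bM x)).
Qed.

Definition nsq f := intR (fun x => f x ^+ 2).

Lemma nsq_ge0 f : 0 <= nsq f.
Proof. by apply: intR_ge0 => x; rewrite sqr_ge0. Qed.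

Lemma eq_nsq f g : f =1 g -> nsq f = nsq g.
Proof. by move=> /funext ->. Qed.

Lemma nsqN f : nsq (fun x => - f x) = nsq f.
Proof. by apply: eq_intR => x; rewrite sqrrN. Qed.

Lemma nsq_abs f : nsq (fun x => `|f x|) = nsq f.
Proof. by apply: eq_intR => x; rewrite real_normK ?num_real. Qed.

Lemma nsqZ k f : L2 f -> nsq (fun x => k * f x) = k ^+ 2 * nsq f.
Proof.
move=> hf; rewrite /nsq -intRZ; last exact: L2_sq.
by apply: eq_intR => x; rewrite exprMn.
Qed.

Lemma nsq_le f g : L2 f -> L2 g -> (forall x, `|f x| <= `|g x|) -> nsq f <= nsq g.
Proof.
move=> [_ hf] [_ hg] fg; apply: intR_le => // x.
exact: le_sqr_norm.
Qed.

Lemma nsqD f g : L2 f -> L2 g ->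
  nsq (fun x => f x + g x) = nsq f + 2 * intR (fun x => f x * g x) + nsq g.
Proof.
move=> hf hg; rewrite /nsq -intRZ; last exact: L2_mul.
rewrite -intRD; [|exact: L2_sq|exact: L1Z (L2_mul hf hg)].
rewrite -intRD; [|apply: L1D; [exact: L2_sq|exact: L1Z (L2_mul hf hg)]|exact: L2_sq].
by apply: eq_intR => x; ring.
Qed.

Lemma le_of_weighted_sum (p a b : R) : 0 <= a -> 0 <= b ->
  (forall t, 0 < t -> 2 * p <= t * a ^+ 2 + b ^+ 2 / t) -> p <= a * b.
Proof.
move=> a0 b0 h.
have [b0'|bp] := eqVneq b 0.
  subst b; rewrite mulr0; apply/ler_addgt0Pr => e e0.
  have := h (e / (1 + a ^+ 2)).
  have q : 0 < 1 + a ^+ 2 by have := sqr_ge0 a; lra.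
  rewrite divr_gt0// => /(_ isT); rewrite expr0n/= mul0r addr0 => h1.
  have : e / (1 + a ^+ 2) * a ^+ 2 <= e.
    rewrite mulrAC ler_pdivrMr// ler_wpM2l// ?ltW//; lra.
  lra.
have {bp} bp : 0 < b by rewrite lt_def bp.
have [a0'|ap] := eqVneq a 0.
  subst a; rewrite mul0r; apply/ler_addgt0Pr => e e0.
  have := h (b ^+ 2 / e).
  rewrite divr_gt0 ?exprn_gt0// => /(_ isT); rewrite expr0n/= mulr0 add0r.
  by rewrite invf_div mulrA mulrAC divff ?mul1r ?gt_eqF ?exprn_gt0//; lra.
have {ap} ap : 0 < a by rewrite lt_def ap.
have := h (b / a); rewrite divr_gt0// => /(_ isT).
have -> : b / a * a ^+ 2 + b ^+ 2 / (b / a) = 2 * (a * b).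
  by field; rewrite !gt_eqF.
lra.
Qed.

(** Cauchy-Schwarz, stated with bounds on the norms so that no square roots
    are needed. *)
Lemma cauchy_schwarz f g A B : L2 f -> L2 g -> 0 <= A -> 0 <= B ->
  nsq f <= A ^+ 2 -> nsq g <= B ^+ 2 -> `|intR (fun x => f x * g x)| <= A * B.
Proof.
move=> hf hg A0 B0 fA gB.
suff H f' g' : L2 f' -> L2 g' -> nsq f' <= A ^+ 2 -> nsq g' <= B ^+ 2 ->
    intR (fun x => f' x * g' x) <= A * B.
  rewrite ler_norml H// andbT.
  have := H (fun x => - f x) g (L2N hf) hg; rewrite nsqN => /(_ fA gB).
  under eq_intR do rewrite mulNr.
  by rewrite intRN; [lra|exact: L2_mul].
move=> {}hf {}hg {}fA {}gB; apply: le_of_weighted_sum => // t t0.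
have hfg := L2_mul hf hg.
rewrite -intRZ//.
apply: (@le_trans _ _ (intR (fun x => t * f' x ^+ 2 + t^-1 * g' x ^+ 2))).
  apply: intR_le.
  - exact: L1Z.
  - by apply: L1D; apply: L1Z; exact: L2_sq.
  - move=> x; rewrite -subr_ge0.
    have -> : t * f' x ^+ 2 + t^-1 * g' x ^+ 2 - 2 * (f' x * g' x) =
      t^-1 * (t * f' x - g' x) ^+ 2 by field; rewrite gt_eqF.
    by rewrite mulr_ge0 ?sqr_ge0// invr_ge0 ltW.
rewrite intRD ?intRZ; try (by exact: L2_sq); try (by apply: L1Z; exact: L2_sq).
apply: lerD; first by apply: ler_wpM2l; [exact: ltW|exact: fA].
rewrite [leRHS]mulrC; apply: ler_wpM2l; last exact: gB.
by rewrite invr_ge0 ltW.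
Qed.

Lemma minkowski2 f g A B : L2 f -> L2 g -> 0 <= A -> 0 <= B ->
  nsq f <= A ^+ 2 -> nsq g <= B ^+ 2 ->
  nsq (fun x => f x + g x) <= (A + B) ^+ 2.
Proof.
move=> hf hg A0 B0 fA gB; rewrite nsqD//.
have := cauchy_schwarz hf hg A0 B0 fA gB; rewrite ler_norml => /andP[_]; nra.
Qed.

Lemma nsqD_le f g : L2 f -> L2 g ->
  nsq (fun x => f x + g x) <= 2 * nsq f + 2 * nsq g.
Proof.
move=> hf hg; have := nsqD hf hg; have := nsqD hf (L2N hg).
rewrite nsqN; have := nsq_ge0 (fun x => f x - g x).
under [X in _ = _ + 2 * X + _ -> _]eq_intR do rewrite mulrN.
rewrite intRN; [lra|exact: L2_mul].
Qed.

Lemma nsqB_le f g : L2 f -> L2 g ->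
  nsq (fun x => f x - g x) <= 2 * nsq f + 2 * nsq g.
Proof. by move=> hf hg; have := nsqD_le hf (L2N hg); rewrite nsqN. Qed.

Lemma nsq_eq0 f : L2 f -> nsq f = 0 -> {ae mu, forall x, f x = 0}.
Proof.
move=> [mf hf] f0.
have : (\int[mu]_x `|(f x ^+ 2)%:E| = 0)%E.
  under eq_integral do rewrite gee0_abs ?lee_fin ?sqr_ge0//.
  by rewrite EFin_intR// -/(nsq f) f0.
have mf2 : measurable_fun setT (fun x => (f x ^+ 2)%:E).
  by apply/measurable_EFinP; exact: measurable_funX.
move=> /(ae_eq_integral_abs mu measurableT mf2) h.
apply: (aeS _ h) => x /= /(_ Logic.I) [fx0].
by apply/eqP; rewrite -sqrf_eq0 fx0.
Qed.

Definition L2cvg (f_ : nat -> R -> R) f :=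
  nsq (fun x => f_ n x - f x) @[n --> \oo] --> 0.

Lemma L2cvgP (f_ : nat -> R -> R) f :
  L2cvg f_ f <-> (forall e, 0 < e ->
    exists N, forall n, (N <= n)%N -> nsq (fun x => f_ n x - f x) <= e).
Proof.
split=> [/cvgrPdist_le h e /h [N _ hN]|h].
  exists N => n Nn; have := hN n Nn.
  by rewrite sub0r normrN ger0_norm ?nsq_ge0.
apply/cvgrPdist_le => e /h [N hN]; exists N => // n /= Nn.
by rewrite sub0r normrN ger0_norm ?nsq_ge0// hN.
Qed.

Lemma L2cvg_intR (f_ : nat -> R -> R) f g :
  (forall n, L2 (f_ n)) -> L2 f -> L2 g -> L2cvg f_ f ->
  intR (fun x => f_ n x * g x) @[n --> \oo] --> intR (fun x => f x * g x).
Proof.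
move=> hf_ hf hg /L2cvgP cf; apply/cvgrPdist_le => e e0.
have G0 : 0 < 1 + nsq g by have := nsq_ge0 g; lra.
have [N hN] := cf ((e / (1 + nsq g)) ^+ 2) (exprn_gt0 _ (divr_gt0 e0 G0)).
exists N => // n /= /hN hn.
rewrite distrC -intRB; try exact: L2_mul.
under eq_intR do rewrite -mulrBl.
have -> : e = e / (1 + nsq g) * (1 + nsq g) by rewrite divfK ?gt_eqF.
apply: cauchy_schwarz => //; [exact: L2B|by rewrite divr_ge0 ?ltW|exact: ltW|].
by have := nsq_ge0 g; nra.
Qed.

Lemma L2cvg_nsq (f_ : nat -> R -> R) f :
  (forall n, L2 (f_ n)) -> L2 f -> L2cvg f_ f ->
  nsq (f_ n) @[n --> \oo] --> nsq f.
Proof.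
move=> hf_ hf cf.
have h n : nsq (f_ n) = nsq (fun x => f_ n x - f x) +
    2 * intR (fun x => f_ n x * f x) - nsq f.
  have := nsqD (L2B (hf_ n) hf) hf.
  under [nsq _]eq_nsq do rewrite subrK.
  move=> ->; under [in LHS]eq_intR do rewrite mulrBl.
  rewrite intRB; try exact: L2_mul.
  rewrite (_ : intR (fun x => f x * f x) = nsq f); first ring.
  by apply: eq_intR => x; rewrite expr2.
have lE : 0 + 2 * intR (fun x => f x * f x) - nsq f = nsq f.
  rewrite (_ : intR (fun x => f x * f x) = nsq f); first ring.
  by apply: eq_intR => x; rewrite expr2.
rewrite (funext h) -[X in _ --> X]lE.
apply: cvgB; last exact: cvg_cst.
by apply: cvgD => //; apply: cvgMl_tmp; exact: L2cvg_intR.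
Qed.

Lemma L2cvgD (f_ g_ : nat -> R -> R) f g :
  (forall n, L2 (f_ n)) -> L2 f -> (forall n, L2 (g_ n)) -> L2 g ->
  L2cvg f_ f -> L2cvg g_ g ->
  L2cvg (fun n x => f_ n x + g_ n x) (fun x => f x + g x).
Proof.
move=> hf_ hf hg_ hg /L2cvgP cf /L2cvgP cg; apply/L2cvgP => e e0.
have e4 : 0 < e / 4 by rewrite divr_gt0.
have [N hN] := cf _ e4; have [M hM] := cg _ e4.
exists (maxn N M) => n; rewrite geq_max => /andP[/hN hn /hM hm].
rewrite (@eq_nsq _ (fun x => (f_ n x - f x) + (g_ n x - g x))); last first.
  by move=> x; ring.
by apply: (le_trans (nsqD_le (L2B _ _) (L2B _ _))) => //; lra.
Qed.

Lemma L2cvgZ k (f_ : nat -> R -> R) f :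
  (forall n, L2 (f_ n)) -> L2 f -> L2cvg f_ f ->
  L2cvg (fun n x => k * f_ n x) (fun x => k * f x).
Proof.
move=> hf_ hf cf; rewrite /L2cvg.
have h n : nsq (fun x => k * f_ n x - k * f x) =
    k ^+ 2 * nsq (fun x => f_ n x - f x).
  by rewrite -nsqZ; [apply: eq_nsq => x; rewrite mulrBr|exact: L2B].
rewrite (funext h).
by rewrite -[X in _ --> X](mulr0 (k ^+ 2)); apply: cvgMl_tmp.
Qed.

Lemma L2cvg_boundedM b (f_ : nat -> R -> R) f M :
  measurable_fun setT b -> (forall x, `|b x| <= M) ->
  (forall n, L2 (f_ n)) -> L2 f -> L2cvg f_ f ->
  L2cvg (fun n x => b x * f_ n x) (fun x => b x * f x).
Proof.
move=> mb bM hf_ hf cf.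
apply: (@squeeze_cvgr _ _ _ _ (fun=> 0) (fun n => M ^+ 2 * nsq (fun x => f_ n x - f x))).
- apply: nearW => n; rewrite nsq_ge0/= -nsqZ; last exact: L2B.
  rewrite (@eq_nsq _ (fun x => b x * (f_ n x - f x))); last first.
    by move=> x; rewrite mulrBr.
  apply: nsq_le.
  + by apply: (L2_boundedM mb bM); exact: L2B.
  + by apply: L2Z; exact: L2B.
  + move=> x; rewrite !normrM ler_wpM2r// (le_trans (bM x))// ler_norm//.
- exact: cvg_cst.
- by rewrite -[X in _ --> X](mulr0 (M ^+ 2)); apply: cvgMl_tmp.
Qed.

Lemma L2cvg_opp (f_ : nat -> R -> R) f :
  (forall n, L2 (f_ n)) -> L2 f -> L2cvg f_ f ->
  L2cvg (fun n x => f_ n (- x)) (fun x => f (- x)).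
Proof.
move=> hf_ hf; rewrite /L2cvg => cf.
have h n : nsq (fun x => f_ n (- x) - f (- x)) = nsq (fun x => f_ n x - f x).
  rewrite /nsq (intR_opp (f := fun x => (f_ n x - f x) ^+ 2))//.
  by have [] := L2B (hf_ n) hf.
by rewrite (funext h).
Qed.

Lemma nsq_opp f : L2 f -> nsq (fun x => f (- x)) = nsq f.
Proof. by move=> [_ hf]; rewrite /nsq (intR_opp hf). Qed.

Lemma L2cvg_unique (f_ : nat -> R -> R) f g :
  (forall n, L2 (f_ n)) -> L2 f -> L2 g -> L2cvg f_ f -> L2cvg f_ g ->
  {ae mu, forall x, f x = g x}.
Proof.
move=> hf_ hf hg /L2cvgP cf /L2cvgP cg.
have : nsq (fun x => f x - g x) = 0.
  apply/eqP; rewrite eq_le nsq_ge0 andbT; apply/ler_addgt0Pr => e e0; rewrite add0r.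
  have e4 : 0 < e / 4 by rewrite divr_gt0.
  have [N hN] := cf _ e4; have [M hM] := cg _ e4.
  have {}hN := hN _ (leq_maxl N M); have {}hM := hM _ (leq_maxr N M).
  rewrite (@eq_nsq _ (fun x => (f_ (maxn N M) x - g x) - (f_ (maxn N M) x - f x))).
    by apply: (le_trans (nsqB_le (L2B _ _) (L2B _ _))) => //; lra.
  by move=> x; ring.
move=> /(nsq_eq0 (L2B hf hg)) h; apply: (aeS _ h) => x /eqP.
by rewrite subr_eq0 => /eqP.
Qed.

Lemma nsq_ae_eq f g : measurable_fun setT f -> measurable_fun setT g ->
  {ae mu, forall x, f x = g x} -> nsq f = nsq g.
Proof.
move=> mf mg fg; apply: intR_ae_eq; [exact: measurable_funX|exact: measurable_funX|].
by apply: (aeS _ fg) => x ->.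
Qed.

Lemma L2_ae_eq f g : measurable_fun setT f -> measurable_fun setT g ->
  {ae mu, forall x, f x = g x} -> L2 f -> L2 g.
Proof.
move=> mf mg fg [_ hf]; split => //; apply: L1_ae_eq hf.
- exact: measurable_funX.
- exact: measurable_funX.
- by apply: (aeS _ fg) => x ->.
Qed.

(** Monotone convergence: bounded integrals force boundedness almost
    everywhere. *)
Lemma nondecreasing_ae_bounded (S : nat -> R -> R) (M : R) :
  (forall K, L1 (S K)) -> (forall K x, 0 <= S K x) ->
  (forall K x, S K x <= S K.+1 x) -> (forall K, intR (S K) <= M) ->
  {ae mu, forall x, exists B, forall K, S K x <= B}.
Proof.
move=> hS S0 SS SM.
have ndS x : {homo (fun n => (S n x)%:E) : m n / (m <= n)%N >-> (m <= n)%E}.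
  apply/nondecreasing_seqP => n; rewrite lee_fin; exact: SS.
have mS n : measurable_fun setT (EFin \o S n).
  by apply/measurable_EFinP; exact: L1_measurable.
pose lS x := limn (fun n => (S n x)%:E).
have cS x : (S n x)%:E @[n --> \oo] --> lS x.
  exact: ereal_nondecreasing_is_cvgn (ndS x).
have mlS : measurable_fun setT lS.
  by apply: (emeasurable_fun_cvg (fun n => EFin \o S n)) => // x _; exact: cS.
have lS0 x : (0 <= lS x)%E.
  apply: lime_ge; first exact: ereal_nondecreasing_is_cvgn (ndS x).
  by apply: nearW => n; rewrite lee_fin.
have ilS : mu.-integrable setT lS.
  apply/integrableP; split => //.
  apply: le_lt_trans (ltry M).
  under eq_integral do rewrite gee0_abs//.
  rewrite /lS monotone_convergence//; last by move=> n x _; rewrite lee_fin.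
  apply: lime_le.
    apply: ereal_nondecreasing_is_cvgn => m n mn.
    rewrite !EFin_intR// lee_fin; apply: intR_le => // x.
    by rewrite -lee_fin; exact: ndS.
  by apply: nearW => n; rewrite EFin_intR ?lee_fin.
have := integrable_ae measurableT ilS.
apply: aeS => x /(_ Logic.I) fx; exists (fine (lS x)) => K.
rewrite -lee_fin fineK//.
apply: lime_ge; first exact: ereal_nondecreasing_is_cvgn (ndS x).
by exists K => // n /= Kn; exact: ndS.
Qed.

Lemma absolutely_cvg_telescope (u : R^nat) (B : R) :
  (forall K, \sum_(k < K) `|u k.+1 - u k| <= B) -> cvgn u.
Proof.
move=> hB.
have cv : cvgn (series (fun k => u k.+1 - u k)).
  apply: normed_cvg; apply: nondecreasing_is_cvgn.
    apply/nondecreasing_seqP => n.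
    by rewrite /series/= [leRHS]big_nat_recr//= lerDl.
  exists B => _ [n _ <-]; have := hB n.
    by rewrite -(big_mkord xpredT (fun k => `|u k.+1 - u k|)).
have uE : u = fun n => u 0%N + series (fun k => u k.+1 - u k) n.
  by apply/funext => n; rewrite /series/= telescope_sumr// addrC subrK.
by rewrite uE; apply: is_cvgD => //; exact: is_cvg_cst.
Qed.

Lemma L2_sub_fatou (f_ : nat -> R -> R) (g f : R -> R) (e : R) :
  (forall n, L2 (f_ n)) -> L2 g -> measurable_fun setT f ->
  {ae mu, forall x, f_ n x @[n --> \oo] --> f x} ->
  (forall n, nsq (fun x => g x - f_ n x) <= e) ->
  L2 f /\ nsq (fun x => g x - f x) <= e.
Proof.
move=> hf_ hg mf cf he.
have mg := L2_measurable hg.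
have [h1 h2] : L1 (fun x => (g x - f x) ^+ 2) /\
    intR (fun x => (g x - f x) ^+ 2) <= e.
  apply: (@intR_fatou _ (fun n x => (g x - f_ n x) ^+ 2)) => //.
  - by move=> n; have [] := L2B hg (hf_ n).
  - by move=> n x; rewrite sqr_ge0.
  - by apply: measurable_funX; exact: measurable_funB.
  - by move=> x; rewrite sqr_ge0.
  - apply: (aeS _ cf) => x hx; rewrite expr2.
    under eq_fun do rewrite expr2.
    by apply: cvgM; apply: cvgB => //; exact: cvg_cst.
split => //.
have hgf : L2 (fun x => g x - f x) by split => //; exact: measurable_funB.
have := L2B hg hgf; rewrite (_ : (fun x => g x - (g x - f x)) = f)//.
by apply/funext => x; ring.
Qed.

(** Riesz-Fischer. A subsequence with square-summable increments converges
    almost everywhere, and Fatou's lemma turns pointwise convergence back into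
    convergence in the mean. *)
Lemma L2_complete (f_ : nat -> R -> R) : (forall n, L2 (f_ n)) ->
  (forall e, 0 < e -> exists N, forall m n, (N <= m)%N -> (N <= n)%N ->
    nsq (fun x => f_ m x - f_ n x) <= e) ->
  exists2 f, L2 f & L2cvg f_ f.
Proof.
move=> hf_ cau.
have p8 k : 0 < (8^-1 : R) ^+ k by rewrite exprn_gt0.
have /choice[N hN] : forall k, exists N, forall m n, (N <= m)%N -> (N <= n)%N ->
    nsq (fun x => f_ m x - f_ n x) <= 8^-1 ^+ k by move=> k; exact: cau.
pose phi k := (\sum_(i < k.+1) N i)%N.
have phiN k : (N k <= phi k)%N by rewrite /phi big_ord_recr/= leq_addl.
have phiS j k : (j <= k)%N -> (phi j <= phi k)%N.
  move=> /subnK <-; elim: (k - j)%N => // i; rewrite addSn => h.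
  by apply: (leq_trans h); rewrite /phi [leqRHS]big_ord_recr/= leq_addr.
pose g k := f_ (phi k).
have gS k : nsq (fun x => g k.+1 x - g k x) <= 8^-1 ^+ k.
  by apply: hN; [apply: (leq_trans (phiN k)); exact: phiS|exact: phiN].
pose S K x := \sum_(k < K) 2 ^+ k * (g k.+1 x - g k x) ^+ 2.
have hgd k : L2 (fun x => g k.+1 x - g k x) by apply: L2B; exact: hf_.
have hS K : L1 (S K) /\ intR (S K) <= 2 - 2^-1 ^+ K *+ 2.
  elim: K => [|K [h1 h2]].
    rewrite /S (_ : (fun _ => _) = fun=> 0) ?intR0; last first.
      by apply/funext => x; rewrite big_ord0.
    by split; [exact: L1_0|rewrite expr0; lra].
  have -> : S K.+1 = fun x => S K x + 2 ^+ K * (g K.+1 x - g K x) ^+ 2.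
    by apply/funext => x; rewrite /S big_ord_recr.
  have h3 : L1 (fun x => 2 ^+ K * (g K.+1 x - g K x) ^+ 2).
    by apply: L1Z; have [] := hgd K.
  split; first exact: L1D.
  rewrite intRD// intRZ; last by have [] := hgd K.
  have h4 := gS K; have q : 0 < 2 ^+ K :> R by rewrite exprn_gt0.
  have h5 : 2 ^+ K * nsq (fun x => g K.+1 x - g K x) <= 2^-1 ^+ K.
    apply: (@le_trans _ _ (2 ^+ K * 8^-1 ^+ K)); first by rewrite ler_wpM2l// ltW.
    rewrite -exprMn lerXn2r ?nnegrE//; lra.
  apply: (le_trans (lerD h2 h5)); rewrite exprS -mulr_natr; lra.
have : {ae mu, forall x, exists B, forall K, S K x <= B}.
  apply: (@nondecreasing_ae_bounded _ 2).
  - by move=> K; have [] := hS K.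
  - by move=> K x; apply: sumr_ge0 => k _; rewrite mulr_ge0 ?sqr_ge0 ?exprn_ge0.
  - move=> K x; rewrite /S big_ord_recr/= lerDl mulr_ge0 ?sqr_ge0 ?exprn_ge0//.
  - move=> K; have [_] := hS K; have : 0 < (2^-1 : R) ^+ K by rewrite exprn_gt0.
    by rewrite -mulr_natr; lra.
have cvg_of_bounded x : (exists B, forall K, S K x <= B) -> cvgn (g ^~ x).
  move=> [B hB]; apply: (@absolutely_cvg_telescope _ (B + 2)) => K.
  have h k : `|g k.+1 x - g k x| <= 2 ^+ k * (g k.+1 x - g k x) ^+ 2 + 2^-1 ^+ k.
    set d := g k.+1 x - g k x; rewrite -(real_normK (num_real d)) exprVn.
    set p := 2 ^+ k; have p0 : 0 < p by rewrite exprn_gt0.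
    have q0 : 0 < p^-1 by rewrite invr_gt0.
    have pq : p * p^-1 = 1 by rewrite divff// gt_eqF.
    have : 0 <= p * (`|d| - p^-1) ^+ 2 by rewrite mulr_ge0 ?sqr_ge0// ltW.
    have -> : p * (`|d| - p^-1) ^+ 2 = p * `|d| ^+ 2 - 2 * (p * p^-1) * `|d| +
      (p * p^-1) * p^-1 by ring.
    rewrite pq; have := normr_ge0 d; lra.
  apply: (@le_trans _ _
      (\sum_(k < K) (2 ^+ k * (g k.+1 x - g k x) ^+ 2 + 2^-1 ^+ k))).
    by apply: ler_sum => k _; exact: h.
  rewrite big_split/=; apply: lerD; first exact: hB.
  suff -> : \sum_(i < K) 2^-1 ^+ i = 2 - 2^-1 ^+ K *+ 2 :> R.
    have : 0 < (2^-1 : R) ^+ K by rewrite exprn_gt0.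
    by rewrite -mulr_natr; lra.
  elim: K => [|K IH]; first by rewrite big_ord0 expr0; lra.
  by rewrite big_ord_recr/= IH exprS; field.
move=> /(aeS cvg_of_bounded)[Z [mZ Z0 /subsetCPl ZP]].
pose g' k (x : R) : R := (x \notin (Z : set R))%:R * g k x.
pose f (x : R) : R := limn (g' ^~ x).
have cg' (x : R) : g' k x @[k --> \oo] --> f x.
  suff : cvgn (g' ^~ x) by [].
  rewrite /g'; have [xZ|xZ] := boolP (x \in Z).
    by under eq_fun do rewrite mul0r; exact: is_cvg_cst.
  under eq_fun do rewrite mul1r; apply: ZP => /= xZ'.
  by move: xZ; rewrite mem_set.
have mg' k : measurable_fun setT (g' k).
  apply: measurable_funM; last exact: (L2_measurable (hf_ (phi k))).
  rewrite (_ : (fun _ => _) = (\1_(~` (Z : set R)) : R -> R)).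
    by apply: measurable_indic; exact: (measurableC mZ).
  by apply/funext => x; rewrite indicE in_setC.
have mf : measurable_fun setT f.
  by apply: (measurable_fun_cvg mg') => x _; exact: cg'.
have gf : {ae mu, forall x, g n x @[n --> \oo] --> f x}.
  exists Z; split => // x /= nx; apply: contrapT => xZ; apply: nx.
  have := cg' x; rewrite /g'; under eq_fun do rewrite (memNset xZ) mul1r.
  by [].
have key k n : (phi k <= n)%N -> L2 f /\ nsq (fun x => f_ n x - f x) <= 8^-1 ^+ k.
  move=> kn; apply: (@L2_sub_fatou (fun j => g (j + k)%N)) => //.
  - by move=> j; exact: hf_.
  - by apply: (aeS _ gf) => x; rewrite (cvg_shiftn k (fun n => g n x)).
  - move=> j; apply: hN; first exact: leq_trans kn.
    by apply: (leq_trans (phiN k)); apply: phiS; rewrite leq_addl.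
exists f; first by have [] := key 0%N _ (leqnn _).
apply/L2cvgP => e e0.
have /cvgrPdist_lt /(_ e e0)[K _ hK] : (8^-1 : R) ^+ k @[k --> \oo] --> 0.
  by apply: cvg_expr; rewrite ger0_norm; lra.
exists (phi K) => n /key[_ h]; apply: (le_trans h).
have := hK K (leqnn _); rewrite sub0r normrN ger0_norm; last exact: ltW.
exact: ltW.
Qed.

End L2.

(** * Integrals over intervals and integration by parts *)

Section Intervals.
Context {R : realType}.
Local Notation mu := (@lebesgue_measure R).
Implicit Types (f g p q F : R -> R) (a b : R).

Lemma derive_continuous F f : (forall x, is_derive x (1:R) F (f x)) -> continuous F.
Proof.
move=> dF x; apply: differentiable_continuous; apply/derivable1_diffP.
by have := dF x => -[].
Qed.

Lemma contD f g : continuous f -> continuous g -> continuous (fun x => f x + g x).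
Proof. by move=> cf cg x; apply: cvgD; [exact: cf|exact: cg]. Qed.

Lemma contB f g : continuous f -> continuous g -> continuous (fun x => f x - g x).
Proof. by move=> cf cg x; apply: cvgB; [exact: cf|exact: cg]. Qed.

Lemma contM f g : continuous f -> continuous g -> continuous (fun x => f x * g x).
Proof. by move=> cf cg x; apply: cvgM; [exact: cf|exact: cg]. Qed.

Lemma contZ c f : continuous f -> continuous (fun x => c * f x).
Proof. by move=> cf x; apply: cvgMl_tmp; exact: cf. Qed.

Lemma contN f : continuous f -> continuous (fun x => - f x).
Proof. by move=> cf x; apply: cvgN; exact: cf. Qed.

Lemma contX f n : continuous f -> continuous (fun x => f x ^+ n).
Proof.
move=> cf; elim: n => [|n IH]; first exact: cst_continuous.
by under eq_fun do rewrite exprS; exact: contM.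
Qed.

Lemma continuous_measurable f : continuous f -> measurable_fun setT f.
Proof. exact: continuous_measurable_fun. Qed.

Definition box a b (x : R) : R := ((a <= x) && (x <= b))%:R.

Lemma boxE a b : box a b = \1_(`[a, b]%classic : set R) :> (R -> R).
Proof.
apply/funext => x; rewrite indicE /box; congr (_%:R); congr nat_of_bool.
by apply/idP/idP; rewrite inE/= in_itv.
Qed.

Lemma box_measurable a b : measurable_fun setT (box a b).
Proof. by rewrite boxE; exact: measurable_indic. Qed.

Lemma box_ge0 a b x : 0 <= box a b x. Proof. exact: ler0n. Qed.

Lemma box_le1 a b x : box a b x <= 1.
Proof. by rewrite /box; case: (_ && _). Qed.

Lemma box_norm_le1 a b x : `|box a b x| <= 1.
Proof. by rewrite ger0_norm ?box_ge0// box_le1. Qed.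

Lemma box_sq a b x : box a b x ^+ 2 = box a b x.
Proof. by rewrite /box; case: (_ && _); rewrite ?expr1n ?expr0n. Qed.

Lemma box1 a b x : a <= x -> x <= b -> box a b x = 1.
Proof. by rewrite /box => -> ->. Qed.

Lemma box0 a b x : ~~ ((a <= x) && (x <= b)) -> box a b x = 0.
Proof. by rewrite /box => /negbTE ->. Qed.

Lemma boxM_restrict a b f : (fun x => box a b x * f x) = f \_ `[a, b].
Proof.
apply/funext => x; rewrite patchE boxE indicE; case: ifPn => h.
  by rewrite mul1r.
by rewrite mul0r.
Qed.

Lemma intR_box a b f :
  intR (fun x => box a b x * f x) = \int[mu]_(x in `[a, b]) f x.
Proof. by rewrite boxM_restrict Rintegral_mkcond. Qed.

Lemma L1_boxM a b f : L1 f -> L1 (fun x => box a b x * f x).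
Proof. by move=> hf; exact: (L1_boundedM (@box_measurable a b) (box_norm_le1 a b)). Qed.

Lemma integrable_cont a b f : continuous f -> mu.-integrable `[a, b] (EFin \o f).
Proof.
move=> cf; apply: continuous_compact_integrable; first exact: segment_compact.
exact: continuous_subspaceT.
Qed.

Lemma L1_box a b f : continuous f -> L1 (fun x => box a b x * f x).
Proof.
move=> cf; rewrite boxM_restrict /L1 -restrict_EFin.
by apply/integrable_restrict => //; rewrite setTI; exact: integrable_cont.
Qed.

Lemma L2_box a b f : continuous f -> L2 (fun x => box a b x * f x).
Proof.
move=> cf; split.
  apply: measurable_funM; [exact: box_measurable|exact: continuous_measurable].
under eq_fun do rewrite exprMn box_sq expr2.
by apply: L1_box => x; apply: cvgM; exact: cf.
Qed.

Lemma intR_FTC a b F f : a <= b -> (forall x, is_derive x (1:R) F (f x)) ->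
  continuous f -> intR (fun x => box a b x * f x) = F b - F a.
Proof.
rewrite le_eqVlt => /predU1P[<-|ab] dF cf.
  by rewrite intR_box set_itv1 Rintegral_set1 subrr.
have cF := derive_continuous dF.
have dF1 x : derivable F x 1 by have := dF x => -[].
rewrite intR_box /Rintegral (@continuous_FTC2 _ f F)//.
- exact: continuous_subspaceT.
- split => //; [exact: (cvg_at_right_filter (cF a))|exact: (cvg_at_left_filter (cF b))].
- by move=> x _; rewrite derive1E; case: (dF x).
Qed.

Lemma box_cvg_center (x : R) : \forall n \near \oo, box (- n%:R) n%:R x = 1.
Proof.
exists (Num.bound x) => // n /= hn.
have : `|x| <= n%:R.
  apply: (le_trans (ltW (archi_boundP (normr_ge0 x)))); rewrite ler_nat.
  by apply: leq_trans hn; rewrite /Num.bound normr_id.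
by rewrite ler_norml => /andP[h1 h2]; exact: box1.
Qed.

Lemma box_cvg (f : R -> R) x :
  box (- n%:R) n%:R x * f x @[n --> \oo] --> f x.
Proof.
apply: cvg_near_cst; apply: filterS (box_cvg_center x) => n ->.
by rewrite mul1r.
Qed.

Lemma box_cvg_ae f :
  {ae mu, forall x, box (- n%:R) n%:R x * f x @[n --> \oo] --> f x}.
Proof. by apply: aeW => x; exact: box_cvg. Qed.

Lemma intR_box_cvg f : L1 f ->
  intR (fun x => box (- n%:R) n%:R x * f x) @[n --> \oo] --> intR f.
Proof.
move=> hf; have [//|//|//|//|//|_ //] := @intR_dominated _
  (fun n x => box (- n%:R) n%:R x * f x) f (fun x => `|f x|).
- by move=> n; apply: measurable_funM; [exact: box_measurable|exact: L1_measurable].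
- exact: L1_measurable.
- by apply: aeW => x; exact: box_cvg.
- exact: L1_abs.
- by move=> n x; rewrite normrM ler_piMl ?box_norm_le1.
Qed.

Lemma L2cvg_box f : L2 f -> L2cvg (fun n x => box (- n%:R) n%:R x * f x) f.
Proof.
move=> hf; rewrite /L2cvg.
have E n : nsq (fun x => box (- n%:R) n%:R x * f x - f x) =
    nsq f - intR (fun x => box (- n%:R) n%:R x * f x ^+ 2).
  rewrite /nsq -intRB; [|exact: L2_sq|by apply: L1_boxM; exact: L2_sq].
  apply: eq_intR => x; rewrite sqrrB exprMn box_sq -mulr_natr.
  by ring.
rewrite (funext E) -(subrr (nsq f)).
by apply: cvgB; [exact: cvg_cst|apply: intR_box_cvg; exact: L2_sq].
Qed.

(** A function bounded by the integrals of its values and of its derivative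
    over the next unit interval: integrate the derivative of
    y |-> (x + 1 - y) p(y). *)
Lemma sup_le_intR p q x : (forall x, is_derive x (1:R) p (q x)) -> continuous q ->
  `|p x| <= intR (fun y => box x (x + 1) y * (`|p y| + `|q y|)).
Proof.
move=> dp cq; have cp := derive_continuous dp.
have dr y : is_derive y (1:R) (fun y => (x + 1 - y) * p y) ((x + 1 - y) * q y - p y).
  have d1 : is_derive y (1:R) (fun y : R => x + 1 - y) (- 1).
    by apply: is_derive_eq; ring.
  by apply: is_derive_eq; rewrite /GRing.scale/=; ring.
have cr : continuous (fun y => (x + 1 - y) * q y - p y).
  move=> y; apply: cvgB; last exact: cp.
  apply: cvgM; last exact: cq.
  by apply: cvgB; [exact: cvg_cst|exact: cvg_id].
have x1 : x <= x + 1 by lra.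
have := intR_FTC x1 dr cr; rewrite subrr mul0r sub0r.
rewrite (_ : x + 1 - x = 1) ?mul1r; last lra.
move=> /(congr1 Num.norm); rewrite normrN => <-.
have ca : continuous (fun y => `|p y| + `|q y|).
  by move=> y; apply: cvgD; apply: cvg_norm; [exact: cp|exact: cq].
apply: intR_norm_le; [exact: L1_box|exact: L1_box|move=> y].
rewrite normrM ger0_norm ?box_ge0//.
have [/andP[h1 h2]|h] := boolP ((x <= y) && (y <= x + 1)); last first.
  by rewrite box0 // !mul0r.
rewrite box1// !mul1r (le_trans (ler_normB _ _))// addrC lerD2l normrM.
by rewrite ler_piMl// ger0_norm; lra.
Qed.

(** By the previous lemma |p x| is at most a tail of a convergent integral. *)
Lemma decay p q : (forall x, is_derive x (1:R) p (q x)) -> continuous q ->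
  L1 p -> L1 q -> p n%:R @[n --> \oo] --> 0 /\ p (- n%:R) @[n --> \oo] --> 0.
Proof.
move=> dp cq hp hq.
have ha : L1 (fun y => `|p y| + `|q y|) by apply: L1D; exact: L1_abs.
have ma := L1_measurable ha.
suff H (c : nat -> R) : (forall y, \forall n \near \oo, ~~ ((c n <= y) && (y <= c n + 1))) ->
    p (c n) @[n --> \oo] --> 0.
  split; apply: H => y.
    exists (Num.bound y) => // n /= hn.
    have h : `|y| < n%:R.
      apply: (lt_le_trans (archi_boundP (normr_ge0 y))); rewrite ler_nat.
      by apply: leq_trans hn; rewrite /Num.bound normr_id.
    by rewrite leNgt (le_lt_trans (ler_norm y) h).
  exists (Num.bound y).+1 => // n /= hn.
  have h : `|y| < n%:R - 1.
    rewrite ltrBrDr; apply: (@lt_le_trans _ _ ((Num.bound y).+1%:R)); last by rewrite ler_nat.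
    rewrite -natr1 ltrD2r (lt_le_trans (archi_boundP (normr_ge0 y)))// ler_nat.
    by rewrite /Num.bound normr_id.
  rewrite negb_and; apply/orP; right; rewrite -ltNge.
  by move: h; rewrite ltr_norml; lra.
move=> hc.
have [||||_ h] := @intR_dominated _
    (fun n y => box (c n) (c n + 1) y * (`|p y| + `|q y|)) (fun=> 0) _ _ _ _ ha.
- by move=> n; apply: measurable_funM => //; exact: box_measurable.
- exact: measurable_cst.
- apply: aeW => x; apply: cvg_near_cst; apply: filterS (hc x) => n hn.
  by rewrite box0// mul0r.
- move=> n y; rewrite normrM ger0_norm ?box_ge0// ger0_norm ?addr_ge0//.
  by rewrite ler_piMl ?addr_ge0// box_le1.
apply: norm_cvg0; rewrite intR0 in h.
apply: (@squeeze_cvgr _ _ _ _ (fun=> 0) _ _ _ _ _ h); last exact: cvg_cst.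
by apply: nearW => n; rewrite normr_ge0 sup_le_intR.
Qed.

Lemma intR_derive0 p q : (forall x, is_derive x (1:R) p (q x)) -> continuous q ->
  L1 p -> L1 q -> intR q = 0.
Proof.
move=> dp cq hp hq; have [c1 c2] := decay dp cq hp hq.
have E n : intR (fun x => box (- n%:R) n%:R x * q x) = p n%:R - p (- n%:R).
  by apply: intR_FTC => //; rewrite (@le_trans _ _ 0)// oppr_le0.
have h : intR (fun x => box (- n%:R) n%:R x * q x) @[n --> \oo] --> (0 : R).
  by rewrite (funext E) -[X in _ --> X](subr0 0); exact: cvgB.
exact: (cvg_unique (@Rhausdorff R) (intR_box_cvg hq) h).
Qed.

End Intervals.

(** * The Poisson kernel *)

Section Poisson.
Context {R : realType}.
Local Notation mu := (@lebesgue_measure R).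
Implicit Types (f g : R -> R) (a b x y z e : R).

Lemma intR_box_split a b c f : a <= b -> b <= c -> continuous f ->
  intR (fun x => box a c x * f x) =
  intR (fun x => box a b x * f x) + intR (fun x => box b c x * f x).
Proof.
move=> ab bc cf; rewrite !intR_box.
have := @Rintegral_itvB R f (BLeft a) (BRight c) b (integrable_cont a c cf).
rewrite !bnd_simp => /(_ ab bc) h.
rewrite -[X in _ + X]Rintegral_itv_obnd_cbnd; last first.
  apply: (integrableS _ _ _ (integrable_cont b c cf)) => //.
  by apply: subset_itvr; rewrite bnd_simp.
by rewrite -h addrC subrK.
Qed.

Lemma box_opp a b x : box a b (- x) = box (- b) (- a) x.
Proof. by rewrite /box lerNr lerNl andbC. Qed.

Lemma intR_box_sym b f : 0 <= b -> continuous f -> (forall x, f (- x) = f x) ->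
  intR (fun x => box (- b) b x * f x) = 2 * intR (fun x => box 0 b x * f x).
Proof.
move=> b0 cf fe; rewrite (@intR_box_split _ 0)// ?oppr_le0//.
rewrite mulr_natl mulr2n; congr (_ + _).
rewrite -(intR_opp (L1_box 0 b cf)); apply: eq_intR => x.
by rewrite box_opp oppr0 fe.
Qed.

Lemma intR_odd f : L1 f -> (forall x, f (- x) = - f x) -> intR f = 0.
Proof.
move=> hf fo; have := intR_opp hf; under eq_intR do rewrite fo.
rewrite intRN//; lra.
Qed.

Definition expabs e x : R := expR (- (e * `|x|)).

Lemma expabs_ge0 e x : 0 <= expabs e x. Proof. exact: expR_ge0. Qed.

Lemma expabs_le1 e x : 0 <= e -> expabs e x <= 1.
Proof. by move=> e0; rewrite /expabs expR_le1 oppr_le0 mulr_ge0. Qed.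

Lemma expabs_opp e x : expabs e (- x) = expabs e x.
Proof. by rewrite /expabs normrN. Qed.

Lemma continuous_expabs e : continuous (expabs e).
Proof.
move=> x; rewrite /expabs.
apply: (@continuous_comp _ _ _ (fun x => - (e * `|x|)) expR).
  apply: continuousN; apply: continuousM; first exact: cst_continuous.
  exact: norm_continuous.
exact: continuous_expR.
Qed.

Lemma is_derive_lin k x : is_derive x (1:R) (fun y => k * y) k.
Proof. by apply: is_derive_eq; rewrite /GRing.scale/=; ring. Qed.

Lemma continuous_lin k : continuous (fun y : R => k * y).
Proof. by move=> x; exact: mulrl_continuous. Qed.

Lemma continuous_cosl z : continuous (fun x : R => cos (z * x)).
Proof.
move=> x; apply: (@continuous_comp _ _ _ (fun x => z * x) cos).
  exact: continuous_lin.
exact: continuous_cos.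
Qed.

Lemma continuous_sinl z : continuous (fun x : R => sin (z * x)).
Proof.
move=> x; apply: (@continuous_comp _ _ _ (fun x => z * x) sin).
  exact: continuous_lin.
exact: continuous_sin.
Qed.

Section fixed_e.
Variable e : R.
Hypothesis e0 : 0 < e.

Let expd x : is_derive x (1:R) (fun y => expR (- e * y)) (expR (- e * x) * - e).
Proof. exact: (is_derive1_comp (is_derive_expR _) (is_derive_lin _ _)). Qed.

Let box_expabs n f x : box 0 n x * (expabs e x * f x) = box 0 n x * (expR (- e * x) * f x).
Proof.
have [/andP[x0 xn]|h] := boolP ((0 <= x) && (x <= n)); last by rewrite box0// !mul0r.
by rewrite /expabs ger0_norm// mulNr.
Qed.

Let expRn : expR (- e * n%:R) @[n --> \oo] --> 0.
Proof.
have h : (expR (- e)) ^+ n @[n --> \oo] --> 0.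
  by apply: cvg_expr; rewrite ger0_norm ?expR_ge0// expR_lt1 oppr_lt0.
by under eq_fun do rewrite mulrC expRM_natl.
Qed.

Lemma L1_expabs : L1 (expabs e).
Proof.
have [] // := @intR_fatou _ (fun n x => box (- n%:R) n%:R x * expabs e x) (expabs e) (2 * e^-1).
- by move=> n; apply: L1_box; exact: continuous_expabs.
- by move=> n x; rewrite mulr_ge0 ?box_ge0 ?expabs_ge0.
- by apply: continuous_measurable; exact: continuous_expabs.
- exact: expabs_ge0.
- exact: box_cvg_ae.
- move=> n; rewrite intR_box_sym//; [|exact: continuous_expabs|exact: expabs_opp].
  rewrite ler_wpM2l//.
  rewrite (_ : intR _ = intR (fun x => box 0 n%:R x * expR (- e * x))); last first.
    by apply: eq_intR => x; have := box_expabs n%:R (fun=> 1) x; rewrite !mulr1.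
  have dE x : is_derive x (1:R) (fun x => - e^-1 * expR (- e * x)) (expR (- e * x)).
    apply: is_derive_eq; rewrite /GRing.scale/=.
    by field; rewrite gt_eqF.
  rewrite (intR_FTC _ dE)//; last exact: derive_continuous expd.
  rewrite mulr0 expR0 mulr1 mulNr opprK addrC gerDl oppr_le0.
  by rewrite mulr_ge0 ?expR_ge0// invr_ge0 ltW.
Qed.

Lemma intR_expabs_cos z :
  intR (fun x => expabs e x * cos (z * x)) = 2 * (e / (e ^+ 2 + z ^+ 2)).
Proof.
have D0 : 0 < e ^+ 2 + z ^+ 2 by rewrite ltr_pwDl ?exprn_gt0 ?sqr_ge0.
have c1 : continuous (fun x => expabs e x * cos (z * x)).
  by move=> x; apply: cvgM; [exact: continuous_expabs|exact: continuous_cosl].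
have hL : L1 (fun x => expabs e x * cos (z * x)).
  apply: (L1_le _ L1_expabs); first exact: continuous_measurable.
  move=> x; rewrite normrM ger0_norm ?expabs_ge0// ler_piMr ?expabs_ge0//.
  exact: cos_max.
apply: (cvg_unique (@Rhausdorff R) (intR_box_cvg hL)).
pose F x := expR (- e * x) * (z * sin (z * x) - e * cos (z * x)) / (e ^+ 2 + z ^+ 2).
have dF x : is_derive x (1:R) F (expR (- e * x) * cos (z * x)).
  have ds := is_derive1_comp (is_derive_sin _) (is_derive_lin z x).
  have dc := is_derive1_comp (is_derive_cos _) (is_derive_lin z x).
  rewrite /F; apply: is_derive_eq; rewrite /GRing.scale/=.
  by field; rewrite gt_eqF.
have E n : intR (fun x => box (- n%:R) n%:R x * (expabs e x * cos (z * x))) =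
    2 * (F n%:R - F 0).
  rewrite intR_box_sym//; last by move=> x; rewrite expabs_opp mulrN cosN.
  congr (_ * _); rewrite (eq_intR (fun x => box_expabs n%:R (fun x => cos (z * x)) x)).
  apply: intR_FTC => // x; apply: cvgM; last exact: continuous_cosl.
  exact: (derive_continuous expd).
have F0 : F 0 = - (e / (e ^+ 2 + z ^+ 2)).
  by rewrite /F !mulr0 expR0 sin0 cos0; field; rewrite gt_eqF.
have h : F n%:R @[n --> \oo] --> 0.
  apply: norm_cvg0.
  apply: (@squeeze_cvgr _ _ _ _ (fun=> 0)
    (fun n => (`|z| + e) / (e ^+ 2 + z ^+ 2) * expR (- e * n%:R))).
  - apply: nearW => n; rewrite normr_ge0/= /F.
    have Di : 0 <= (e ^+ 2 + z ^+ 2)^-1 by rewrite invr_ge0 ltW.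
    rewrite 2!normrM (ger0_norm (expR_ge0 _)) (ger0_norm Di) -mulrA [leRHS]mulrC.
    apply: ler_wpM2l; first exact: expR_ge0.
    apply: ler_wpM2r => //; apply: (le_trans (ler_normB _ _)).
    rewrite !normrM (ger0_norm (ltW e0)); apply: lerD.
      by apply: ler_piMr => //; exact: sin_max.
    by apply: ler_piMr; [exact: ltW|exact: cos_max].
  - exact: cvg_cst.
  - rewrite -[X in _ --> X](mulr0 ((`|z| + e) / (e ^+ 2 + z ^+ 2))).
    exact: cvgMl_tmp.
rewrite /= (funext E) (_ : 2 * _ = 2 * (0 - F 0)); last by rewrite F0 sub0r opprK.
by apply: cvgMl_tmp; apply: cvgB => //; exact: cvg_cst.
Qed.

End fixed_e.

Definition poisson e x : R := e / (e ^+ 2 + x ^+ 2).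

Lemma poisson_ge0 e x : 0 < e -> 0 <= poisson e x.
Proof. by move=> e0; rewrite divr_ge0 ?ltW// ltr_pwDl ?exprn_gt0 ?sqr_ge0. Qed.

Lemma continuous_poisson e : 0 < e -> continuous (poisson e).
Proof.
move=> e0 x; rewrite /poisson; apply: cvgM; first exact: cvg_cst.
apply: cvgV; first by rewrite gt_eqF// ltr_pwDl ?exprn_gt0 ?sqr_ge0.
by apply: cvgD; [exact: cvg_cst|exact: exprn_continuous].
Qed.

Lemma intR_poisson e c : 0 < e ->
  L1 (fun x => poisson e (x - c)) /\ intR (fun x => poisson e (x - c)) = pi.
Proof.
move=> e0.
pose F x := atan (e^-1 * (x - c)).
have dF x : is_derive x (1:R) F (poisson e (x - c)).
  have d1 : is_derive x (1:R) (fun y => e^-1 * (y - c)) e^-1.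
    by apply: is_derive_eq; rewrite /GRing.scale/=; ring.
  apply: (is_derive_eq (is_derive1_comp (is_derive1_atan _) d1)).
  rewrite /poisson; set u := x - c; have u0 : 0 < e ^+ 2 + u ^+ 2.
    by rewrite ltr_pwDl ?exprn_gt0 ?sqr_ge0.
  have -> : 1 + (e^-1 * u) ^+ 2 = (e ^+ 2 + u ^+ 2) / e ^+ 2.
    by field; rewrite gt_eqF.
  by field; rewrite !gt_eqF.
have cp : continuous (fun x => poisson e (x - c)).
  move=> x; apply: (@continuous_comp _ _ _ (fun x => x - c) (poisson e)).
    by apply: continuousB; [exact: cvg_id|exact: cst_continuous].
  exact: continuous_poisson.
have E n : intR (fun x => box (- n%:R) n%:R x * poisson e (x - c)) =
    F n%:R - F (- n%:R).
  by apply: intR_FTC => //; rewrite (@le_trans _ _ 0)// oppr_le0.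
have hL : L1 (fun x => poisson e (x - c)).
  have [] // := @intR_fatou _ (fun n x => box (- n%:R) n%:R x * poisson e (x - c)) (fun x => poisson e (x - c)) pi.
  - by move=> n; exact: L1_box.
  - by move=> n x; rewrite mulr_ge0 ?box_ge0 ?poisson_ge0.
  - exact: continuous_measurable.
  - by move=> x; exact: poisson_ge0.
  - exact: (box_cvg_ae (fun x => poisson e (x - c))).
  - move=> n; rewrite E /F.
    have := atan_ltpi2 (e^-1 * (n%:R - c)); have := atan_gtNpi2 (e^-1 * (- n%:R - c)).
    lra.
split => //; apply: (cvg_unique (@Rhausdorff R) (intR_box_cvg hL)).
have ny k : (n%:R * e^-1 + k : R) @[n --> \oo] --> +oo.
  apply/cvgryPge => A; near=> n; rewrite -lerBlDr -ler_pdivrMr ?invr_gt0// invrK.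
  near: n; exact: nbhs_infty_ger.
have h1 : F n%:R @[n --> \oo] --> pi / 2.
  rewrite /F; under eq_fun do rewrite mulrBr (mulrC _ _%:R).
  by apply: (cvg_comp _ (@atan R)); [exact: ny|exact: cvgy_atan].
have h2 : F (- n%:R) @[n --> \oo] --> - (pi / 2).
  rewrite /F; under eq_fun do rewrite -opprD mulrN atanN mulrDr (mulrC _ _%:R).
  apply: cvgN.
  by apply: (cvg_comp _ (@atan R)); [exact: ny|exact: cvgy_atan].
rewrite /= (funext E) (_ : pi = pi / 2 - - (pi / 2)); last by lra.
exact: cvgB.
Unshelve. all: by end_near. Qed.

End Poisson.

(** * The Hartley transform and Plancherel's theorem *)

Section Hartley.
Context {R : realType}.
Local Notation mu := (@lebesgue_measure R).
Implicit Types (f g h : R -> R) (a b x y z : R).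

Definition cas x : R := cos x + sin x.

Lemma cas_norm x : `|cas x| <= 2.
Proof.
rewrite (le_trans (ler_normD _ _))//; have := cos_max x; have := sin_max x; lra.
Qed.

Lemma continuous_cas : continuous cas.
Proof. by move=> x; apply: cvgD; [exact: continuous_cos|exact: continuous_sin]. Qed.

Lemma continuous_casl z : continuous (fun x => cas (x * z)).
Proof.
move=> x; apply: (@continuous_comp _ _ _ (fun x => x * z) cas).
  exact: mulrr_continuous.
exact: continuous_cas.
Qed.

Lemma casM x y z : cas (x * z) * cas (y * z) = cos ((x - y) * z) + sin ((x + y) * z).
Proof. by rewrite mulrBl (mulrDl x y) cosB sinD /cas; ring. Qed.

Definition cF : R := (Num.sqrt (2 * pi))^-1.

Lemma cF_gt0 : 0 < cF.
Proof. by rewrite invr_gt0 sqrtr_gt0 mulr_gt0 ?pi_gt0. Qed.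

Lemma cF_sq : cF ^+ 2 = (2 * pi)^-1.
Proof. by rewrite exprVn sqr_sqrtr// mulr_ge0 ?pi_ge0. Qed.

Lemma cF_sq2 : cF ^+ 2 * 2 = pi^-1.
Proof. by rewrite cF_sq invfM mulrAC mulVf ?mul1r. Qed.

Lemma cF_le1 : cF <= 1.
Proof.
have h : cF ^+ 2 <= 1.
  rewrite cF_sq invf_le1 ?mulr_gt0 ?pi_gt0//.
  by have := @pi_ge2 R; lra.
have := cF_gt0; nra.
Qed.

Definition hart f z : R := cF * intR (fun x => f x * cas (x * z)).

Lemma L1_cas f z : L1 f -> L1 (fun x => f x * cas (x * z)).
Proof.
move=> hf; under eq_fun do rewrite mulrC; apply: (L1_boundedM _ _ hf).
  by apply: continuous_measurable; exact: continuous_casl.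
by move=> x; exact: cas_norm.
Qed.

Lemma hart_norm f z : L1 f -> `|hart f z| <= 2 * intR (fun x => `|f x|).
Proof.
move=> hf; rewrite /hart normrM (ger0_norm (ltW cF_gt0)).
apply: (@le_trans _ _ (`|intR (fun x => f x * cas (x * z))|)).
  by rewrite ler_piMl// cF_le1.
rewrite -intRZ; last exact: L1_abs.
apply: intR_norm_le; [exact: L1_cas|exact: L1Z (L1_abs hf)|move=> x].
by rewrite normrM mulrC ler_wpM2r// cas_norm.
Qed.

Lemma measurable_cas2 : measurable_fun setT (fun t : R * R => cas (t.1 * t.2)).
Proof.
apply: measurableT_comp; first exact: continuous_measurable continuous_cas.
by apply: measurable_funM; [exact: measurable_fst|exact: measurable_snd].
Qed.

Lemma measurable_fst2 f : measurable_fun setT f ->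
  measurable_fun setT (fun t : R * R => f t.1).
Proof. by move=> mf; exact: measurableT_comp. Qed.

Lemma measurable_snd2 f : measurable_fun setT f ->
  measurable_fun setT (fun t : R * R => f t.2).
Proof. by move=> mf; exact: measurableT_comp. Qed.

Lemma hart_sym_kernel f g : L1 f -> L1 g ->
  measurable_fun setT (fun t : R * R => f t.1 * g t.2 * cas (t.1 * t.2)) /\
  (forall x y, `|f x * g y * cas (x * y)| <= (2 * `|f x|) * `|g y|).
Proof.
move=> hf hg; split.
  apply: measurable_funM; last exact: measurable_cas2.
  apply: measurable_funM.
    by apply: measurable_fst2; exact: L1_measurable.
  by apply: measurable_snd2; exact: L1_measurable.
move=> x y; rewrite !normrM mulrC -mulrA ler_wpM2r ?mulr_ge0//.
exact: cas_norm.
Qed.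

Lemma hart_measurable f : L1 f -> measurable_fun setT (hart f).
Proof.
move=> hf; have he := @L1_expabs R 1 ltr01.
have [mk dk] := hart_sym_kernel he hf.
have := L1_intR_section1 mk (L1Z 2 (L1_abs he)) (L1_abs hf) dk.
move=> /L1_measurable mg.
rewrite (_ : hart f = fun z => cF * (expR (1 * `|z|) *
   intR (fun y => expabs 1 z * f y * cas (z * y)))); last first.
  apply/funext => z; rewrite /hart; congr (_ * _).
  under [X in _ = _ * X]eq_intR do rewrite -mulrA [z * _]mulrC.
  rewrite intRZ; last exact: L1_cas.
  by rewrite mulrA /expabs expRN divff ?mul1r// gt_eqF// expR_gt0.
apply: measurable_funM => //; apply: measurable_funM => //.
apply: continuous_measurable => z; apply: (@continuous_comp _ _ _ (fun z => 1 * `|z|) expR).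
  by apply: cvgM; [exact: cvg_cst|exact: norm_continuous].
exact: continuous_expR.
Qed.

Lemma hart_sym f g : L1 f -> L1 g ->
  intR (fun x => f x * hart g x) = intR (fun x => hart f x * g x).
Proof.
move=> hf hg; have [mk dk] := hart_sym_kernel hf hg.
have := intR_fubini mk (L1Z 2 (L1_abs hf)) (L1_abs hg) dk.
have E1 x : intR (fun y => f x * g y * cas (x * y)) = f x * intR (fun y => g y * cas (y * x)).
  under eq_intR do rewrite -mulrA [x * _]mulrC.
  by rewrite intRZ//; exact: L1_cas.
have E2 y : intR (fun x => f x * g y * cas (x * y)) = g y * intR (fun x => f x * cas (x * y)).
  under eq_intR do rewrite [f _ * g y]mulrC -mulrA.
  by rewrite intRZ//; exact: L1_cas.
rewrite (eq_intR E1) (eq_intR E2) => h.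
have hb k q : L1 k -> L1 q -> L1 (fun x => k x * hart q x).
  move=> hk hq; under eq_fun do rewrite mulrC.
  by apply: (L1_boundedM (hart_measurable hq) _ hk) => x; exact: hart_norm.
have hb' k q : L1 k -> L1 q -> L1 (fun x => k x * intR (fun y => q y * cas (y * x))).
  move=> hk hq; apply: L1_eq (L1Z cF^-1 (hb _ _ hk hq)) => x.
  by rewrite /hart; field; rewrite gt_eqF// cF_gt0.
have E3 k q : L1 k -> L1 q -> intR (fun x => k x * hart q x) =
    cF * intR (fun x => k x * intR (fun y => q y * cas (y * x))).
  move=> hk hq; rewrite -intRZ; last exact: hb'.
  by apply: eq_intR => x; rewrite /hart; ring.
rewrite E3// h -E3//; apply: eq_intR => x; exact: mulrC.
Qed.

(** The functions to which the elementary form of Plancherel's theorem is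
    applied: truncations of continuous functions are of this kind. *)
Definition tame f (B : R) : Prop :=
  [/\ L1 f, (forall x, `|f x| <= B) & {ae mu, forall x, {for x, continuous f}}].

Lemma intR_cas_cas e x y : 0 < e ->
  intR (fun z => expabs e z * (cas (x * z) * cas (y * z))) = 2 * poisson e (y - x).
Proof.
move=> e0; have hb (b : R -> R) M : continuous b -> (forall z, `|b z| <= M) ->
    L1 (fun z => expabs e z * b z).
  move=> cb bM; under eq_fun do rewrite mulrC.
  by apply: (L1_boundedM _ bM (L1_expabs e0)); exact: continuous_measurable.
have hc : L1 (fun z => expabs e z * cos ((x - y) * z)).
  by apply: (hb _ 1); [exact: continuous_cosl|move=> z; exact: cos_max].
have hs : L1 (fun z => expabs e z * sin ((x + y) * z)).
  by apply: (hb _ 1); [exact: continuous_sinl|move=> z; exact: sin_max].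
under eq_intR do rewrite casM mulrDr.
rewrite intRD// (intR_odd hs); last first.
  by move=> z; rewrite expabs_opp mulrN sinN mulrN.
rewrite addr0 intR_expabs_cos// /poisson.
by congr (2 * (_ / (_ + _))); ring.
Qed.

(** Damping the inversion integral by exp(-e |z|) amounts to smoothing f with
    the Poisson kernel. *)
Lemma damped_inversion f e x : 0 < e -> L1 f ->
  hart (fun z => expabs e z * hart f z) x = pi^-1 * intR (fun y => f y * poisson e (y - x)).
Proof.
move=> e0 hf; rewrite /hart; have he := L1_expabs e0.
pose F z y := expabs e z * cas (z * x) * f y * cas (y * z).
have hec : L1 (fun z => expabs e z * cas (z * x)) by exact: L1_cas.
have [mk dk] := hart_sym_kernel hec hf.
have dk' z y : `|expabs e z * cas (z * x) * f y * cas (z * y)| <=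
    2 * `|expabs e z * cas (z * x)| * `|f y| by exact: dk.
have /= := intR_fubini mk (L1Z 2 (L1_abs hec)) (L1_abs hf) dk'.
have E1 z : intR (fun y => expabs e z * cas (z * x) * f y * cas (z * y)) =
    expabs e z * intR (fun y => f y * cas (y * z)) * cas (z * x).
  transitivity (intR (fun y => (expabs e z * cas (z * x)) * (f y * cas (y * z)))).
    by apply: eq_intR => y; rewrite -mulrA [z * y]mulrC.
  by rewrite intRZ; [ring|exact: L1_cas].
have E2 y : intR (fun z => expabs e z * cas (z * x) * f y * cas (z * y)) =
    2 * (f y * poisson e (y - x)).
  rewrite mulrCA -intR_cas_cas// -intRZ.
    by apply: eq_intR => z; rewrite [x * z]mulrC [y * z]mulrC; ring.
  apply: L1_eq (L1_cas y (L1_cas x he)) => z.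
  by rewrite [x * z]mulrC [y * z]mulrC mulrA.
have hp : L1 (fun y => f y * poisson e (y - x)).
  under eq_fun do rewrite mulrC; apply: (L1_boundedM (M := e^-1) _ _ hf).
    by apply: L1_measurable; have [] := intR_poisson x e0.
  move=> y; rewrite ger0_norm ?poisson_ge0// /poisson ler_pdivrMr.
    by rewrite mulrDr expr2 mulKf ?gt_eqF// lerDl mulr_ge0 ?sqr_ge0// invr_ge0 ltW.
  by rewrite ltr_pwDl ?exprn_gt0 ?sqr_ge0.
rewrite (eq_intR E1) (eq_intR E2) intRZ// => h.
rewrite (_ : (fun z => _) = fun z => cF * (expabs e z * intR (fun y => f y * cas (y * z)) * cas (z * x))).
  rewrite intRZ.
    by rewrite h mulrA -expr2 mulrA cF_sq2.
  rewrite -(funext E1).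
  exact: (L1_intR_section1 mk (L1Z 2 (L1_abs hec)) (L1_abs hf) dk').
by apply/funext => z; ring.
Qed.

(** The Poisson kernel is an approximate identity. *)
Lemma poisson_cvg f B x : L1 f -> (forall y, `|f y| <= B) -> {for x, continuous f} ->
  pi^-1 * intR (fun y => f y * poisson (k.+1%:R^-1) (y - x)) @[k --> \oo] --> f x.
Proof.
move=> hf fB cf; apply/cvgrPdist_le => d d0.
have /cvgrPdist_le /(_ (d / 2)) := cf; rewrite divr_gt0// => /(_ isT).
move=> [r /= r0 hr].
have B0 : 0 <= B by rewrite (le_trans _ (fB x)).
pose C := 2 * B * ((1 + r ^+ 2) / r ^+ 2).
have C0 : 0 <= C by rewrite !mulr_ge0 ?invr_ge0 ?addr_ge0 ?sqr_ge0.
have near_far y : `|f y - f x| <= d / 2 + C * ((y - x) ^+ 2 / (1 + (y - x) ^+ 2)).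
  have [yx|yx] := ltP `|x - y| r.
    rewrite distrC (le_trans (hr _ yx))// lerDl mulr_ge0// divr_ge0 ?sqr_ge0//.
    by rewrite addr_ge0 ?sqr_ge0.
  apply: (@le_trans _ _ (2 * B)).
    by rewrite (le_trans (ler_normB _ _))//; have := fB x; have := fB y; lra.
  apply: (@le_trans _ _ (C * ((y - x) ^+ 2 / (1 + (y - x) ^+ 2)))); last by lra.
  rewrite /C -[leRHS]mulrA ler_peMr ?mulr_ge0//.
  have r2 : r ^+ 2 <= (y - x) ^+ 2.
    by apply: le_sqr_norm; rewrite distrC (ger0_norm (ltW r0)).
  have q0 : 0 < r ^+ 2 by rewrite exprn_gt0.
  set u := (y - x) ^+ 2 in r2 *.
  rewrite mulf_div ler_pdivlMr ?mul1r; last by rewrite mulr_gt0//; lra.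
  by nra.
near=> k; set e := k.+1%:R^-1 : R.
have e0 : 0 < e by rewrite invr_gt0 ltr0n.
have [hp ip] := intR_poisson x e0.
have [h1 i1] := intR_poisson x ltr01.
have fp : L1 (fun y => f y * poisson e (y - x)).
  by apply: (L1_boundedM (L1_measurable hf) fB hp).
have -> : f x - pi^-1 * intR (fun y => f y * poisson e (y - x)) =
    pi^-1 * intR (fun y => f x * poisson e (y - x) - f y * poisson e (y - x)).
  rewrite intRB//; last exact: L1Z.
  by rewrite intRZ// ip mulrBr mulrCA mulVf ?mulr1// gt_eqF ?pi_gt0.
rewrite normrM ger0_norm ?invr_ge0 ?pi_ge0// mulrC ler_pdivrMr ?pi_gt0//.
apply: (@le_trans _ _ (intR (fun y => d / 2 * poisson e (y - x) + C * e * poisson 1 (y - x)))).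
  apply: intR_norm_le.
  - by apply: L1B => //; exact: L1Z.
  - by apply: L1D; exact: L1Z.
  move=> y; rewrite -mulrBl normrM (ger0_norm (poisson_ge0 _ e0)) distrC.
  apply: (le_trans (ler_wpM2r (poisson_ge0 _ e0) (near_far y))).
  rewrite mulrDl lerD2l /poisson expr1n -2!(mulrA C).
  set u := (y - x) ^+ 2; have u0 : 0 <= u by rewrite sqr_ge0.
  have q : 0 < e ^+ 2 by rewrite exprn_gt0.
  have q1 : 0 < 1 + u by lra.
  have q2 : 0 < e ^+ 2 + u by lra.
  apply: ler_wpM2l => //.
  rewrite mulf_div ler_pdivrMr ?mulr_gt0//.
  have -> : e * (1 / (1 + u)) * ((1 + u) * (e ^+ 2 + u)) = e * (e ^+ 2 + u).
    by field; rewrite gt_eqF.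
  by nra.
rewrite intRD; [|exact: L1Z|exact: L1Z].
rewrite (intRZ (d / 2) hp) (intRZ (C * e) h1) ip i1.
have : C * e <= d / 2.
  rewrite /e ler_pdivrMr ?ltr0n// mulrC -ler_pdivrMr ?divr_gt0//.
  near: k; exists (Num.bound (C / (d / 2))) => // k /= hk.
  apply: (le_trans (ltW (archi_boundP _))); first by rewrite divr_ge0// divr_ge0// ltW.
  by rewrite ler_nat; exact: leqW.
by have := @pi_gt0 R; nra.
Unshelve. all: by end_near. Qed.

End Hartley.

Section HartleyL2.
Context {R : realType}.
Local Notation mu := (@lebesgue_measure R).
Implicit Types (f g h : R -> R) (a b x y z : R).

Lemma L2_of_bounded f B : L1 f -> (forall x, `|f x| <= B) -> L2 f.
Proof.
move=> hf fB; split; first exact: L1_measurable.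
by under eq_fun do rewrite expr2; exact: (L1_boundedM (L1_measurable hf) fB hf).
Qed.

Lemma tameD f g A B : tame f A -> tame g B -> tame (fun x => f x + g x) (A + B).
Proof.
move=> [f1 f2 f3] [g1 g2 g3]; split; first exact: L1D.
  by move=> x; rewrite (le_trans (ler_normD _ _))// lerD.
by apply: (aeS _ (aeI f3 g3)) => x [cf cg]; apply: cvgD; [exact: cf|exact: cg].
Qed.

Lemma tameZ k f B : tame f B -> tame (fun x => k * f x) (`|k| * B).
Proof.
move=> [f1 f2 f3]; split; first exact: L1Z.
  by move=> x; rewrite normrM ler_wpM2l.
by apply: (aeS _ f3) => x cf; apply: cvgMl_tmp; exact: cf.
Qed.

Lemma tame_L2 f B : tame f B -> L2 f.
Proof. by move=> [f1 f2 _]; exact: (L2_of_bounded f1 f2). Qed.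

Lemma continuous_box_bounded a b f : continuous f ->
  exists B, forall x, `|box a b x * f x| <= B.
Proof.
move=> cf.
have [M hM] : exists M, forall x, a <= x -> x <= b -> `|f x| <= M.
  have := @segment_compact R a b => /(continuous_compact (continuous_subspaceT cf)).
  move=> /compact_bounded [M [Mr hM]]; exists (M + 1) => x ax xb.
  by apply: (hM (M + 1)); [lra|exists x => //=; rewrite in_itv/= ax xb].
exists `|M| => x; have [/andP[h1 h2]|hx] := boolP ((a <= x) && (x <= b)).
  by rewrite box1// mul1r (le_trans (hM _ h1 h2))// ler_norm.
by rewrite box0// mul0r normr0.
Qed.

Lemma box_continuous_at a b x : x != a -> x != b -> {for x, continuous (box a b)}.
Proof.
move=> xa xb; have [h|h] := boolP ((a <= x) && (x <= b)).
- move: h => /andP[h1 h2].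
  apply: cvg_near_cst; near=> y; rewrite [RHS]box1// box1// ltW//.
    by near: y; apply: lt_nbhsr; rewrite lt_def xa.
  by near: y; apply: lt_nbhsl; rewrite lt_def eq_sym xb.
- move: h; rewrite negb_and -!ltNge => /orP[h|h]; apply: cvg_near_cst; near=> y.
    rewrite [RHS]box0 ?box0// negb_and -!ltNge ?h//.
    by apply/orP; left; near: y; exact: lt_nbhsl.
  rewrite [RHS]box0 ?box0// negb_and -!ltNge ?h ?orbT//.
  by apply/orP; right; near: y; exact: lt_nbhsr.
Unshelve. all: by end_near. Qed.

Lemma ae_neq a : {ae mu, forall x, x != a}.
Proof.
exists [set a]; split => //; first exact: lebesgue_measure_set1.
by move=> x /= /negP; rewrite negbK => /eqP.
Qed.

Lemma tame_box a b f : continuous f -> exists B, tame (fun x => box a b x * f x) B.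
Proof.
move=> cf; have [B hB] := continuous_box_bounded a b cf; exists B; split => //.
  exact: L1_box.
apply: (aeS _ (aeI (ae_neq a) (ae_neq b))) => x [xa xb].
by apply: cvgM; [exact: box_continuous_at|exact: cf].
Qed.

Lemma hartD f g z : L1 f -> L1 g ->
  hart (fun x => f x + g x) z = hart f z + hart g z.
Proof.
move=> hf hg; rewrite /hart -mulrDr -intRD; try exact: L1_cas.
by congr (_ * _); apply: eq_intR => x; rewrite mulrDl.
Qed.

Lemma hartZ k f z : L1 f -> hart (fun x => k * f x) z = k * hart f z.
Proof.
move=> hf; rewrite /hart [RHS]mulrCA -(intRZ k); last exact: L1_cas.
by congr (_ * _); apply: eq_intR => x; rewrite mulrA.
Qed.

Lemma expabs_cvg1 x : expabs k.+1%:R^-1 x @[k --> \oo] --> (1 : R).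
Proof.
have h : - (k.+1%:R^-1 * `|x|) @[k --> \oo] --> - (0 * `|x|).
  by apply: cvgN; apply: cvgMr_tmp; exact: cvg_harmonic.
rewrite mul0r oppr0 in h.
rewrite -[X in _ --> X](@expR0 R).
by apply: (cvg_comp _ (@expR R)) h _; exact: continuous_expR.
Qed.

(** Plancherel for tame functions: pair f with its damped inversion integral
    and let the damping go to zero. *)
Lemma plancherel_tame f B : tame f B -> L2 (hart f) /\ nsq (hart f) = nsq f.
Proof.
move=> [hf fB cf]; have f2 := L2_of_bounded hf fB.
pose e k : R := k.+1%:R^-1.
have e0 k : 0 < e k by rewrite invr_gt0 ltr0n.
have mh := hart_measurable hf.
have he k : L1 (fun z => expabs (e k) z * hart f z).
  under eq_fun do rewrite mulrC.
  by apply: (L1_boundedM mh _ (L1_expabs (e0 k))) => z; exact: hart_norm.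
have he2 k : L1 (fun z => expabs (e k) z * hart f z ^+ 2).
  under eq_fun do rewrite expr2 mulrA mulrC.
  by apply: (L1_boundedM mh _ (he k)) => z; exact: hart_norm.
pose G k x := pi^-1 * intR (fun y => f y * poisson (e k) (y - x)).
have GE k x : hart (fun z => expabs (e k) z * hart f z) x = G k x.
  exact: damped_inversion.
have mG k : measurable_fun setT (G k).
  by rewrite -(funext (GE k)); exact: hart_measurable.
have GB k x : `|G k x| <= B.
  have [hp ip] := intR_poisson x (e0 k).
  rewrite /G normrM ger0_norm ?invr_ge0 ?pi_ge0// mulrC ler_pdivrMr ?pi_gt0//.
  rewrite -ip -intRZ//; apply: intR_norm_le.
  - exact: (L1_boundedM (L1_measurable hf) fB hp).
  - exact: L1Z.
  - by move=> y; rewrite normrM (ger0_norm (poisson_ge0 _ (e0 k))) ler_wpM2r// poisson_ge0.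
have I1 k : intR (fun z => expabs (e k) z * hart f z ^+ 2) = intR (fun x => f x * G k x).
  transitivity (intR (fun x => f x * hart (fun z => expabs (e k) z * hart f z) x)).
    2: by apply: eq_intR => x; rewrite GE.
  by rewrite (hart_sym hf (he k)); apply: eq_intR => z; rewrite expr2; ring.
have [_ c1] : L1 (fun x => f x * f x) /\
    intR (fun x => f x * G k x) @[k --> \oo] --> intR (fun x => f x * f x).
  apply: (@intR_dominated _ _ _ (fun x => B * `|f x|)).
  - by move=> n; apply: measurable_funM => //; exact: L1_measurable.
  - by apply: measurable_funM; exact: L1_measurable.
  - apply: (aeS _ cf) => x cx; apply: cvgMl_tmp; exact: (poisson_cvg hf fB cx).
  - by apply: L1Z; exact: L1_abs.
  - by move=> n x; rewrite normrM mulrC ler_wpM2r.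
have pw : {ae mu, forall x, expabs (e n) x * hart f x ^+ 2 @[n --> \oo] --> hart f x ^+ 2}.
  apply: aeW => x; rewrite -[X in _ --> X]mul1r.
  by apply: cvgMr_tmp; exact: expabs_cvg1.
have h2 : L2 (hart f).
  split => //; have [] // := @intR_fatou _ (fun k x => expabs (e k) x * hart f x ^+ 2)
    (fun x => hart f x ^+ 2) (intR (fun x => B * `|f x|)).
  - by move=> n x; rewrite mulr_ge0 ?expabs_ge0 ?sqr_ge0.
  - exact: measurable_funX.
  - by move=> x; rewrite sqr_ge0.
  - move=> n; rewrite I1; apply: intR_le.
    + apply: (L1_le _ (L1Z B (L1_abs hf))).
        by apply: measurable_funM => //; exact: L1_measurable.
      by move=> x; rewrite normrM mulrC ler_wpM2r.
    + by apply: L1Z; exact: L1_abs.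
    + move=> x; rewrite (le_trans (ler_norm _))// normrM mulrC ler_wpM2r//.
split => //.
have [_ c2] : L1 (fun x => hart f x ^+ 2) /\
    intR (fun z => expabs (e k) z * hart f z ^+ 2) @[k --> \oo] --> intR (fun x => hart f x ^+ 2).
  apply: (@intR_dominated _ _ _ (fun x => hart f x ^+ 2)) => //.
  - by move=> n; exact: L1_measurable.
  - exact: measurable_funX.
  - exact: L2_sq.
  - move=> n x; rewrite normrM (ger0_norm (expabs_ge0 _ _)) ger0_norm ?sqr_ge0//.
    by rewrite ler_piMl ?sqr_ge0// expabs_le1// ltW.
rewrite (funext I1) in c2.
rewrite /nsq (cvg_unique (@Rhausdorff R) c2 c1).
by apply: eq_intR => x; rewrite expr2.
Qed.

Definition trunc (n : nat) f (x : R) : R := box (- n%:R) n%:R x * f x.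

(** The Hartley transform on L2, as a limit in the mean of the transforms of
    truncations. *)
Definition is_hartley f h := L2 h /\ L2cvg (fun n => hart (trunc n f)) h.

Lemma tame_trunc n f : continuous f -> exists B, tame (trunc n f) B.
Proof. exact: tame_box. Qed.

Lemma L1_trunc n f : continuous f -> L1 (trunc n f).
Proof. exact: L1_box. Qed.

Lemma L2_hart_trunc n f : continuous f -> L2 (hart (trunc n f)).
Proof. by move=> /(tame_trunc n)[B /plancherel_tame[]]. Qed.

Lemma plancherel_trunc m n f : continuous f ->
  nsq (fun z => hart (trunc m f) z - hart (trunc n f) z) =
  nsq (fun x => trunc m f x - trunc n f x).
Proof.
move=> cf; have [A tm] := tame_trunc m cf; have [B tn] := tame_trunc n cf.
have := (plancherel_tame (tameD tm (tameZ (-1) tn))).2.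
rewrite (_ : hart _ = fun z => hart (trunc m f) z - hart (trunc n f) z).
  by move=> ->; apply: eq_nsq => x; rewrite mulN1r.
apply/funext => z; rewrite hartD ?hartZ ?mulN1r//; try exact: L1_trunc.
by apply: L1Z; exact: L1_trunc.
Qed.

(** By Plancherel's theorem the transforms of the truncations form a Cauchy sequence. *)
Lemma hartley_exists f : continuous f -> L2 f -> exists h, is_hartley f h.
Proof.
move=> cf hf.
have [h h1 h2] : exists2 h, L2 h & L2cvg (fun n => hart (trunc n f)) h.
  apply: L2_complete => [n|e e0]; first exact: L2_hart_trunc.
  have /L2cvgP /(_ (e / 4)) := L2cvg_box hf.
  rewrite divr_gt0// => /(_ isT)[N hN]; exists N => m n Nm Nn.
  rewrite plancherel_trunc//.
  rewrite (@eq_nsq _ _ (fun x => (trunc m f x - f x) - (trunc n f x - f x))); last first.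
    by move=> x; ring.
  have ht k : L2 (fun x => trunc k f x - f x) by apply: L2B => //; exact: L2_box.
  by apply: (le_trans (nsqB_le (ht m) (ht n))); have := hN _ Nm; have := hN _ Nn; lra.
by exists h.
Qed.

Lemma hartley_unique f h h' : continuous f -> is_hartley f h -> is_hartley f h' ->
  {ae mu, forall x, h x = h' x}.
Proof.
move=> cf [h1 h2] [h1' h2']; apply: L2cvg_unique h2 h2' => // n.
exact: L2_hart_trunc.
Qed.

Lemma hartley_ae f h h' : continuous f -> measurable_fun setT h' ->
  {ae mu, forall x, h x = h' x} -> is_hartley f h -> is_hartley f h'.
Proof.
move=> cf mh' hh [h1 h2]; have h1' := L2_ae_eq (L2_measurable h1) mh' hh h1.
have E n : nsq (fun x => hart (trunc n f) x - h' x) =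
    nsq (fun x => hart (trunc n f) x - h x).
  have mt := L2_measurable (L2_hart_trunc n cf).
  apply: nsq_ae_eq; [exact: measurable_funB| |by apply: (aeS _ hh) => x ->].
  by apply: measurable_funB => //; exact: L2_measurable.
by split => //; rewrite /L2cvg (funext E).
Qed.

Lemma hartleyD f g h k : continuous f -> continuous g ->
  is_hartley f h -> is_hartley g k ->
  is_hartley (fun x => f x + g x) (fun x => h x + k x).
Proof.
move=> cf cg [h1 h2] [k1 k2]; split; first exact: L2D.
have -> : (fun n => hart (trunc n (fun x => f x + g x))) =
    fun n z => hart (trunc n f) z + hart (trunc n g) z.
  apply/funext => n; apply/funext => z; rewrite -hartD; try exact: L1_trunc.
  by congr (hart _ _); apply/funext => x; rewrite /trunc mulrDr.
by apply: L2cvgD => // n; exact: L2_hart_trunc.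
Qed.

Lemma hartleyZ c f h : continuous f -> is_hartley f h ->
  is_hartley (fun x => c * f x) (fun x => c * h x).
Proof.
move=> cf [h1 h2]; split; first exact: L2Z.
have -> : (fun n => hart (trunc n (fun x => c * f x))) =
    fun n z => c * hart (trunc n f) z.
  apply/funext => n; apply/funext => z; rewrite -hartZ; last exact: L1_trunc.
  by congr (hart _ _); apply/funext => x; rewrite /trunc mulrCA.
by apply: L2cvgZ => // n; exact: L2_hart_trunc.
Qed.

Lemma hartley_nsq f h : continuous f -> L2 f -> is_hartley f h -> nsq h = nsq f.
Proof.
move=> cf hf [h1 h2].
have c1 : nsq (hart (trunc n f)) @[n --> \oo] --> nsq h.
  by apply: L2cvg_nsq => // n; exact: L2_hart_trunc.
have c2 : nsq (trunc n f) @[n --> \oo] --> nsq f.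
  by apply: L2cvg_nsq => //; [move=> n; exact: L2_box|exact: L2cvg_box].
apply: (cvg_unique (@Rhausdorff R) c1).
rewrite (_ : (fun n => nsq (hart (trunc n f))) = (fun n => nsq (trunc n f)))//.
by apply/funext => n; have [B /plancherel_tame[]] := tame_trunc n cf.
Qed.

(** Parseval's identity against a tame function, by polarization. *)
Lemma hartley_pair f h phi B : continuous f -> L2 f -> is_hartley f h ->
  tame phi B -> intR (fun x => f x * phi x) = intR (fun z => h z * hart phi z).
Proof.
move=> cf hf [h1 h2] tp; have p2 := tame_L2 tp.
have [q2 qE] := plancherel_tame tp; have [p1 _ _] := tp.
have E n : intR (fun x => trunc n f x * phi x) = intR (fun z => hart (trunc n f) z * hart phi z).
  have [A tn] := tame_trunc n cf; have [t2 tE] := plancherel_tame tn.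
  have := (plancherel_tame (tameD tn tp)).2.
  rewrite (nsqD (tame_L2 tn) p2).
  rewrite (_ : hart _ = fun z => hart (trunc n f) z + hart phi z); last first.
    by apply/funext => z; rewrite hartD//; exact: L1_trunc.
  by rewrite (nsqD t2 q2) tE qE; lra.
have c1 : intR (fun x => trunc n f x * phi x) @[n --> \oo] --> intR (fun x => f x * phi x).
  by apply: L2cvg_intR => //; [move=> n; exact: L2_box|exact: L2cvg_box].
have c2 : intR (fun z => hart (trunc n f) z * hart phi z) @[n --> \oo] --> intR (fun z => h z * hart phi z).
  by apply: L2cvg_intR => // n; exact: L2_hart_trunc.
rewrite (funext E) in c1.
exact: (cvg_unique (@Rhausdorff R) c1 c2).
Qed.

End HartleyL2.

(** * Sobolev norms on the Hartley side *)

Section Sobolev.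
Context {R : realType}.
Local Notation mu := (@lebesgue_measure R).
Implicit Types (f g h k : R -> R) (s x y z : R).

Definition wt s x : R := (1 + x ^+ 2) `^ (s / 2).

Lemma wt_base_gt0 x : 0 < 1 + x ^+ 2 :> R.
Proof. by rewrite ltr_pwDl ?sqr_ge0. Qed.

Lemma wt_base_ge1 x : 1 <= 1 + x ^+ 2 :> R.
Proof. by rewrite lerDl sqr_ge0. Qed.

Lemma gt0_powRD (u r t : R) : 0 < u -> u `^ (r + t) = u `^ r * u `^ t.
Proof. by move=> u0; rewrite powRD//; apply/implyP => _; rewrite gt_eqF. Qed.

Lemma wt_gt0 s x : 0 < wt s x.
Proof. by rewrite powR_gt0 ?wt_base_gt0. Qed.

Lemma wt_ge0 s x : 0 <= wt s x. Proof. exact/ltW/wt_gt0. Qed.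

Lemma wt_opp s x : wt s (- x) = wt s x. Proof. by rewrite /wt sqrrN. Qed.

Lemma wt0 x : wt 0 x = 1. Proof. by rewrite /wt mul0r powRr0. Qed.

Lemma wtD s t x : wt (s + t) x = wt s x * wt t x.
Proof. by rewrite /wt mulrDl gt0_powRD ?wt_base_gt0. Qed.

Lemma wt_sq s x : wt s x ^+ 2 = (1 + x ^+ 2) `^ s.
Proof.
rewrite /wt expr2 -gt0_powRD ?wt_base_gt0//.
by congr (_ `^ _); lra.
Qed.

Lemma wt_le s t x : s <= t -> wt s x <= wt t x.
Proof. by move=> st; rewrite ler_powR ?wt_base_ge1// ler_wpM2r. Qed.

Lemma continuous_wt s : continuous (wt s).
Proof.
apply: (@derive_continuous _ _ (fun x => (s / 2 * (1 + x ^+ 2) `^ (s / 2 - 1)) * (2 * x))) => x.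
have d1 : is_derive x (1:R) (fun x : R => 1 + x ^+ 2) (2 * x).
  by apply: is_derive_eq; rewrite /GRing.scale/=; ring.
exact: (@is_derive1_comp _ (fun u : R => u `^ (s / 2)) (fun x => 1 + x ^+ 2) x _ _
  (is_derive1_powR _ (wt_base_gt0 x)) d1).
Qed.

Lemma measurable_wt s : measurable_fun setT (wt s).
Proof. by apply: continuous_measurable; exact: continuous_wt. Qed.

Lemma L2_wt s : 1 / 2 < s -> L2 (wt (- s)).
Proof.
move=> hs; split; first exact: measurable_wt.
have s1 : 0 < 2 * s - 1 by lra.
pose q x : R := - (1 + x ^+ 2) `^ (- (s - 1 / 2)).
pose C := 2 / (2 * s - 1).
have C0 : 0 < C by rewrite divr_gt0.
pose q' x : R := (2 * s - 1) * (x * (1 + x ^+ 2) `^ (- s - 1 / 2)).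
have dq x : is_derive x (1:R) q (q' x).
  have d1 : is_derive x (1:R) (fun x : R => 1 + x ^+ 2) (2 * x).
    by apply: is_derive_eq; rewrite /GRing.scale/=; ring.
  apply: is_derive_eq.
    exact: (is_deriveN (@is_derive1_comp _ (fun u : R => u `^ (- (s - 1 / 2)))
      (fun x => 1 + x ^+ 2) x _ _ (is_derive1_powR _ (wt_base_gt0 x)) d1)).
  rewrite /q' (_ : - (s - 1 / 2) - 1 = - s - 1 / 2); last lra.
  by set p := _ `^ _; lra.
have cq' : continuous q'.
  move=> x; apply: cvgM; first exact: cvg_cst.
  apply: cvgM; first exact: cvg_id.
  have := @continuous_wt (2 * (- s - 1 / 2)) x.
  by rewrite /wt [2 * _]mulrC mulfK.
have cw : continuous (fun x => wt (- s) x ^+ 2).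
  by move=> x; apply: cvgM; exact: continuous_wt.
have [hP iP] := intR_poisson 0 (@ltr01 R).
have bnd x : 0 <= x -> wt (- s) x ^+ 2 <= C * q' x + 2 * poisson 1 (x - 0).
  move=> x0; rewrite wt_sq subr0 /poisson expr1n.
  have u0 := wt_base_gt0 x; set u := 1 + x ^+ 2 in u0 *.
  have Eq : C * q' x = 2 * x * u `^ (- s - 1 / 2).
    by rewrite /C /q' -/u; field; rewrite gt_eqF.
  have p0 : 0 < u `^ (- s - 1 / 2) by rewrite powR_gt0.
  have [x1|x1] := leP 1 x.
    apply: (@le_trans _ _ (2 * x * u `^ (- s - 1 / 2))); last first.
      by rewrite Eq lerDl mulr_ge0// divr_ge0// ltW.
    have -> : - s = (- s - 1 / 2) + 1 / 2 by lra.
    rewrite gt0_powRD// mulrC.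
    rewrite (_ : - s - 1 / 2 + 1 / 2 - 1 / 2 = - s - 1 / 2); last lra.
    apply: ler_wpM2r; first exact: ltW.
    rewrite div1r powR12_sqrt; last exact: ltW.
    have q2 : 0 <= 2 * x by rewrite mulr_ge0.
    by rewrite -(ger0_norm q2) -sqrtr_sqr ler_wsqrtr// /u; nra.
  apply: (@le_trans _ _ (2 * (1 / u))); last first.
    by rewrite lerDr Eq !mulr_ge0// ltW.
  apply: (@le_trans _ _ 1).
    rewrite -(powRr0 u) ler_powR ?wt_base_ge1//; lra.
  by rewrite mulrA mulr1 ler_pdivlMr// mul1r /u; nra.
have [] // := @intR_fatou _ (fun n x => box (- n%:R) n%:R x * wt (- s) x ^+ 2)
  (fun x => wt (- s) x ^+ 2) (2 * (C + 2 * pi)).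
- by move=> n; exact: L1_box.
- by move=> n x; rewrite mulr_ge0 ?box_ge0 ?sqr_ge0.
- exact: continuous_measurable.
- by move=> x; rewrite sqr_ge0.
- exact: box_cvg_ae.
- move=> n; rewrite intR_box_sym//; last by move=> x; rewrite wt_opp.
  rewrite ler_wpM2l//.
  have cP : continuous (fun x : R => poisson 1 (x - 0)).
    under eq_fun do rewrite subr0; exact: continuous_poisson.
  apply: (@le_trans _ _ (intR (fun x => C * (box 0 n%:R x * q' x) + 2 * (box 0 n%:R x * poisson 1 (x - 0))))).
    apply: intR_le; first exact: L1_box.
      by apply: L1D; apply: L1Z; exact: L1_box.
    move=> x; have [/andP[x0 xn]|h] := boolP ((0 <= x) && (x <= n%:R)).
      by rewrite box1// !mul1r bnd.
    by rewrite box0// !mul0r !mulr0 addr0.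
  rewrite intRD; [|by apply: L1Z; exact: L1_box|by apply: L1Z; exact: L1_box].
  rewrite intRZ; last exact: L1_box.
  rewrite intRZ; last exact: L1_box.
  rewrite (intR_FTC _ dq)//.
  apply: lerD.
    rewrite ler_piMr ?(ltW C0)// /q expr0n addr0 powR1.
    by have := powR_ge0 (1 + n%:R ^+ 2 : R) (- (s - 1 / 2)); lra.
  rewrite ler_wpM2l// -iP; apply: intR_le => //; first exact: L1_box.
  by move=> x; rewrite ler_piMl ?box_le1 ?poisson_ge0.
Qed.

(** For h a Hartley transform of f, this says that the H^s norm of f is at most M. *)
Definition hb s (M : R) h := L2 (fun x => wt s x * h x) /\
  nsq (fun x => wt s x * h x) <= M ^+ 2.

Definition Hbd s (M : R) f := exists h, is_hartley f h /\ hb s M h.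

Lemma hb_ae s M h h' : measurable_fun setT h' ->
  {ae mu, forall x, h x = h' x} -> L2 h -> hb s M h -> hb s M h'.
Proof.
move=> mh' hh [mh _] [h1 h2].
have m1 g : measurable_fun setT g -> measurable_fun setT (fun x => wt s x * g x).
  by move=> mg; apply: measurable_funM => //; exact: measurable_wt.
have E : {ae mu, forall x, wt s x * h x = wt s x * h' x} by apply: (aeS _ hh) => x ->.
split; first exact: L2_ae_eq (m1 _ mh) (m1 _ mh') E h1.
by rewrite -(nsq_ae_eq (m1 _ mh) (m1 _ mh') E).
Qed.

Lemma Hbd_any s M f h : continuous f -> is_hartley f h -> Hbd s M f -> hb s M h.
Proof.
move=> cf fh [k [fk kM]]; apply: hb_ae kM; last by case: fk.
  by case: fh => -[].
exact: hartley_unique cf fk fh.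
Qed.

Lemma hbW s t M N h : s <= t -> M ^+ 2 <= N ^+ 2 -> measurable_fun setT h ->
  hb t M h -> hb s N h.
Proof.
move=> st MN mh [h1 h2].
have le x : `|wt s x * h x| <= `|wt t x * h x|.
  by rewrite !normrM ler_wpM2r// !ger0_norm ?wt_ge0// wt_le.
have hL : L2 (fun x => wt s x * h x).
  apply: sq_L1_of_le le => //.
  by apply: measurable_funM => //; exact: measurable_wt.
split => //; apply: (le_trans _ MN); apply: (le_trans _ h2).
exact: (nsq_le hL h1 le).
Qed.

Lemma HbdW s t M N f : s <= t -> M ^+ 2 <= N ^+ 2 -> Hbd t M f -> Hbd s N f.
Proof.
move=> st MN [h [fh hM]]; exists h; split => //; apply: hbW hM => //.
by case: fh => -[].
Qed.

Lemma HbdD s A B f g : continuous f -> continuous g -> 0 <= A -> 0 <= B ->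
  Hbd s A f -> Hbd s B g -> Hbd s (A + B) (fun x => f x + g x).
Proof.
move=> cf cg A0 B0 [h [fh [h1 h2]]] [k [gk [k1 k2]]].
exists (fun x => h x + k x); split; first exact: hartleyD.
rewrite /hb (_ : (fun x => _) = fun x => wt s x * h x + wt s x * k x).
  by split; [exact: L2D|exact: minkowski2].
by apply/funext => x; rewrite mulrDr.
Qed.

Lemma HbdZ s A c f : continuous f -> Hbd s A f -> Hbd s (`|c| * A) (fun x => c * f x).
Proof.
move=> cf [h [fh [h1 h2]]]; exists (fun x => c * h x); split; first exact: hartleyZ.
rewrite /hb (_ : (fun x => _) = fun x => c * (wt s x * h x)).
  split; first exact: L2Z.
  by rewrite nsqZ// exprMn real_normK ?num_real// ler_wpM2l// sqr_ge0.
by apply/funext => x; rewrite mulrCA.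
Qed.

Lemma Hbd0_of_L2 M f : continuous f -> L2 f -> nsq f <= M ^+ 2 -> Hbd 0 M f.
Proof.
move=> cf hf fM; have [h fh] := hartley_exists cf hf; exists h; split => //.
rewrite /hb (_ : (fun x => _) = h); last by apply/funext => x; rewrite wt0 mul1r.
by have [hh _] := fh; rewrite (hartley_nsq cf hf fh).
Qed.

Definition avg (n : nat) x y : R := (n.+1%:R / 2) * box (x - n.+1%:R^-1) (x + n.+1%:R^-1) y.

Lemma tame_avg n x : exists B, tame (avg n x) B.
Proof.
have [B tB] := tame_box (x - n.+1%:R^-1) (x + n.+1%:R^-1) (fun y => @cst_continuous R R 1 y).
exists (`|n.+1%:R / 2| * B); have := tameZ (n.+1%:R / 2) tB.
by congr tame; apply/funext => y; rewrite /avg mulr1.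
Qed.

Lemma intR_avg n x : intR (avg n x) = 1.
Proof.
have e0 : 0 < n.+1%:R^-1 :> R by rewrite invr_gt0.
rewrite /avg; under eq_intR do rewrite -[box _ _ _]mulr1.
rewrite intRZ; last by apply: L1_box; exact: cst_continuous.
have h : x - n.+1%:R^-1 <= x + n.+1%:R^-1.
  by rewrite lerBlDr -addrA lerDl addr_ge0 // ltW.
rewrite (intR_FTC h (fun y : R => is_derive_id y 1) (@cst_continuous R R 1)).
by field; rewrite nat1r pnatr_eq0.
Qed.

Lemma avg_ge0 n x y : 0 <= avg n x y.
Proof. by rewrite mulr_ge0 ?box_ge0// divr_ge0. Qed.

Lemma avg_cvg g x : continuous g ->
  intR (fun y => avg n x y * g y) @[n --> \oo] --> g x.
Proof.
move=> cg; apply/cvgrPdist_le => e e0.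
have /cvgrPdist_le /(_ e e0)[r /= r0 hr] := cg x.
exists (Num.bound r^-1) => // n /= hn.
have [B [tB _ _]] := tame_avg n x.
have hg : L1 (fun y => avg n x y * g y).
  apply: L1_eq (L1Z (n.+1%:R / 2) (L1_box (x - n.+1%:R^-1) (x + n.+1%:R^-1) cg)) => y.
  by rewrite /avg mulrA.
have -> : g x - intR (fun y => avg n x y * g y) =
    intR (fun y => g x * avg n x y - avg n x y * g y).
  by rewrite intRB//; [rewrite intRZ// intR_avg mulr1|exact: L1Z].
rewrite -[leRHS]mulr1 -(intR_avg n x) -intRZ//.
apply: intR_norm_le; [by apply: L1B => //; exact: L1Z|exact: L1Z|move=> y].
rewrite [avg n x y * _]mulrC -mulrBl normrM (ger0_norm (avg_ge0 _ _ _)).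
have [/andP[h1 h2]|h] := boolP ((x - n.+1%:R^-1 <= y) && (y <= x + n.+1%:R^-1)).
  rewrite ler_wpM2r ?avg_ge0// hr//=.
  have : n.+1%:R^-1 < r.
    rewrite invf_plt ?posrE//.
    apply: (lt_le_trans (archi_boundP _)); first by rewrite invr_ge0 ltW.
    by rewrite ler_nat; exact: leqW.
  move: h1 h2; set p := n.+1%:R^-1 => h1 h2 h3.
  by rewrite ltr_norml; lra.
by rewrite /avg box0// !mulr0.
Qed.

Lemma L1_of_hb s M h : 1 / 2 < s -> hb s M h -> 0 <= M ->
  L1 h /\ intR (fun x => `|h x|) <= Num.sqrt (nsq (wt (- s))) * M.
Proof.
move=> hs [h1 h2] M0; have hw := L2_wt hs.
have E x : wt (- s) x * (wt s x * h x) = h x.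
  by rewrite mulrA -wtD addNr wt0 mul1r.
have hh : L1 h by apply: L1_eq (L2_mul hw h1) => x; exact: E.
split => //.
have ha := L2_abs h1.
have -> : intR (fun x => `|h x|) = intR (fun x => wt (- s) x * `|wt s x * h x|).
  by apply: eq_intR => x; rewrite -{1}E normrM (ger0_norm (wt_ge0 _ _)).
apply: (le_trans (ler_norm _)); apply: cauchy_schwarz => //.
- by rewrite sqr_sqrtr ?nsq_ge0.
- by rewrite nsq_abs.
Qed.

(** Fourier inversion at every point, for continuous functions whose
    transform is integrable. *)
Lemma hartley_inversion f h x : continuous f -> L2 f -> is_hartley f h -> L1 h ->
  f x = cF * intR (fun z => h z * cas (z * x)).
Proof.
move=> cf hf fh hh.
have [_ c1] : L1 (fun z => h z * (cF * cas (z * x))) /\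
   intR (fun z => h z * hart (avg n x) z) @[n --> \oo] --> intR (fun z => h z * (cF * cas (z * x))).
  have mc : measurable_fun setT (fun z => cas (z * x)).
    by apply: continuous_measurable; exact: continuous_casl.
  apply: (@intR_dominated _ _ _ (fun z => 2 * `|h z|)).
  - move=> n; have [B [tB _ _]] := tame_avg n x; apply: measurable_funM.
      exact: L1_measurable.
    exact: hart_measurable.
  - by apply: measurable_funM; [exact: L1_measurable|exact: measurable_funM].
  - apply: aeW => z; apply: cvgMl_tmp; apply: cvgMl_tmp.
    rewrite mulrC; apply: (@avg_cvg (fun y => cas (y * z))).
    exact: continuous_casl.
  - by apply: L1Z; exact: L1_abs.
  - move=> n z; have [B [tB _ _]] := tame_avg n x.
    rewrite normrM mulrC ler_wpM2r//; apply: (le_trans (hart_norm _ tB)).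
    rewrite (@eq_intR _ _ (avg n x)) ?intR_avg ?mulr1// => y.
    by rewrite ger0_norm// avg_ge0.
have c2 : intR (fun y => f y * avg n x y) @[n --> \oo] --> f x.
  have E n : intR (fun y => f y * avg n x y) = intR (fun y => avg n x y * f y).
    by apply: eq_intR => y; rewrite mulrC.
  by rewrite (funext E); exact: avg_cvg.
have E n : intR (fun y => f y * avg n x y) = intR (fun z => h z * hart (avg n x) z).
  by have [B tB] := tame_avg n x; exact: hartley_pair tB.
rewrite (funext E) in c2.
rewrite (cvg_unique (@Rhausdorff R) c2 c1) -intRZ; last exact: L1_cas.
by apply: eq_intR => z; ring.
Qed.

Definition sobC s : R := 2 * Num.sqrt (nsq (wt (- s))).

Lemma sobC_ge0 s : 0 <= sobC s. Proof. by rewrite mulr_ge0. Qed.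

(** A function with an integrable transform is bounded by the inversion formula, and
    the weight (1 + z^2)^(-s/2) is square integrable for s > 1/2. *)
Lemma sobolev s M f x : 1 / 2 < s -> continuous f -> L2 f -> 0 <= M ->
  Hbd s M f -> `|f x| <= sobC s * M.
Proof.
move=> hs cf hf M0 [h [fh hM]]; have [hh hI] := L1_of_hb hs hM M0.
rewrite (hartley_inversion x cf hf fh hh).
apply: (le_trans (hart_norm x hh)).
by rewrite /sobC -mulrA ler_wpM2l.
Qed.

End Sobolev.

(** * The operators (1 - d^2/dx^2)^-1 and -d/dx (1 - d^2/dx^2)^-1 *)

Section Resolvent.
Context {R : realType}.
Local Notation mu := (@lebesgue_measure R).
Implicit Types (f g h : R -> R) (M x y : R).

Definition half x y : R := ((y <= x)%R)%:R.

Lemma halfM_restrict x f : (fun y => half x y * f y) = f \_ `]-oo, x].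
Proof.
apply/funext => y; rewrite patchE /half; case: ifPn => h.
  by move: h; rewrite inE/= in_itv/= => ->; rewrite mul1r.
by case: leP => // yx; rewrite ?mul0r//; move: h; rewrite notin_setE/= in_itv/= yx.
Qed.

Lemma half_ge0 x y : 0 <= half x y. Proof. exact: ler0n. Qed.

Lemma measurable_half x : measurable_fun setT (half x).
Proof.
rewrite (_ : half x = fun y => half x y * 1); last by apply/funext => y; rewrite mulr1.
by rewrite halfM_restrict; apply/measurable_restrict.
Qed.

Lemma L1_half_exp x : L1 (fun y => half x y * expR y) /\
  intR (fun y => half x y * expR y) <= expR x.
Proof.
have me : measurable_fun setT (@expR R) by exact: (continuous_measurable (@continuous_expR R)).
apply: (@intR_fatou _ (fun n y => box (- n%:R) x y * expR y)).
- by move=> n; apply: L1_box; exact: continuous_expR.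
- by move=> n y; rewrite mulr_ge0 ?box_ge0 ?expR_ge0.
- by apply: measurable_funM => //; exact: measurable_half.
- by move=> y; rewrite mulr_ge0 ?half_ge0 ?expR_ge0.
- apply: aeW => y; apply: cvgMr_tmp; apply: cvg_near_cst.
  apply: filterS (box_cvg_center y) => n h.
  rewrite /half /box; congr (nat_of_bool _)%:R.
  have [ny|ny] := leP (- n%:R) y => //.
  by move: h; rewrite box0 ?ny ?leNgt ?ny// => /eqP; rewrite eq_sym oner_eq0.
- move=> n; have [nx|nx] := leP (- n%:R) x.
    rewrite (intR_FTC nx (fun y => is_derive_expR y) (@continuous_expR R)).
    by rewrite gerBl expR_ge0.
  rewrite (_ : (fun y => _) = fun=> 0) ?intR0 ?expR_ge0//.
  apply/funext => y; rewrite box0 ?mul0r//.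
  by apply/negP => /andP[h1 h2]; have := le_trans h1 h2; rewrite leNgt nx.
Qed.

Lemma L1_half x f M : measurable_fun setT f -> (forall y, `|f y| <= M) ->
  L1 (fun y => half x y * (expR y * f y)).
Proof.
move=> mf fM; apply: L1_eq (L1_boundedM mf fM (L1_half_exp x).1) => y; ring.
Qed.

(** Solution of u' = f - u that stays bounded on the left. *)
Definition Lop f x : R := expR (- x) * intR (fun y => half x y * (expR y * f y)).

(** Solution of u' = u - f that stays bounded on the right. *)
Definition Rop f x : R := Lop (fun y => f (- y)) (- x).

Section bounded.
Variables (f : R -> R) (M : R).
Hypotheses (cf : continuous f) (fM : forall y, `|f y| <= M).
Let mf := continuous_measurable cf.
Let M0 : 0 <= M := le_trans (normr_ge0 _) (fM 0).

Lemma Lop_derive x : is_derive x (1:R) (Lop f) (f x - Lop f x).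
Proof.
pose F x := intR (fun y => half x y * (expR y * f y)).
have FE z : F z = \int[mu]_(y in `]-oo, z]) (expR y * f y).
  by rewrite Rintegral_mkcond -halfM_restrict.
have iF z : mu.-integrable `]-oo, z] (EFin \o (fun y => expR y * f y)).
  apply/integrable_mkcond => //; rewrite restrict_EFin -halfM_restrict.
  exact: (L1_half z mf fM).
have cef : continuous (fun y => expR y * f y).
  by move=> y; apply: cvgM; [exact: continuous_expR|exact: cf].
have [dF F'] : derivable F x 1 /\ (F^`())%classic x = expR x * f x.
  rewrite (funext FE).
  apply: (@continuous_FTC1 _ _ (BInfty _ true) x (x + 1)) => //.
  - by rewrite ltrDl.
  - by rewrite ltNyr.
  - exact: cef.
have d1 : is_derive x (1:R) F (expR x * f x) by apply: (DeriveDef dF); rewrite -derive1E.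
have d2 : is_derive x (1:R) (fun x => expR (- x)) (- expR (- x)).
  apply: (is_derive_eq (@is_derive1_comp _ (@expR R) -%R x _ _ (is_derive_expR _) _)).
  by rewrite mulrN1.
apply: (is_derive_eq (is_deriveM d2 d1)); rewrite /GRing.scale/= /Lop -/(F x).
by rewrite mulrA -expRD addNr expR0; ring.
Qed.

Lemma Lop_bound x : `|Lop f x| <= M.
Proof.
have [h1 h2] := L1_half_exp x.
rewrite /Lop normrM (ger0_norm (expR_ge0 _)).
have h : `|intR (fun y => half x y * (expR y * f y))| <= M * expR x.
  apply: (@le_trans _ _ (intR (fun y => M * (half x y * expR y)))).
    apply: intR_norm_le; [exact: (L1_half x mf fM)|exact: L1Z|move=> y].
    rewrite !normrM (ger0_norm (half_ge0 _ _)) (ger0_norm (expR_ge0 _)).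
    by rewrite mulrA [leRHS]mulrC ler_wpM2l// mulr_ge0 ?half_ge0 ?expR_ge0.
  by rewrite intRZ// ler_wpM2l.
apply: (le_trans (ler_wpM2l (expR_ge0 _) h)).
by rewrite mulrCA [expR (- x) * _]mulrC expRxMexpNx_1 mulr1.
Qed.

Lemma Lop_bound1 x : L1 f -> `|Lop f x| <= intR (fun y => `|f y|).
Proof.
move=> hf; rewrite /Lop -intRZ; last exact: (L1_half x mf fM).
apply: intR_norm_le; [|exact: L1_abs|move=> y].
  by apply: L1Z; exact: (L1_half x mf fM).
rewrite !normrM (ger0_norm (half_ge0 _ _)) !(ger0_norm (expR_ge0 _)).
rewrite /half; have [yx|yx] := leP y x; last by rewrite mul0r mulr0.
by rewrite mul1r mulrA -expRD ler_piMl// expR_le1; lra.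
Qed.

Lemma continuous_Lop : continuous (Lop f).
Proof. exact: derive_continuous Lop_derive. Qed.

Let cLf : continuous (fun x => f x - Lop f x).
Proof. exact: contB continuous_Lop. Qed.

(** Energy estimate for u' = f - u. *)
Lemma Lop_L2 : L2 f -> L2 (Lop f) /\ nsq (Lop f) <= nsq f.
Proof.
move=> hf; have cL := continuous_Lop.
have mL := continuous_measurable cL.
pose p x := Lop f x ^+ 2; pose q x := 2 * (f x * Lop f x) - 2 * Lop f x ^+ 2.
have dp x : is_derive x (1:R) p (q x).
  have dL := Lop_derive x.
  by apply: is_derive_eq; rewrite /GRing.scale/= /q; ring.
have cq : continuous q.
  by apply: contB; apply: contZ; [exact: contM|exact: contX].
have hL : L2 (Lop f).
  split => //; have [] // := @intR_fatou _ (fun n x => box (- n%:R) n%:R x * Lop f x ^+ 2)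
    (fun x => Lop f x ^+ 2) (nsq f + M ^+ 2).
  - by move=> n; apply: L1_box; exact: contX.
  - by move=> n x; rewrite mulr_ge0 ?box_ge0 ?sqr_ge0.
  - exact: measurable_funX.
  - by move=> x; rewrite sqr_ge0.
  - exact: box_cvg_ae.
  - move=> n; have n0 : - n%:R <= n%:R :> R by rewrite (@le_trans _ _ 0)// oppr_le0.
    have := intR_FTC n0 dp cq.
    have h1 : L1 (fun x => box (- n%:R) n%:R x * Lop f x ^+ 2).
      by apply: L1_box; exact: contX.
    have h2 : L1 (fun x => f x ^+ 2) by exact: L2_sq.
    have h3 : p (- n%:R) <= M ^+ 2.
      by apply: le_sqr_norm; rewrite (le_trans (Lop_bound _))// ler_norm.
    have h4 : 0 <= p n%:R by rewrite sqr_ge0.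
    have : intR (fun x => box (- n%:R) n%:R x * q x) <=
        intR (fun x => f x ^+ 2 - box (- n%:R) n%:R x * Lop f x ^+ 2).
      apply: intR_le; [exact: L1_box|exact: L1B|move=> x].
      have := sqr_ge0 (f x - Lop f x); have := sqr_ge0 (f x); rewrite /q.
      by rewrite /box; case: (_ && _) => /=; rewrite ?mul1r ?mul0r; nra.
    rewrite intRB// -/(nsq f); lra.
split => //.
have hfL := L2_mul hf hL; have hL2 := L2_sq hL.
have hq : L1 q by apply: L1B; exact: L1Z.
have := intR_derive0 dp cq (L2_sq hL) hq.
rewrite /q intRB; [|exact: L1Z|exact: L1Z].
rewrite intRZ// intRZ// -/(nsq _).
have : intR (fun x => 2 * (f x * Lop f x)) <= intR (fun x => f x ^+ 2 + Lop f x ^+ 2).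
  apply: intR_le; [exact: L1Z|by apply: L1D => //; exact: L2_sq|move=> x].
  by have := sqr_ge0 (f x - Lop f x); nra.
rewrite intRZ// intRD//; last exact: L2_sq.
rewrite -!/(nsq _); lra.
Qed.

End bounded.

Lemma LopD f g A B x : continuous f -> continuous g ->
  (forall y, `|f y| <= A) -> (forall y, `|g y| <= B) ->
  Lop (fun y => f y + g y) x = Lop f x + Lop g x.
Proof.
move=> cf cg fA gB; rewrite /Lop -mulrDr -intRD.
- by congr (_ * _); apply: eq_intR => y; rewrite !mulrDr.
- exact: (L1_half x (continuous_measurable cf) fA).
- exact: (L1_half x (continuous_measurable cg) gB).
Qed.

Lemma LopZ c f A x : continuous f -> (forall y, `|f y| <= A) ->
  Lop (fun y => c * f y) x = c * Lop f x.
Proof.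
move=> cf fA; rewrite /Lop mulrCA -(intRZ c).
  by congr (_ * _); apply: eq_intR => y; ring.
exact: (L1_half x (continuous_measurable cf) fA).
Qed.

Lemma continuous_opp f : continuous f -> continuous (fun x => f (- x)).
Proof.
move=> cf x; apply: (@continuous_comp _ _ _ -%R f); first exact: opp_continuous.
exact: cf.
Qed.

(** -d/dx (1 - d^2/dx^2)^-1 *)
Definition Aop f x : R := (Lop f x - Rop f x) / 2.

(** (1 - d^2/dx^2)^-1 *)
Definition Gop f x : R := (Lop f x + Rop f x) / 2.

Let quarter_le (a b c d : R) : d <= 2 * a + 2 * b -> a <= c -> b <= c ->
  2^-1 ^+ 2 * d <= c.
Proof. by lra. Qed.

Let three_le (a b c : R) : a <= 1 * (c + c) -> b <= 1 * c -> b + a <= 3 * c.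
Proof. by lra. Qed.

Let sum_eq0 (a b c : R) : a + b - 2 * c = 0 -> - c = 0 -> a = - b.
Proof. by lra. Qed.

Section bounded_AG.
Variables (f : R -> R) (M : R).
Hypotheses (cf : continuous f) (fM : forall y, `|f y| <= M).
Let cfo := continuous_opp cf.
Let fMo y : `|f (- y)| <= M := fM (- y).

Lemma Rop_derive x : is_derive x (1:R) (Rop f) (Rop f x - f x).
Proof.
have d1 := Lop_derive cfo fMo (- x).
apply: (is_derive_eq (@is_derive1_comp _ (Lop (fun y => f (- y))) -%R x _ _ d1 _)).
by rewrite /Rop opprK; ring.
Qed.

Lemma Aop_derive x : is_derive x (1:R) (Aop f) (f x - Gop f x).
Proof.
have d1 := Lop_derive cf fM x; have d2 := Rop_derive x.
by apply: is_derive_eq; rewrite /GRing.scale/= /Gop; field.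
Qed.

Lemma Gop_derive x : is_derive x (1:R) (Gop f) (- Aop f x).
Proof.
have d1 := Lop_derive cf fM x; have d2 := Rop_derive x.
by apply: is_derive_eq; rewrite /GRing.scale/= /Aop; field.
Qed.

Lemma continuous_Aop : continuous (Aop f).
Proof. exact: derive_continuous Aop_derive. Qed.

Lemma continuous_Gop : continuous (Gop f).
Proof. exact: derive_continuous Gop_derive. Qed.

Lemma Aop_bound x : `|Aop f x| <= M.
Proof.
have := Lop_bound cf fM x; have := Lop_bound cfo fMo (- x).
by rewrite -/(Rop f x) /Aop !ler_norml; lra.
Qed.

Lemma Gop_bound x : `|Gop f x| <= M.
Proof.
have := Lop_bound cf fM x; have := Lop_bound cfo fMo (- x).
by rewrite -/(Rop f x) /Gop !ler_norml; lra.
Qed.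

Lemma Aop_bound1 x : L1 f -> `|Aop f x| <= intR (fun y => `|f y|).
Proof.
move=> hf; have := Lop_bound1 cf fM x hf.
have := Lop_bound1 cfo fMo (- x) (L1_opp hf).
rewrite -/(Rop f x) (intR_opp (f := fun y => `|f y|)); last exact: L1_abs.
by rewrite /Aop !ler_norml; lra.
Qed.

Let Rop_L2 : L2 f -> L2 (Rop f) /\ nsq (Rop f) <= nsq f.
Proof.
move=> hf; have [h1 h2] := Lop_L2 cfo fMo (L2_opp hf).
by split; [exact: L2_opp|rewrite nsq_opp// (le_trans h2)// nsq_opp].
Qed.

Lemma Aop_L2 : L2 f -> L2 (Aop f) /\ nsq (Aop f) <= nsq f.
Proof.
move=> hf; have [l1 l2] := Lop_L2 cf fM hf; have [r1 r2] := Rop_L2 hf.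
have E : Aop f = fun x => 2^-1 * (Lop f x - Rop f x).
  by apply/funext => x; rewrite /Aop mulrC.
rewrite E; split; first by apply: L2Z; exact: L2B.
rewrite nsqZ; last exact: L2B.
exact: quarter_le (nsqB_le l1 r1) l2 r2.
Qed.

Lemma Gop_L2 : L2 f -> L2 (Gop f) /\ nsq (Gop f) <= nsq f.
Proof.
move=> hf; have [l1 l2] := Lop_L2 cf fM hf; have [r1 r2] := Rop_L2 hf.
have E : Gop f = fun x => 2^-1 * (Lop f x + Rop f x).
  by apply/funext => x; rewrite /Gop mulrC.
rewrite E; split; first by apply: L2Z; exact: L2D.
rewrite nsqZ; last exact: L2D.
exact: quarter_le (nsqD_le l1 r1) l2 r2.
Qed.

End bounded_AG.

Section linear_A.
Variables (f g : R -> R) (A B : R).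
Hypotheses (cf : continuous f) (cg : continuous g).
Hypotheses (fA : forall y, `|f y| <= A) (gB : forall y, `|g y| <= B).

Lemma AopD x : Aop (fun y => f y + g y) x = Aop f x + Aop g x.
Proof.
rewrite /Aop /Rop (LopD x cf cg fA gB).
rewrite (LopD (- x) (continuous_opp cf) (continuous_opp cg) (fun y => fA (- y)) (fun y => gB (- y))).
by field.
Qed.

Lemma AopZ c x : Aop (fun y => c * f y) x = c * Aop f x.
Proof.
rewrite /Aop /Rop (LopZ c x cf fA) (LopZ c (- x) (continuous_opp cf) (fun y => fA (- y))).
by field.
Qed.

End linear_A.

Section pairing.
Variables (f g : R -> R) (A B : R).
Hypotheses (cf : continuous f) (cg : continuous g).
Hypotheses (fA : forall y, `|f y| <= A) (gB : forall y, `|g y| <= B).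
Hypotheses (hf : L2 f) (hg : L2 g).

Let hAf := (Aop_L2 cf fA hf).1.
Let hAg := (Aop_L2 cg gB hg).1.
Let hGf := (Gop_L2 cf fA hf).1.
Let hGg := (Gop_L2 cg gB hg).1.

(** Both products Af.Ag and Gf.Gg have integrable derivatives, whose integrals
    vanish; adding the two identities gives the antisymmetry of A. *)
Lemma Aop_antisym : intR (fun x => f x * Aop g x) = - intR (fun x => g x * Aop f x).
Proof.
have cAf := continuous_Aop cf fA; have cAg := continuous_Aop cg gB.
have cGf := continuous_Gop cf fA; have cGg := continuous_Gop cg gB.
pose p x := Aop f x * Aop g x + Gop f x * Gop g x.
pose q x := (f x * Aop g x + g x * Aop f x) -
  2 * (Gop f x * Aop g x + Aop f x * Gop g x).
have dp x : is_derive x (1:R) p (q x).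
  have d1 := Aop_derive cf fA x; have d2 := Aop_derive cg gB x.
  have d3 := Gop_derive cf fA x; have d4 := Gop_derive cg gB x.
  by apply: is_derive_eq; rewrite /GRing.scale/= /q; ring.
pose p2 x := Gop f x * Gop g x.
pose q2 x := - (Gop f x * Aop g x + Aop f x * Gop g x).
have dp2 x : is_derive x (1:R) p2 (q2 x).
  have d3 := Gop_derive cf fA x; have d4 := Gop_derive cg gB x.
  by apply: is_derive_eq; rewrite /GRing.scale/= /q2; ring.
have cq2 : continuous q2 by apply: contN; apply: contD; exact: contM.
have cq : continuous q.
  by apply: contB; [|apply: contZ]; apply: contD; exact: contM.
have h1 : L1 (fun x => f x * Aop g x) by exact: L2_mul.
have h2 : L1 (fun x => g x * Aop f x) by exact: L2_mul.
have h3 : L1 (fun x => Gop f x * Aop g x + Aop f x * Gop g x).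
  by apply: L1D; exact: L2_mul.
have i1 := intR_derive0 dp cq (L1D (L2_mul hAf hAg) (L2_mul hGf hGg)) (L1B (L1D h1 h2) (L1Z 2 h3)).
have i2 := intR_derive0 dp2 cq2 (L2_mul hGf hGg) (L1N h3).
move: i1 i2; rewrite /q /q2 intRN// intRB; [|exact: L1D|exact: L1Z].
rewrite intRD// intRZ// => i1 i2; exact: sum_eq0 i1 i2.
Qed.

(** The energy of w = Af is read off from f: |w|^2 + |w'|^2 = <f, w'>. *)
Lemma Aop_energy : intR (fun x => f x * (f x - Gop f x)) =
  nsq (Aop f) + nsq (fun x => f x - Gop f x).
Proof.
have cAf := continuous_Aop cf fA; have cGf := continuous_Gop cf fA.
have hw : L2 (fun x => f x - Gop f x) by exact: L2B.
pose p x := Gop f x * Aop f x.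
pose q x := Gop f x * (f x - Gop f x) - Aop f x ^+ 2.
have dp x : is_derive x (1:R) p (q x).
  have d1 := Aop_derive cf fA x; have d3 := Gop_derive cf fA x.
  by apply: is_derive_eq; rewrite /GRing.scale/= /q; ring.
have cq : continuous q.
  by apply: contB; [apply: contM => //; exact: contB|exact: contX].
have h1 := L2_mul hGf hw; have h2 := L2_sq hAf.
have := intR_derive0 dp cq (L2_mul hGf hAf) (L1B h1 h2).
rewrite /q intRB// => i1.
rewrite (@eq_intR _ _ (fun x => Gop f x * (f x - Gop f x) + (f x - Gop f x) ^+ 2)); last first.
  by move=> x; ring.
rewrite intRD//; last exact: L2_sq.
rewrite -!/(nsq _); rewrite -!/(nsq _) in i1; lra.
Qed.

(** The integrand is the derivative of (A f)^3 / 3. *)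
Lemma Aop_cubic : intR (fun x => Aop f x ^+ 2 * (f x - Gop f x)) = 0.
Proof.
have cAf := continuous_Aop cf fA; have cGf := continuous_Gop cf fA.
have hw : L2 (fun x => f x - Gop f x) by exact: L2B.
have hA2 : L2 (fun x => Aop f x * Aop f x).
  exact: (L2_boundedM (continuous_measurable cAf) (Aop_bound cf fA)).
pose p x := 3^-1 * (Aop f x * (Aop f x * Aop f x)).
pose q x := Aop f x ^+ 2 * (f x - Gop f x).
have dp x : is_derive x (1:R) p (q x).
  have d1 := Aop_derive cf fA x.
  by apply: is_derive_eq; rewrite /GRing.scale/= /q; field.
have cq : continuous q by apply: contM; [exact: contX|exact: contB].
have hq : L1 q by have := L2_mul hA2 hw; under eq_fun do rewrite -expr2.
exact: (intR_derive0 dp cq (L1Z _ (L2_mul hAf hA2)) hq).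
Qed.

(** The integral of |A f| + |(A f)'| over a unit interval dominates |A f|; the
    derivative is f - G f. *)
Lemma Aop_bound2 x N : 0 <= N -> nsq f <= N ^+ 2 -> `|Aop f x| <= 3 * N.
Proof.
move=> N0 fN; have cAf := continuous_Aop cf fA; have cGf := continuous_Gop cf fA.
have hw : L2 (fun x => f x - Gop f x) by exact: L2B.
have cw : continuous (fun x => f x - Gop f x).
  exact: contB.
have hb : L2 (fun y => box x (x + 1) y * 1) by apply: L2_box; exact: cst_continuous.
have nb : nsq (fun y => box x (x + 1) y * 1) <= 1 ^+ 2.
  rewrite /nsq; under eq_intR do rewrite mulr1 box_sq -[box _ _ _]mulr1.
  have h : x <= x + 1 by lra.
  rewrite (intR_FTC h (fun y : R => is_derive_id y 1) (@cst_continuous R R 1)).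
  by rewrite addrAC subrr add0r expr1n.
apply: (le_trans (sup_le_intR x (Aop_derive cf fA) cw)).
have a1 : L2 (fun y => `|Aop f y|) by exact: L2_abs.
have a2 : L2 (fun y => `|f y - Gop f y|) by exact: L2_abs.
have n1 : nsq (fun y => `|Aop f y|) <= N ^+ 2.
  by rewrite nsq_abs (le_trans (Aop_L2 cf fA hf).2).
have n2 : nsq (fun y => `|f y - Gop f y|) <= (N + N) ^+ 2.
  rewrite nsq_abs; apply: minkowski2 => //; first exact: L2N.
  by rewrite nsqN (le_trans (Gop_L2 cf fA hf).2).
have N2 : 0 <= N + N by exact: addr_ge0.
have := cauchy_schwarz hb a1 ler01 N0 nb n1.
have := cauchy_schwarz hb a2 ler01 N2 nb n2.
have -> : intR (fun y => box x (x + 1) y * (`|Aop f y| + `|f y - Gop f y|)) =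
    intR (fun y => box x (x + 1) y * 1 * `|Aop f y|) +
    intR (fun y => box x (x + 1) y * 1 * `|f y - Gop f y|).
  rewrite -intRD; [|exact: L2_mul|exact: L2_mul].
  by apply: eq_intR => y; ring.
by rewrite !ler_norml => /andP[_ i1] /andP[_ i2]; exact: three_le i1 i2.
Qed.

End pairing.

End Resolvent.

(** * Derivatives, products and limits on the Hartley side *)

Section HartleyRules.
Context {R : realType}.
Local Notation mu := (@lebesgue_measure R).
Implicit Types (f g h k : R -> R) (s M x y z : R).

Lemma ae_opp (P : R -> Prop) : {ae mu, forall x, P x} -> {ae mu, forall x, P (- x)}.
Proof.
move=> [Z [mZ Z0 hZ]]; exists (-%R @^-1` (Z : set R)); split.
- rewrite -[X in measurable X]setTI.
  exact: (@oppr_measurable R setT measurableT _ mZ).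
- by rewrite -[RHS]Z0; exact: (lebesgue_measureN mZ).
- by move=> x /= nPx; exact: hZ.
Qed.

Lemma ae_all_nat (P : nat -> R -> Prop) : (forall n, {ae mu, forall x, P n x}) ->
  {ae mu, forall x, forall n, P n x}.
Proof. by move=> h; exact: ae_foralln. Qed.

Lemma casN_derive x z : is_derive x (1:R) (fun x => cas (x * z)) (z * cas (x * - z)).
Proof.
have d : is_derive x (1:R) (fun x : R => x * z) z.
  by apply: is_derive_eq; rewrite /GRing.scale/=; ring.
have ds := @is_derive1_comp _ sin (fun x => x * z) x _ _ (is_derive_sin _) d.
have dc := @is_derive1_comp _ cos (fun x => x * z) x _ _ (is_derive_cos _) d.
apply: (is_derive_eq (is_deriveD dc ds)).
by rewrite /cas mulrN cosN sinN; ring.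
Qed.

(** Integration by parts; the boundary terms vanish in the limit. *)
Lemma hart_trunc_derive n f g z : (forall x, is_derive x (1:R) f (g x)) -> continuous g ->
  hart (trunc n g) z = cF * (f n%:R * cas (n%:R * z) - f (- n%:R) * cas (- n%:R * z)) -
    z * hart (trunc n f) (- z).
Proof.
move=> df cg; have cf := derive_continuous df.
have n0 : - n%:R <= n%:R :> R by rewrite (@le_trans _ _ 0)// oppr_le0.
pose q x := g x * cas (x * z) + z * (f x * cas (x * - z)).
have dp x : is_derive x (1:R) (fun x => f x * cas (x * z)) (q x).
  have dc := casN_derive x z.
  by apply: is_derive_eq; rewrite /GRing.scale/= /q; ring.
have c1 : continuous (fun x => g x * cas (x * z)).
  by apply: contM => //; exact: continuous_casl.
have c2 : continuous (fun x => f x * cas (x * - z)).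
  by apply: contM => //; exact: continuous_casl.
have cq : continuous q by apply: contD => //; exact: contZ.
have := intR_FTC n0 dp cq.
have -> : intR (fun x => box (- n%:R) n%:R x * q x) =
    intR (fun x => box (- n%:R) n%:R x * (g x * cas (x * z))) +
    z * intR (fun x => box (- n%:R) n%:R x * (f x * cas (x * - z))).
  rewrite -intRZ; last exact: L1_box.
  rewrite -intRD; [|exact: L1_box|by apply: L1Z; exact: L1_box].
  by apply: eq_intR => x; rewrite /q; ring.
move=> E; rewrite /hart /trunc.
rewrite -(eq_intR (fun x => mulrA (box (- n%:R) n%:R x) (g x) (cas (x * z)))).
rewrite -(eq_intR (fun x => mulrA (box (- n%:R) n%:R x) (f x) (cas (x * - z)))).
by rewrite -E; ring.
Qed.

Lemma decay_L2 f g : (forall x, is_derive x (1:R) f (g x)) -> continuous g ->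
  L2 f -> L2 g ->
  f n%:R ^+ 2 @[n --> \oo] --> 0 /\ f (- n%:R) ^+ 2 @[n --> \oo] --> 0.
Proof.
move=> df cg hf hg; have cf := derive_continuous df.
apply: (@decay _ (fun x => f x ^+ 2) (fun x => 2 * (f x * g x))).
- by move=> x; apply: is_derive_eq; rewrite /GRing.scale/=; ring.
- by apply: contZ; exact: contM.
- exact: L2_sq.
- by apply: L1Z; exact: L2_mul.
Qed.

Lemma L2cvg_ae_eq (f_ g_ : nat -> R -> R) f g :
  (forall n, L2 (f_ n)) -> L2 f -> L2 g -> (forall n, f_ n =1 g_ n) ->
  L2cvg f_ f -> L2cvg g_ g -> {ae mu, forall x, f x = g x}.
Proof.
move=> h1 h2 h3 E c1 c2; apply: (L2cvg_unique h1 h2 h3 c1).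
by rewrite (_ : f_ = g_)//; apply/funext => n; apply/funext => x; exact: E.
Qed.

Lemma hartley_derive f g h k : (forall x, is_derive x (1:R) f (g x)) -> continuous g ->
  L2 f -> L2 g -> is_hartley f h -> is_hartley g k ->
  {ae mu, forall z, k z = - (z * h (- z))}.
Proof.
move=> df cg hf hg [h2 hh] [k2 kk]; have cf := derive_continuous df.
have [dy dNy] := decay_L2 df cg hf hg.
suff loc (K : nat) : {ae mu, forall z, box (- K%:R) K%:R z * k z = box (- K%:R) K%:R z * - (z * h (- z))}.
  apply: (aeS _ (ae_all_nat loc)) => z hz.
  have [K _ hK] := box_cvg_center z.
  by have := hz K; rewrite (hK K (leqnn K)) !mul1r.
pose b z := box (- K%:R) K%:R z.
have mb : measurable_fun setT b by exact: box_measurable.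
have [B hB] : exists B, forall z, `|b z * z| <= B.
  by apply: (@continuous_box_bounded _ _ _ (fun z => z)) => z; exact: cvg_id.
have mbz : measurable_fun setT (fun z => b z * z) by apply: measurable_funM.
have ht g' n : continuous g' -> L2 (hart (trunc n g')) by move=> ?; exact: L2_hart_trunc.
pose E n z := b z * (cF * (f n%:R * cas (n%:R * z) - f (- n%:R) * cas (- n%:R * z))).
pose e n := 8 * (f n%:R ^+ 2 + f (- n%:R) ^+ 2).
have cE n : continuous (fun z => cF * (f n%:R * cas (n%:R * z) - f (- n%:R) * cas (- n%:R * z))).
  have cc c : continuous (fun z => cas (c * z)).
    by under eq_fun do rewrite mulrC; exact: continuous_casl.
  by apply: contZ; apply: contB; apply: contZ; exact: cc.
have E2 n : L2 (E n) by exact: L2_box.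
have Ee n z : E n z ^+ 2 <= e n * b z.
  rewrite /E exprMn /b box_sq mulrC ler_wpM2r ?box_ge0// /e.
  have c0 := @cF_gt0 R; have c1 := @cF_le1 R.
  have := cas_norm (n%:R * z); have := cas_norm (- n%:R * z).
  set u := cas _; set v := cas _; set p := f _; set q := f _.
  move=> u2 v2; have uu : u ^+ 2 <= 2 ^+ 2 by apply: le_sqr_norm; rewrite (ger0_norm (_ : 0 <= 2)).
  have vv : v ^+ 2 <= 2 ^+ 2 by apply: le_sqr_norm; rewrite (ger0_norm (_ : 0 <= 2)).
  have cc : cF ^+ 2 <= 1 :> R by rewrite expr2; apply: mulr_ile1 => //; exact: ltW.
  rewrite exprMn; apply: (@le_trans _ _ (1 * (p * v - q * u) ^+ 2)).
    by rewrite ler_wpM2r ?sqr_ge0.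
  have a1 : (p * v) ^+ 2 <= 4 * p ^+ 2.
    by rewrite exprMn mulrC ler_wpM2r ?sqr_ge0//; lra.
  have a2 : (q * u) ^+ 2 <= 4 * q ^+ 2.
    by rewrite exprMn mulrC ler_wpM2r ?sqr_ge0//; lra.
  by have := sqr_ge0 (p * v + q * u); nra.
have L1b : L1 b.
  by have := @L1_box R (- K%:R) K%:R (fun=> 1) (@cst_continuous R R 1); under eq_fun do rewrite mulr1.
have cE0 : L2cvg E (fun=> 0).
  rewrite /L2cvg.
  have e0 : e n * intR b @[n --> \oo] --> 0.
    rewrite -[X in _ --> X](mul0r (intR b)); apply: cvgMr_tmp.
    rewrite -[X in _ --> X](mulr0 8); apply: cvgMl_tmp.
    by rewrite -[X in _ --> X](addr0 0); exact: cvgD.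
  apply: (@squeeze_cvgr _ _ _ _ (fun=> 0) _ _ _ _ _ e0); last exact: cvg_cst.
  apply: nearW => n; rewrite nsq_ge0/= -intRZ// /nsq.
  under eq_intR do rewrite subr0.
  by apply: intR_le; [exact: L2_sq|exact: L1Z|exact: Ee].
pose G n z := - ((b z * z) * hart (trunc n f) (- z)).
have hoff n : L2 (fun z => hart (trunc n f) (- z)) by apply: L2_opp; exact: ht.
have hof : L2 (fun z => h (- z)) by exact: L2_opp.
have G2 n : L2 (G n) by apply: L2N; exact: (L2_boundedM mbz hB).
have cG : L2cvg G (fun z => -1 * ((b z * z) * h (- z))).
  have := @L2cvgZ _ (-1) (fun n z => (b z * z) * hart (trunc n f) (- z)) (fun z => (b z * z) * h (- z)).
  have -> : (fun n x => -1 * (b x * x * hart (trunc n f) (- x))) = G.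
    by apply/funext => n; apply/funext => z; rewrite mulN1r.
  apply.
  - by move=> n; exact: (L2_boundedM mbz hB).
  - exact: (L2_boundedM mbz hB).
  - exact: (L2cvg_boundedM mbz hB hoff hof (L2cvg_opp (fun n => ht f n cf) h2 hh)).
have c1 : L2cvg (fun n z => b z * hart (trunc n g) z) (fun z => b z * k z).
  by apply: (L2cvg_boundedM mb (box_norm_le1 _ _)) => // n; exact: ht.
have hlim : L2 (fun z => -1 * ((b z * z) * h (- z))).
  by apply: L2Z; exact: (L2_boundedM mbz hB).
have := L2cvgD E2 L2_0 G2 hlim cE0 cG.
move=> c2; have := L2cvg_ae_eq _ _ _ _ c1 c2.
have -> : (forall n, L2 (fun z => b z * hart (trunc n g) z)) = True.
  by apply/propext; split => // _ n; apply: (L2_boundedM mb (box_norm_le1 _ _)); exact: ht.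
move=> /(_ Logic.I (L2_boundedM mb (box_norm_le1 _ _) k2) (L2D L2_0 hlim)).
move=> H; apply: (aeS _ (H _)); last first.
  by move=> n z; rewrite (hart_trunc_derive n z df cg) /E /G /=; ring.
by move=> z /= ->; rewrite -/(b z); ring.
Qed.

(** The symbol of A is z / (1 + z^2), up to the reflection z |-> - z that turns
    the sine transform into the Hartley transform. *)
Lemma hartley_Aop f h M : continuous f -> (forall y, `|f y| <= M) -> L2 f ->
  is_hartley f h ->
  is_hartley (Aop f) (fun z => z / (1 + z ^+ 2) * h (- z)).
Proof.
move=> cf fM hf fh.
have cA := continuous_Aop cf fM; have cG := continuous_Gop cf fM.
have [hA _] := Aop_L2 cf fM hf; have [hG _] := Gop_L2 cf fM hf.
have [a ah] := hartley_exists cA hA; have [k kh] := hartley_exists cG hG.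
have d1 := hartley_derive (Gop_derive cf fM) (contN cA) hG (L2N hA) kh.
have mah : is_hartley (fun x => - Aop f x) (fun z => -1 * a z).
  have := hartleyZ (-1) cA ah.
  by rewrite (_ : (fun x => -1 * Aop f x) = fun x => - Aop f x)//; apply/funext => x; rewrite mulN1r.
have mgh : is_hartley (fun x => f x - Gop f x) (fun z => h z + -1 * k z).
  have := hartleyD cf (contZ (c := -1) cG) fh (hartleyZ (-1) cG kh).
  rewrite (_ : (fun x => f x + -1 * Gop f x) = fun x => f x - Gop f x)//.
  by apply/funext => x; rewrite mulN1r.
have d2 := hartley_derive (Aop_derive cf fM) (contB cf cG) hA (L2B hf hG) ah mgh.
have {}d1 := d1 _ mah.
apply: (hartley_ae cA _ _ ah).
  have [mh _] := fh.1.
  apply: measurable_funM; last exact: (measurableT_comp mh (@oppr_measurable R setT)).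
  apply: continuous_measurable => z.
  apply: cvgM; first exact: cvg_id.
  apply: cvgV; first by rewrite gt_eqF ?wt_base_gt0.
  by apply: cvgD; [exact: cvg_cst|exact: exprn_continuous].
apply: (aeS _ (aeI (aeI d1 (ae_opp d1)) (ae_opp d2))) => z [[e1 e2] e3].
have q := wt_base_gt0 z.
have -> : a z = z * k (- z) by lra.
have -> : k (- z) = h (- z) / (1 + z ^+ 2).
  apply: (@mulIf _ (1 + z ^+ 2)); rewrite ?gt_eqF// divfK ?gt_eqF//.
  by move: e3; rewrite opprK (_ : a z = z * k (- z)); [move=> e3; nra|lra].
by ring.
Qed.

(** The symbol z / (1 + z^2) is at most (1 + z^2)^(-1/2). *)
Lemma Hbd_Aop s M f B : continuous f -> (forall y, `|f y| <= B) -> L2 f ->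
  Hbd s M f -> Hbd (s + 1) M (Aop f).
Proof.
move=> cf fB hf [h [fh [h1 h2]]].
exists (fun z => z / (1 + z ^+ 2) * h (- z)); split; first exact: hartley_Aop fB _ _.
have mh : measurable_fun setT (fun z => z / (1 + z ^+ 2) * h (- z)).
  by have [[]] := hartley_Aop cf fB hf fh.
have hr := L2_opp h1.
have sym z : `|wt 1 z * (z / (1 + z ^+ 2))| <= 1.
  have q := wt_base_gt0 z.
  have : (wt 1 z * (z / (1 + z ^+ 2))) ^+ 2 <= 1.
    rewrite exprMn wt_sq powRr1 ?(ltW q)// exprMn exprVn.
    have -> : (1 + z ^+ 2) * (z ^+ 2 / (1 + z ^+ 2) ^+ 2) = z ^+ 2 / (1 + z ^+ 2).
      by field; rewrite gt_eqF.
    by rewrite ler_pdivrMr// mul1r lerDr.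
  rewrite -(real_normK (num_real _)); have := normr_ge0 (wt 1 z * (z / (1 + z ^+ 2))).
  by set u := `|_|; nra.
have le z : `|wt (s + 1) z * (z / (1 + z ^+ 2) * h (- z))| <= `|wt s (- z) * h (- z)|.
  rewrite (_ : wt (s + 1) z * _ = (wt 1 z * (z / (1 + z ^+ 2))) * (wt s (- z) * h (- z))).
    by rewrite normrM ler_piMl.
  by rewrite wtD wt_opp; ring.
have hL : L2 (fun z => wt (s + 1) z * (z / (1 + z ^+ 2) * h (- z))).
  apply: (sq_L1_of_le _ hr le); apply: measurable_funM => //; exact: measurable_wt.
split => //; apply: le_trans h2; rewrite -(nsq_opp h1); exact: (nsq_le hL hr le).
Qed.

End HartleyRules.

(** * Sobolev spaces above 1/2 are algebras *)

Section Product.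
Context {R : realType}.
Local Notation mu := (@lebesgue_measure R).
Implicit Types (f g h P Q F G H : R -> R) (s M x y z : R).

Lemma measurable_intR (k : R -> R -> R) :
  measurable_fun setT (fun t : R * R => k t.1 t.2) -> (forall x, L1 (k x)) ->
  measurable_fun setT (fun x => intR (k x)).
Proof.
move=> mk hk.
have pos (q : R -> R -> R) : measurable_fun setT (fun t : R * R => q t.1 t.2) ->
    (forall x y, 0 <= q x y) -> measurable_fun setT (fun x => intR (q x)).
  move=> mq q0.
  have mE : measurable_fun setT (fun t : R * R => (q t.1 t.2)%:E).
    exact/measurable_EFinP.
  have := @measurable_fun_fubini_tonelli_F _ _ (measurableTypeR R)
    (measurableTypeR R) R mu (fun t => (q t.1 t.2)%:E).
  move=> /(_ mE) /(_ (fun t => q0 _ _)) m1.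
  exact: (measurableT_comp (fine_measurable measurableT) m1).
have mabs : measurable_fun setT (fun t : R * R => `|k t.1 t.2|).
  exact: measurableT_comp.
have E x : intR (k x) = intR (fun y => `|k x y| + k x y) - intR (fun y => `|k x y|).
  rewrite -intRB; [|by apply: L1D => //; exact: L1_abs|exact: L1_abs].
  by apply: eq_intR => y; ring.
rewrite (funext E); apply: measurable_funB; apply: pos => //.
  exact: measurable_funD.
by move=> x y; have := ler_norm (- k x y); rewrite normrN; lra.
Qed.

Lemma L2_shift Q c : L2 Q -> L2 (fun x => Q (x + c)) /\ nsq (fun x => Q (x + c)) = nsq Q.
Proof.
move=> [mQ hQ].
have ms : measurable_fun setT (fun x => Q (x + c)).
  by apply: (measurableT_comp mQ); exact: measurable_funD.
have E : (\int[mu]_x (Q (x + c) ^+ 2)%:E = \int[mu]_x (Q x ^+ 2)%:E)%E.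
  have := @ge0_integral_translation R (fun x => (Q x ^+ 2)%:E) c.
  apply => [|x]; last by rewrite lee_fin sqr_ge0.
  by apply/measurable_EFinP; exact: measurable_funX.
split; last by rewrite /nsq /intR /Rintegral E.
split => //; have [] // := @ge0_L1P R (fun x => Q (x + c) ^+ 2) (nsq Q).
- exact: measurable_funX.
- by move=> x; rewrite sqr_ge0.
- by rewrite E EFin_intR.
Qed.

Lemma intR_shift Q c : L1 Q -> L1 (fun x => Q (x + c)) /\ intR (fun x => Q (x + c)) = intR Q.
Proof.
move=> hQ; have mQ := L1_measurable hQ.
have mt : measurable_fun setT (fun x : R => x + c) by exact: measurable_funD.
have key (q : R -> R) : measurable_fun setT q -> L1 q -> (forall x, 0 <= q x) ->
    L1 (fun x => q (x + c)) /\ intR (fun x => q (x + c)) = intR q.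
  move=> mq hq q0.
  have E : (\int[mu]_x (q (x + c))%:E = \int[mu]_x (q x)%:E)%E.
    have := @ge0_integral_translation R (fun x => (q x)%:E) c.
    by apply => [|x]; [exact/measurable_EFinP|rewrite lee_fin].
  split; last by rewrite /intR /Rintegral E.
  have [] // := @ge0_L1P R (fun x => q (x + c)) (intR q).
  - exact: (measurableT_comp mq mt).
  - by rewrite E EFin_intR.
have [a1 a2] := key _ (measurableT_comp (@normr_measurable _ _) mQ) (L1_abs hQ) (fun x => normr_ge0 _).
have hp : L1 (fun x => `|Q x| + Q x) by apply: L1D => //; exact: L1_abs.
have [b1 b2] : L1 (fun x => `|Q (x + c)| + Q (x + c)) /\ intR (fun x => `|Q (x + c)| + Q (x + c)) = intR (fun x => `|Q x| + Q x).
  apply: (key (fun x => `|Q x| + Q x)) => //; first exact: L1_measurable.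
  by move=> x; have := ler_norm (- Q x); rewrite normrN; lra.
have E (q : R -> R) : q = fun x => (`|q x| + q x) - `|q x|.
  by apply/funext => x; rewrite addrAC subrr add0r.
split; first by rewrite (E (fun x => Q (x + c))); exact: L1B.
rewrite (E (fun x => Q (x + c))) intRB// b2 /= [X in _ - X]a2.
rewrite intRD//; last exact: L1_abs.
by ring.
Qed.

Definition corr P Q x : R := intR (fun a => P a * Q (a - x)).

Lemma L1_corr P Q x : L2 P -> L2 Q -> L1 (fun a => P a * Q (a - x)).
Proof. by move=> hP hQ; apply: L2_mul => //; exact: (L2_shift (- x) hQ).1. Qed.

Lemma measurable_corr_kernel P Q : measurable_fun setT P -> measurable_fun setT Q ->
  measurable_fun setT (fun t : R * R => P t.2 * Q (t.2 - t.1)).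
Proof.
move=> mP mQ; apply: measurable_funM; first exact: measurable_snd2.
apply: (measurableT_comp mQ); apply: measurable_funB; first exact: measurable_snd.
exact: measurable_fst.
Qed.

Lemma measurable_corr P Q : L2 P -> L2 Q -> measurable_fun setT (corr P Q).
Proof.
move=> hP hQ; apply: (@measurable_intR (fun x a => P a * Q (a - x))).
  by apply: measurable_corr_kernel; exact: L2_measurable.
by move=> x; exact: L1_corr.
Qed.

(** Young's inequality for L1 * L2, from Cauchy-Schwarz with respect to the
    measure |P| and Tonelli's theorem. *)
Lemma young P Q K : L2 P -> L2 Q -> L1 P -> intR (fun a => `|P a|) <= K -> 0 <= K ->
  L2 (corr P Q) /\ nsq (corr P Q) <= K ^+ 2 * nsq Q.
Proof.
move=> hP hQ hP1 PK K0; have mU := measurable_corr hP hQ.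
have mP := L2_measurable hP; have mQ := L2_measurable hQ.
pose k x a := `|P a| * Q (a - x) ^+ 2.
have k0 x a : 0 <= k x a by rewrite mulr_ge0 ?sqr_ge0.
have mk : measurable_fun setT (fun t : R * R => (k t.1 t.2)%:E).
  apply/measurable_EFinP; apply: measurable_funM.
    by apply: measurableT_comp => //; exact: measurable_snd2.
  apply: measurable_funX; apply: (measurableT_comp mQ); apply: measurable_funB.
    exact: measurable_snd.
  exact: measurable_fst.
pose u x := (\int[mu]_a (k x a)%:E)%E.
have mu_ : measurable_fun setT u.
  have := @measurable_fun_fubini_tonelli_F _ _ (measurableTypeR R)
    (measurableTypeR R) R mu (fun t => (k t.1 t.2)%:E).
  by move=> /(_ mk); apply => t; exact: k0.
have u0 x : (0 <= u x)%E by apply: integral_ge0 => a _; rewrite lee_fin.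
have tonelli : (\int[mu]_x u x <= (K * nsq Q)%:E)%E.
  have := @fubini_tonelli _ _ (measurableTypeR R) (measurableTypeR R) R mu mu
    (fun t => (k t.1 t.2)%:E).
  move=> /(_ mk) /(_ (fun t => k0 _ _)); rewrite /= -/u => ->.
  have E a : (\int[mu]_x (k x a)%:E = (`|P a| * nsq Q)%:E)%E.
    have [r1 r2] := L2_shift (- a) (L2_opp hQ).
    have L : L1 (fun x => Q (a - x) ^+ 2).
      apply: L1_eq (L2_sq r1) => x; congr (Q _ ^+ 2); ring.
    rewrite (@EFin_intR _ (fun x => `|P a| * Q (a - x) ^+ 2)); last exact: L1Z.
    rewrite intRZ//; congr (_ * _)%:E; rewrite -(nsq_opp hQ) -r2.
    by apply: eq_intR => x; congr (Q _ ^+ 2); ring.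
  under eq_integral do rewrite E.
  rewrite (@EFin_intR _ (fun a => `|P a| * nsq Q)); last first.
    by under eq_fun do rewrite mulrC; apply: L1Z; exact: L1_abs.
  rewrite lee_fin; under eq_intR do rewrite mulrC.
  by rewrite intRZ; [rewrite mulrC ler_wpM2r ?nsq_ge0|exact: L1_abs].
have pw x : ((corr P Q x ^+ 2)%:E <= K%:E * u x)%E.
  have [ux|] := boolP (u x \is a fin_num); last first.
    rewrite ge0_fin_numE// -leNgt leye_eq => /eqP ->.
    have [K00|Kp] := eqVneq K 0; last first.
      by rewrite gt0_muley ?leey// lte_fin lt_def Kp.
    have P0 : {ae mu, forall a, P a = 0}.
      have : intR (fun a => `|P a|) = 0.
        by apply/eqP; rewrite eq_le intR_ge0// andbT -K00.
      move=> i0.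
      have : nsq (fun a => Num.sqrt `|P a|) = 0.
        by rewrite -i0; apply: eq_intR => a; rewrite sqr_sqrtr.
      move=> /nsq_eq0 h; have hs : L2 (fun a => Num.sqrt `|P a|).
        split; last by apply: L1_eq (L1_abs hP1) => a; rewrite sqr_sqrtr.
        by apply: measurableT_comp; [apply: continuous_measurable; exact: sqrt_continuous|exact: measurableT_comp].
      apply: (aeS _ (h hs)) => a /eqP; rewrite sqrtr_eq0 => h'.
      by apply/eqP; rewrite -normr_eq0 eq_le h' normr_ge0.
    have -> : corr P Q x = 0.
      rewrite -(@intR0 R); apply: intR_ae_eq => //.
        by apply: L1_measurable; exact: L1_corr.
      by apply: (aeS _ P0) => a ->; rewrite mul0r.
    by rewrite expr0n K00 mul0e.
  have kx : measurable_fun setT (k x).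
    apply: measurable_funM; first exact: measurableT_comp.
    by apply: measurable_funX; have [[]] := L2_shift (- x) hQ.
  have [k1 k2] : L1 (k x) /\ intR (k x) <= fine (u x).
    by apply: ge0_L1P => //; rewrite fineK.
  rewrite -(fineK ux) -EFinM lee_fin.
  have hs : L2 (fun a => Num.sqrt `|P a|).
    split; last by apply: L1_eq (L1_abs hP1) => a; rewrite sqr_sqrtr.
    by apply: measurableT_comp; [apply: continuous_measurable; exact: sqrt_continuous|exact: measurableT_comp].
  have ht : L2 (fun a => Num.sqrt `|P a| * `|Q (a - x)|).
    split; last by apply: L1_eq k1 => a; rewrite exprMn sqr_sqrtr// real_normK ?num_real.
    apply: measurable_funM; first exact: L2_measurable.
    by apply: measurableT_comp => //; have [[]] := L2_shift (- x) hQ.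
  have F0 : 0 <= fine (u x) by exact: fine_ge0.
  have := cauchy_schwarz hs ht (sqrtr_ge0 K) (sqrtr_ge0 (fine (u x))).
  rewrite !sqr_sqrtr//.
  have -> : nsq (fun a => Num.sqrt `|P a|) = intR (fun a => `|P a|).
    by apply: eq_intR => a; rewrite sqr_sqrtr.
  have -> : nsq (fun a => Num.sqrt `|P a| * `|Q (a - x)|) = intR (k x).
    by apply: eq_intR => a; rewrite exprMn sqr_sqrtr// real_normK ?num_real.
  move=> /(_ PK k2) cs.
  have cU : `|corr P Q x| <= Num.sqrt K * Num.sqrt (fine (u x)).
    apply: le_trans cs; rewrite [leRHS]ger0_norm; last first.
      by apply: intR_ge0 => a; rewrite !mulr_ge0.
    apply: intR_norm_le; [exact: L1_corr|exact: L2_mul|move=> a].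
    by rewrite mulrA -expr2 sqr_sqrtr// normrM.
  rewrite -(real_normK (num_real _)).
  apply: (@le_trans _ _ ((Num.sqrt K * Num.sqrt (fine (u x))) ^+ 2)).
    by rewrite lerXn2r ?nnegrE ?mulr_ge0.
  by rewrite exprMn !sqr_sqrtr.
have [h1 h2] : L1 (fun x => corr P Q x ^+ 2) /\ intR (fun x => corr P Q x ^+ 2) <= K ^+ 2 * nsq Q.
  apply: ge0_L1P; [exact: measurable_funX|by move=> x; rewrite sqr_ge0|].
  apply: (@le_trans _ _ (\int[mu]_x (K%:E * u x))%E).
    apply: ge0_le_integral => //.
    - by move=> x _; rewrite lee_fin sqr_ge0.
    - by apply/measurable_EFinP; exact: measurable_funX.
    - by apply: measurable_funeM.
  rewrite ge0_integralZl//.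
  apply: (le_trans (lee_wpmul2l _ tonelli)); first by rewrite lee_fin.
  by rewrite -EFinM mulrA expr2.
by split.
Qed.

Lemma corr_swap P Q x : L2 P -> L2 Q -> corr P Q x = corr Q P (- x).
Proof.
move=> hP hQ; rewrite /corr -[LHS](intR_shift x (L1_corr x hP hQ)).2.
by apply: eq_intR => a; rewrite addrK opprK mulrC.
Qed.

Lemma young_swap P Q K : L2 P -> L2 Q -> L1 Q -> intR (fun a => `|Q a|) <= K -> 0 <= K ->
  L2 (corr P Q) /\ nsq (corr P Q) <= K ^+ 2 * nsq P.
Proof.
move=> hP hQ hQ1 QK K0; have [y1 y2] := young hQ hP hQ1 QK K0.
have -> : corr P Q = fun x => corr Q P (- x) by apply/funext => x; exact: corr_swap.
by split; [exact: L2_opp|rewrite nsq_opp].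
Qed.

(** Peetre's inequality: one of y and y - x is at least half as large as x. *)
Lemma wt_peetre s x y : 0 <= s -> wt s x <= 2 `^ s * (wt s y + wt s (y - x)).
Proof.
move=> s0.
have s2 : 0 <= s / 2 by rewrite divr_ge0.
have -> : 2 `^ s = 4 `^ (s / 2) :> R.
  have -> : 4 = 2 `^ 2%:R :> R by rewrite powR_mulrn//; ring.
  by rewrite -powRrM; congr (_ `^ _); lra.
wlog h : y / `|y - x| <= `|y| => [H|].
  have [h|h] := leP `|y - x| `|y|; first exact: H.
  have := H (x - y); rewrite [x - y - x]addrAC subrr add0r normrN distrC => /(_ (ltW h)).
  by rewrite wt_opp addrC -opprB wt_opp.
apply: (@le_trans _ _ (4 `^ (s / 2) * wt s y)); last first.
  by rewrite ler_wpM2l ?powR_ge0// lerDl wt_ge0.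
rewrite /wt -powRM//; last by rewrite addr_ge0// sqr_ge0.
apply: ge0_ler_powR => //; rewrite ?nnegrE.
- by rewrite addr_ge0// sqr_ge0.
- by rewrite mulr_ge0// addr_ge0// sqr_ge0.
- have h2 : (y - x) ^+ 2 <= y ^+ 2 by exact: le_sqr_norm.
  by have := sqr_ge0 (x - 2 * y); have := sqr_ge0 (y - (y - x)); nra.
Qed.

Definition sob1 s : R := Num.sqrt (nsq (wt (- s))).

(** Peetre's inequality puts the weight on one of the factors; the other one is
    integrable because s > 1/2, so that Young's inequality applies. *)
Lemma hb_corr s A B F G : 1 / 2 < s -> 0 <= A -> 0 <= B -> L2 F -> L2 G ->
  hb s A F -> hb s B G -> hb s (2 `^ s * (2 * sob1 s * A * B)) (corr F G).
Proof.
move=> hs A0 B0 hF hG hbF hbG; have [F1 F2] := L1_of_hb hs hbF A0.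
have [G1 G2] := L1_of_hb hs hbG B0; rewrite -!/(sob1 s) in F2 G2.
have s0 : 0 <= s by lra.
have S0 : 0 <= sob1 s by exact: sqrtr_ge0.
pose P x := `|wt s x * F x|; pose Q x := `|wt s x * G x|.
have hP : L2 P by apply: L2_abs; exact: hbF.1.
have hQ : L2 Q by apply: L2_abs; exact: hbG.1.
have nP : nsq P <= A ^+ 2 by rewrite nsq_abs; exact: hbF.2.
have nQ : nsq Q <= B ^+ 2 by rewrite nsq_abs; exact: hbG.2.
have hFa := L2_abs hF; have hGa := L2_abs hG.
have [a1 a2] : L2 (corr P (fun x => `|G x|)) /\ nsq (corr P (fun x => `|G x|)) <= (sob1 s * B) ^+ 2 * nsq P.
  apply: young_swap => //; [exact: L1_abs| |exact: mulr_ge0].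
  by rewrite (@eq_intR _ _ (fun x => `|G x|)) // => x; rewrite normr_id.
have [b1 b2] : L2 (corr (fun x => `|F x|) Q) /\ nsq (corr (fun x => `|F x|) Q) <= (sob1 s * A) ^+ 2 * nsq Q.
  apply: young => //; [exact: L1_abs| |exact: mulr_ge0].
  by rewrite (@eq_intR _ _ (fun x => `|F x|)) // => x; rewrite normr_id.
have le x : `|wt s x * corr F G x| <= `|2 `^ s * (corr P (fun x => `|G x|) x + corr (fun x => `|F x|) Q x)|.
  have i1 := L1_corr x hP hGa; have i2 := L1_corr x hFa hQ.
  rewrite [leRHS]ger0_norm; last first.
    rewrite mulr_ge0 ?powR_ge0// addr_ge0//; apply: intR_ge0 => a; rewrite mulr_ge0//; exact: normr_ge0.
  rewrite /corr -intRD// -(intRZ (wt s x)); last exact: L1_corr.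
  rewrite -(intRZ (2 `^ s)); last exact: L1D.
  apply: intR_norm_le; [by apply: L1Z; exact: L1_corr|by apply: L1Z; exact: L1D|move=> a].
  rewrite !normrM (ger0_norm (wt_ge0 _ _)) /P /Q !normrM !(ger0_norm (wt_ge0 _ _)).
  have w := wt_peetre x a s0.
  have -> : 2 `^ s * (wt s a * `|F a| * `|G (a - x)| + `|F a| * (wt s (a - x) * `|G (a - x)|)) =
    (2 `^ s * (wt s a + wt s (a - x))) * (`|F a| * `|G (a - x)|) by ring.
  by rewrite ler_wpM2r ?mulr_ge0.
have hR : L2 (fun x => 2 `^ s * (corr P (fun x => `|G x|) x + corr (fun x => `|F x|) Q x)).
  by apply: L2Z; exact: L2D.
have hL : L2 (fun x => wt s x * corr F G x).
  apply: (sq_L1_of_le _ hR le); apply: measurable_funM; first exact: measurable_wt.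
  exact: measurable_corr.
split => //; apply: (le_trans (nsq_le hL hR le)).
rewrite nsqZ; last exact: L2D.
rewrite exprMn ler_wpM2l ?sqr_ge0//.
have D0 : 0 <= sob1 s * A * B by rewrite !mulr_ge0.
have -> : 2 * sob1 s * A * B = sob1 s * A * B + sob1 s * A * B by ring.
apply: minkowski2 => //.
- apply: (le_trans a2); rewrite -[leRHS]/(_ ^+ 2).
  have -> : (sob1 s * A * B) ^+ 2 = (sob1 s * B) ^+ 2 * A ^+ 2 by ring.
  by rewrite ler_wpM2l ?sqr_ge0.
- apply: (le_trans b2).
  have -> : (sob1 s * A * B) ^+ 2 = (sob1 s * A) ^+ 2 * B ^+ 2 by ring.
  by rewrite ler_wpM2l ?sqr_ge0.
Qed.

Lemma hb_opp s A F : hb s A F -> hb s A (fun x => F (- x)).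
Proof.
move=> [h1 h2]; have E : (fun x => wt s x * F (- x)) = fun x => wt s (- x) * F (- x).
  by apply/funext => x; rewrite wt_opp.
by rewrite /hb E; split; [exact: (L2_opp h1)|rewrite (nsq_opp h1)].
Qed.

Lemma hbD s A B F G : 0 <= A -> 0 <= B -> hb s A F -> hb s B G ->
  hb s (A + B) (fun x => F x + G x).
Proof.
move=> A0 B0 [f1 f2] [g1 g2].
have E : (fun x => wt s x * (F x + G x)) = fun x => wt s x * F x + wt s x * G x.
  by apply/funext => x; rewrite mulrDr.
by rewrite /hb E; split; [exact: L2D|exact: minkowski2].
Qed.

Lemma hbZ s A c F : hb s A F -> hb s (`|c| * A) (fun x => c * F x).
Proof.
move=> [f1 f2].
have E : (fun x => wt s x * (c * F x)) = fun x => c * (wt s x * F x).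
  by apply/funext => x; rewrite mulrCA.
rewrite /hb E; split; first exact: L2Z.
by rewrite nsqZ// exprMn real_normK ?num_real// ler_wpM2l// sqr_ge0.
Qed.

(** The transform of a product: a convolution rewritten for the Hartley
    transform by means of cas A cas B = cos (A - B) + sin (A + B). *)
Definition hconv F G x : R := cF / 2 * (corr F G x + corr F (fun z => G (- z)) x +
  corr F G (- x) + -1 * corr F (fun z => G (- z)) (- x)).

Lemma hart_trunc_product n f g F z : continuous f -> continuous g -> L2 f ->
  is_hartley f F -> L1 F ->
  hart (trunc n (fun x => f x * g x)) z = hconv F (hart (trunc n g)) z.
Proof.
move=> cf cg hf fF F1; have [F2 _] := fF.
have t1 := L1_trunc n cg; have t2 := L2_hart_trunc n cg.
pose r x := trunc n g x * cas (x * z).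
have r1 : L1 r by exact: L1_cas.
have [mk dk] := hart_sym_kernel r1 F1.
have fub := intR_fubini mk (L1Z 2 (L1_abs r1)) (L1_abs F1) dk.
have E1 x : intR (fun a => r x * F a * cas (x * a)) = cF^-1 * (f x * r x).
  have -> : cF^-1 * (f x * r x) = r x * (cF^-1 * f x) by ring.
  rewrite (hartley_inversion x cf hf fF F1) mulKf ?gt_eqF ?cF_gt0//.
  rewrite -intRZ; last exact: L1_cas.
  by apply: eq_intR => a; rewrite mulrA [x * a]mulrC.
have fr : L1 (fun x => f x * r x).
  apply: L1_eq (L1_cas z (L1_box (- n%:R) n%:R (contM cf cg))) => x.
  by rewrite /r /trunc; ring.
pose h := hart (trunc n g).
have E2 a : intR (fun x => r x * F a * cas (x * a)) = cF^-1 *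
   (2^-1 * (F a * h (a - z) + F a * h (- (a - z)) + F a * h (a + z) + -1 * (F a * h (- (a + z))))).
  have lc w : L1 (fun x => trunc n g x * cas (x * w)) by exact: L1_cas.
  have -> : 2^-1 * (F a * h (a - z) + F a * h (- (a - z)) + F a * h (a + z) + -1 * (F a * h (- (a + z)))) =
    cF * (F a / 2 * (intR (fun x => trunc n g x * cas (x * (a - z))) + intR (fun x => trunc n g x * cas (x * - (a - z)))
      + intR (fun x => trunc n g x * cas (x * (a + z))) + -1 * intR (fun x => trunc n g x * cas (x * - (a + z))))).
    by rewrite /h /hart; field.
  rewrite mulKf ?gt_eqF ?cF_gt0// -(intRZ (-1)); last exact: lc.
  rewrite -intRD; [|exact: lc|exact: lc].
  rewrite -intRD; [|by apply: L1D; exact: lc|exact: lc].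
  rewrite -intRD; [|by apply: L1D; [apply: L1D|]; exact: lc|by apply: L1Z; exact: lc].
  rewrite -intRZ; last by apply: L1D; [apply: L1D; [apply: L1D|]; exact: lc|apply: L1Z; exact: lc].
  apply: eq_intR => x; rewrite /r.
  have -> : trunc n g x * cas (x * z) * F a * cas (x * a) = F a * trunc n g x * (cas (a * x) * cas (z * x)).
    by rewrite [x * z]mulrC [x * a]mulrC; ring.
  rewrite casM; set u := (a - z) * x; set v := (a + z) * x.
  rewrite ![x * _]mulrC !mulNr -/u -/v /cas !cosN !sinN.
  by field.
rewrite (eq_intR E1) (eq_intR E2) intRZ// in fub.
have hh := t2; have hho := L2_opp t2.
have k1 := L1_corr z F2 hh; have k2 := L1_corr z F2 hho.
have k3 := L1_corr (- z) F2 hh; have k4 := L1_corr (- z) F2 hho.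
have K1 : L1 (fun a => F a * h (a - z)) by [].
have K2 : L1 (fun a => F a * h (- (a - z))) by [].
have K3 : L1 (fun a => F a * h (a + z)) by apply: L1_eq k3 => a; rewrite opprK.
have K4 : L1 (fun a => F a * h (- (a + z))) by apply: L1_eq k4 => a; rewrite opprK.
have S3 : corr F h (- z) = intR (fun a => F a * h (a + z)) by apply: eq_intR => a; rewrite opprK.
have S4 : corr F (fun z => h (- z)) (- z) = intR (fun a => F a * h (- (a + z))) by apply: eq_intR => a; rewrite opprK.
have L12 := L1D K1 K2; have L123 := L1D L12 K3; have L4 := L1Z (-1) K4.
have L1234 := L1D L123 L4.
rewrite (intRZ cF^-1 (L1Z 2^-1 L1234)) in fub.
have {}fub := mulfI (_ : cF^-1 != 0) fub.
have cN0 : (cF : R)^-1 != 0 by rewrite invr_eq0 gt_eqF ?cF_gt0.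
move: (fub cN0); rewrite (intRZ 2^-1 L1234) (intRD L123 L4) (intRD L12 K3) (intRD K1 K2) (intRZ (-1) K4) => e.
rewrite /hart -(_ : intR (fun x => f x * r x) = intR (fun x => trunc n (fun x => f x * g x) x * cas (x * z))); last first.
  by apply: eq_intR => x; rewrite /r /trunc; ring.
by rewrite e /hconv S3 S4 mulrA.
Qed.

Lemma L2cvg_corr F (G_ : nat -> R -> R) G : L2 F -> L1 F ->
  (forall n, L2 (G_ n)) -> L2 G -> L2cvg G_ G ->
  L2cvg (fun n => corr F (G_ n)) (corr F G).
Proof.
move=> F2 F1 hG_ hG cG; pose K := intR (fun a => `|F a|).
have K0 : 0 <= K by exact: intR_ge0.
have c0 : K ^+ 2 * nsq (fun x => G_ n x - G x) @[n --> \oo] --> 0.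
  by rewrite -[X in _ --> X](mulr0 (K ^+ 2)); exact: cvgMl_tmp.
apply: (@squeeze_cvgr _ _ _ _ (fun=> 0) _ _ _ _ _ c0); last exact: cvg_cst.
apply: nearW => n; rewrite nsq_ge0/=.
have [y1 y2] := young F2 (L2B (hG_ n) hG) F1 (lexx K) K0.
apply: le_trans y2; rewrite le_eqVlt; apply/orP; left; apply/eqP.
apply: eq_nsq => x; rewrite /corr -intRB; [|exact: L1_corr|exact: L1_corr].
by apply: eq_intR => a; rewrite mulrBr.
Qed.

Lemma L2_corr F G : L2 F -> L1 F -> L2 G -> L2 (corr F G).
Proof. by move=> F2 F1 hG; have [] := young F2 hG F1 (lexx _) (intR_ge0 (fun a => normr_ge0 _)). Qed.

Lemma hartley_product f g F G : continuous f -> continuous g -> L2 f ->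
  is_hartley f F -> L1 F -> is_hartley g G ->
  is_hartley (fun x => f x * g x) (hconv F G).
Proof.
move=> cf cg hf fF F1 [G2 gG]; have [F2 _] := fF.
have t2 n := L2_hart_trunc n cg.
have lc H : L2 H -> L2 (corr F H) by move=> hH; exact: L2_corr.
have lo H : L2 H -> L2 (fun x => corr F (fun z => H (- z)) x) by move=> hH; apply: lc; exact: L2_opp.
have lr H : L2 H -> L2 (fun x => corr F H (- x)) by move=> hH; apply: (L2_opp (lc _ hH)).
have lro H : L2 H -> L2 (fun x => -1 * corr F (fun z => H (- z)) (- x)).
  by move=> hH; apply: L2Z; apply: (L2_opp (lo _ hH)).
split; first by apply: L2Z; apply: L2D; [apply: L2D; [apply: L2D|]|]; auto.
have -> : (fun n => hart (trunc n (fun x => f x * g x))) = fun n => hconv F (hart (trunc n g)).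
  by apply/funext => n; apply/funext => z; exact: hart_trunc_product.
have c1 : L2cvg (fun n => corr F (hart (trunc n g))) (corr F G) by exact: L2cvg_corr.
have c2 : L2cvg (fun n => corr F (fun z => hart (trunc n g) (- z))) (corr F (fun z => G (- z))).
  apply: L2cvg_corr => //; [by move=> n; exact: (L2_opp (t2 n))|exact: L2_opp|].
  exact: (L2cvg_opp t2 G2 gG).
have c3 := L2cvg_opp (fun n => lc _ (t2 n)) (lc _ G2) c1.
have c4 := L2cvg_opp (fun n => lo _ (t2 n)) (lo _ G2) c2.
apply: L2cvgZ.
- by move=> n; apply: L2D; [apply: L2D; [apply: L2D|]|]; auto.
- by apply: L2D; [apply: L2D; [apply: L2D|]|]; auto.
apply: L2cvgD.
- by move=> n; apply: L2D; [apply: L2D|]; auto.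
- by apply: L2D; [apply: L2D|]; auto.
- by move=> n; exact: lro.
- exact: lro.
- apply: L2cvgD.
  + by move=> n; apply: L2D; auto.
  + by apply: L2D; auto.
  + by move=> n; exact: lr.
  + exact: lr.
  + exact: (L2cvgD (fun n => lc _ (t2 n)) (lc _ G2) (fun n => lo _ (t2 n)) (lo _ G2) c1 c2).
  + exact: c3.
- apply: L2cvgZ; [by move=> n; exact: (L2_opp (lo _ (t2 n)))|exact: (L2_opp (lo _ G2))|exact: c4].
Qed.

Definition algC s : R := 4 * (2 `^ s * (2 * sob1 s)).

Lemma algC_ge0 s : 0 <= algC s.
Proof. by rewrite !mulr_ge0// ?powR_ge0// sqrtr_ge0. Qed.

Lemma Hbd_mul s A B f g : 1 / 2 < s -> 0 <= A -> 0 <= B ->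
  continuous f -> continuous g -> L2 f -> Hbd s A f -> Hbd s B g ->
  Hbd s (algC s * A * B) (fun x => f x * g x).
Proof.
move=> hs A0 B0 cf cg hf [F [fF hF]] [G [gG hG]].
have [F1 _] := L1_of_hb hs hF A0; have [F2 _] := fF; have [G2 _] := gG.
exists (hconv F G); split; first exact: hartley_product.
set D := 2 `^ s * (2 * sob1 s * A * B).
have D0 : 0 <= D by rewrite !mulr_ge0 ?powR_ge0// sqrtr_ge0.
have hGo := hb_opp hG; have G2o := L2_opp G2.
have h1 : hb s D (corr F G) by exact: hb_corr.
have h2 : hb s D (corr F (fun z => G (- z))) by exact: hb_corr.
have h3 := hb_opp h1; have h4 := hbZ (-1) (hb_opp h2).
rewrite normrN1 mul1r in h4.
have DD : 0 <= D + D by exact: addr_ge0.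
have h := hbZ (cF / 2) (hbD (addr_ge0 DD D0) D0 (hbD DD D0 (hbD D0 D0 h1 h2) h3) h4).
apply: hbW h => //; last first.
  have lc H : L2 H -> L2 (corr F H) by move=> hH; exact: L2_corr.
  apply: L2_measurable; apply: L2Z; apply: L2D; [apply: L2D; [apply: L2D|]|].
  - exact: lc.
  - exact: lc.
  - exact: (L2_opp (lc _ G2)).
  - by apply: L2Z; exact: (L2_opp (lc _ G2o)).
have -> : algC s * A * B = 4 * D by rewrite /algC /D; ring.
apply: le_sqr_norm; rewrite normrM normr_id [`|4 * D|]ger0_norm; last exact: mulr_ge0.
rewrite (ger0_norm (_ : 0 <= D + D + D + D)); last by rewrite !addr_ge0.
rewrite ger0_norm; last by rewrite divr_ge0 ?(ltW cF_gt0).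
by have := @cF_le1 R; have := @cF_gt0 R; nra.
Qed.

End Product.

(** * Curves in the space of bounded continuous square integrable functions *)

Section Energy.
Context {R : realType}.
Local Notation mu := (@lebesgue_measure R).
Implicit Types (f g h : R -> R) (u : R -> R -> R) (a b t A B M K : R).

(** E is the intersection of L2 with the bounded continuous functions. It is the
    space in which solutions are estimated, because there A and the product have
    norm at most one and because the lower bound on eta controls its norm. *)
Definition Ebd M f := [/\ continuous f, forall x, `|f x| <= M, L2 f & nsq f <= M ^+ 2].

Lemma Ebd_cont M f : Ebd M f -> continuous f. Proof. by case. Qed.
Lemma Ebd_sup M f x : Ebd M f -> `|f x| <= M. Proof. by case. Qed.
Lemma Ebd_L2 M f : Ebd M f -> L2 f. Proof. by case. Qed.
Lemma Ebd_nsq M f : Ebd M f -> nsq f <= M ^+ 2. Proof. by case. Qed.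

Lemma Ebd_ge0 M f : Ebd M f -> 0 <= M.
Proof. by move=> /(Ebd_sup 0); exact: le_trans. Qed.

Lemma Ebd_eq M f g : f =1 g -> Ebd M f -> Ebd M g.
Proof. by move=> /funext ->. Qed.

Lemma EbdW M K f : M <= K -> Ebd M f -> Ebd K f.
Proof.
move=> MK h; have M0 := Ebd_ge0 h; case: h => cf fM f2 fn; split => //.
  by move=> x; exact: le_trans MK.
by apply: (le_trans fn); rewrite lerXn2r ?nnegrE// (le_trans M0).
Qed.

Lemma Ebd_0 M : 0 <= M -> Ebd M (fun=> 0).
Proof.
move=> M0; split; [by move=> x; exact: cvg_cst|by move=> x; rewrite normr0|exact: L2_0|].
rewrite /nsq (@eq_intR _ _ (fun=> 0)) ?intR0 ?sqr_ge0// => x.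
by rewrite expr0n.
Qed.

Lemma EbdD A B f g : Ebd A f -> Ebd B g -> Ebd (A + B) (fun x => f x + g x).
Proof.
move=> hf hg; have A0 := Ebd_ge0 hf; have B0 := Ebd_ge0 hg.
case: hf => cf fA f2 fn; case: hg => cg gB g2 gn; split.
- exact: contD.
- by move=> x; apply: (le_trans (ler_normD _ _)); exact: lerD.
- exact: L2D.
- exact: minkowski2.
Qed.

Lemma EbdZ c M f : Ebd M f -> Ebd (`|c| * M) (fun x => c * f x).
Proof.
move=> [cf fM f2 fn]; split.
- exact: contZ.
- by move=> x; rewrite normrM ler_wpM2l.
- exact: L2Z.
- by rewrite nsqZ// exprMn real_normK ?num_real// ler_wpM2l// sqr_ge0.
Qed.

Lemma EbdN M f : Ebd M f -> Ebd M (fun x => - f x).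
Proof.
move=> /(EbdZ (-1)); rewrite normrN1 mul1r; apply: Ebd_eq => x.
by rewrite mulN1r.
Qed.

Lemma EbdB A B f g : Ebd A f -> Ebd B g -> Ebd (A + B) (fun x => f x - g x).
Proof. by move=> hf /EbdN; exact: EbdD. Qed.

Lemma EbdM A B f g : Ebd A f -> Ebd B g -> Ebd (A * B) (fun x => f x * g x).
Proof.
move=> hf hg; have A0 := Ebd_ge0 hf.
case: hf => cf fA f2 fn; have B0 := Ebd_ge0 hg; case: hg => cg gB g2 gn.
have le x : `|f x * g x| <= `|A * g x|.
  by rewrite !normrM (ger0_norm A0) ler_wpM2r.
have h2 : L2 (fun x => A * g x) by exact: L2Z.
have h1 : L2 (fun x => f x * g x).
  by apply: sq_L1_of_le le => //; apply: continuous_measurable; exact: contM.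
split => //; first exact: contM.
  by move=> x; rewrite normrM ler_pM.
apply: (le_trans (nsq_le h1 h2 le)); rewrite nsqZ// exprMn.
by rewrite ler_wpM2l ?sqr_ge0.
Qed.

Lemma Ebd_Aop M f : Ebd M f -> Ebd M (Aop f).
Proof.
move=> [cf fM f2 fn]; have [a1 a2] := Aop_L2 cf fM f2; split => //.
- exact: continuous_Aop.
- by move=> x; exact: Aop_bound.
- exact: le_trans fn.
Qed.

Lemma Ebd_Gop M f : Ebd M f -> Ebd M (Gop f).
Proof.
move=> [cf fM f2 fn]; have [a1 a2] := Gop_L2 cf fM f2; split => //.
- exact: continuous_Gop.
- by move=> x; exact: Gop_bound.
- exact: le_trans fn.
Qed.

Definition finE f := exists M, Ebd M f.

Lemma AopB f g : finE f -> finE g -> Aop (fun x => f x - g x) = fun x => Aop f x - Aop g x.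
Proof.
move=> [A [cf fA _ _]] [B [cg gB _ _]]; apply/funext => x.
have gB' y : `|-1 * g y| <= B by rewrite mulN1r normrN.
have -> : (fun x => f x - g x) = fun x => f x + -1 * g x.
  by apply/funext => y; rewrite mulN1r.
by rewrite (AopD cf (contZ (c := -1) cg) fA gB') (AopZ cg gB) mulN1r.
Qed.

Lemma AopZ_E c f : finE f -> Aop (fun x => c * f x) = fun x => c * Aop f x.
Proof. by move=> [A [cf fA _ _]]; apply/funext => x; rewrite (AopZ cf fA). Qed.

Definition Econt u t := forall e, 0 < e ->
  exists2 d, 0 < d & forall r, `|r - t| < d -> Ebd e (fun x => u r x - u t x).

Definition Ederiv u t f := forall e, 0 < e -> exists2 d, 0 < d &
  forall r, `|r - t| < d -> Ebd (e * `|r - t|) (fun x => u r x - u t x - (r - t) * f x).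

(** The weak equations first yield differentiability in this weaker sense; that the
    remainder is also small in L2 is a consequence of the mean value inequality. *)
Definition Sderiv u t f := forall e, 0 < e -> exists2 d, 0 < d &
  forall r, `|r - t| < d -> continuous (u r) /\
    forall x, `|u r x - u t x - (r - t) * f x| <= e * `|r - t|.

Lemma Sderiv_of_E u t f : continuous (u t) -> continuous f ->
  Ederiv u t f -> Sderiv u t f.
Proof.
move=> cu cf h e e0; have [d d0 hd] := h e e0; exists d => // r /hd H; split.
  have -> : u r = fun x => (u r x - u t x - (r - t) * f x) + (u t x + (r - t) * f x).
    by apply/funext => x; ring.
  apply: contD; first exact: (Ebd_cont H).
  by apply: contD => //; exact: contZ.
by move=> x; exact: (Ebd_sup x H).
Qed.

Lemma Ederiv_cont u t f : Ederiv u t f -> finE f -> Econt u t.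
Proof.
move=> h [K hK] e e0; have K0 := Ebd_ge0 hK; have [d d0 hd] := h 1 ltr01.
exists (Num.min d (e / (1 + K))).
  by rewrite lt_min d0 divr_gt0// ltr_pwDl.
move=> r; rewrite lt_min => /andP[rd re].
apply: (@EbdW (1 * `|r - t| + `|r - t| * K)).
  by rewrite mul1r -{1}[X in X + _]mulr1 -mulrDr -ler_pdivlMr ?ltr_pwDl// ltW.
by apply: Ebd_eq (EbdD (hd r rd) (EbdZ (r - t) hK)) => x; ring.
Qed.

Lemma is_derive_of_bound (F : R -> R) t (l : R) :
  (forall e, 0 < e -> exists2 d, 0 < d & forall r, `|r - t| < d ->
    `|F r - F t - (r - t) * l| <= e * `|r - t|) -> is_derive t (1:R) F l.
Proof.
move=> H.
have c : h^-1 *: (F (h *: (1:R) + t) - F t) @[h --> (0:R)^'] --> l.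
  apply/cvgrPdist_le => e e0; have [d d0 hd] := H e e0.
  near=> h.
  have h0 : h != 0 by near: h; exact: nbhs_dnbhs_neq.
  have hd' : `|h| < d.
    near: h; apply: dnbhs0_lt; exact: d0.
  have := hd (h + t); rewrite addrK => /(_ hd').
  rewrite /GRing.scale/= mulr1.
  have -> : l - h^-1 * (F (h + t) - F t) = - (h^-1 * (F (h + t) - F t - h * l)).
    by field.
  rewrite normrN normrM normfV => hh.
  by rewrite mulrC ler_pdivrMr ?normr_gt0.
apply: DeriveDef; [exact: (cvgP _ c)|exact: (cvg_lim _ c)].
Unshelve. all: by end_near. Qed.

Lemma mean_value (F G : R -> R) a b : a <= b ->
  (forall t, a <= t -> t <= b -> is_derive t (1:R) F (G t)) ->
  exists c, [/\ a <= c, c <= b & F b - F a = G c * (b - a)].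
Proof.
move=> ab H; have [||c] := @MVT_segment R F G a b ab.
- by move=> x; rewrite in_itv/= => /andP[/ltW ax /ltW xb]; exact: H.
- apply: derivable_within_continuous => x; rewrite in_itv/= => /andP[ax xb].
  by have [] := H x ax xb.
- by rewrite in_itv/= => /andP[ac cb] E; exists c.
Qed.

Lemma Sderiv_pt u t f (x : R) : Sderiv u t f -> is_derive t (1:R) (fun r => u r x) (f x).
Proof.
by move=> h; apply: is_derive_of_bound => e /h[d d0 hd]; exists d => // r /hd[_].
Qed.

Lemma le_of_sqr_le (q c : R) : 0 <= c -> 0 <= q -> q <= Num.sqrt q * c -> q <= c ^+ 2.
Proof.
move=> c0 q0 h; have s0 := sqrtr_ge0 q; have E := sqr_sqrtr q0.
move: h; rewrite -{1 3}E; move: (Num.sqrt q) s0 => t t0 h.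
have [->|tn] := eqVneq t 0; first by rewrite expr0n sqr_ge0.
have tp : 0 < t by rewrite lt_def tn.
by rewrite lerXn2r ?nnegrE// -(ler_pM2l tp) -expr2.
Qed.

Lemma L2_of_box w (c : R) : continuous w ->
  (forall n, nsq (fun x => box (- n%:R) n%:R x * w x) <= c) -> L2 w /\ nsq w <= c.
Proof.
move=> cw h; have mw := continuous_measurable cw.
have [] // := @intR_fatou R (fun n x => (box (- n%:R) n%:R x * w x) ^+ 2) (fun x => w x ^+ 2) c.
- by move=> n; apply: L2_sq; exact: L2_box.
- by move=> n x; exact: sqr_ge0.
- exact: measurable_funX.
- by move=> x; exact: sqr_ge0.
- apply: (aeS _ (box_cvg_ae w)) => x hx.
  by rewrite expr2; under eq_fun do rewrite expr2; exact: cvgM.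
Qed.

(** Mean value inequality.  The square integral of the increment w is estimated
    by duality: its truncations are integrable, so that pairing with them
    is a linear form continuous for the supremum norm. *)
Lemma E_mean_value u (v : R -> R -> R) a b B : a <= b ->
  (forall t, a <= t -> t <= b -> Sderiv u t (v t)) ->
  (forall t, a <= t -> t <= b -> Ebd B (v t)) ->
  Ebd (B * (b - a)) (fun x => u b x - u a x).
Proof.
move=> ab du bv; have B0 : 0 <= B by exact: (Ebd_ge0 (bv a (lexx _) ab)).
have ba0 : 0 <= b - a by rewrite subr_ge0.
have Bba : 0 <= B * (b - a) by exact: mulr_ge0.
have cu t : a <= t -> t <= b -> continuous (u t).
  move=> h1 h2; have [d d0 hd] := du t h1 h2 1 ltr01.
  by have [] := hd t; rewrite ?subrr ?normr0.
pose w x := u b x - u a x; have cw : continuous w by apply: contB; apply: cu.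
have [|w2 wn] := @L2_of_box w ((B * (b - a)) ^+ 2) cw; last first.
  split => // x; have [|c [ac cb ->]] := @mean_value (fun t => u t x) (fun t => v t x) a b ab.
    by move=> t h1 h2; apply: Sderiv_pt; exact: du.
  by rewrite normrM (ger0_norm ba0) ler_wpM2r//; exact: (Ebd_sup x (bv c ac cb)).
move=> n; pose g x := box (- n%:R) n%:R x * w x.
have g1 : L1 g by exact: L1_box.
have g2 : L2 g by exact: L2_box.
have pg f : continuous f -> L1 (fun x => g x * f x).
  move=> cf; apply: L1_eq (L1_box (- n%:R) n%:R (contM cw cf)) => x.
  by rewrite /g mulrA.
pose k := intR (fun x => `|g x|); have k0 : 0 <= k by exact: intR_ge0.
have [|c [ac cb]] := @mean_value (fun t => intR (fun x => g x * u t x))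
    (fun t => intR (fun x => g x * v t x)) a b ab.
  move=> t at_ tb; apply: is_derive_of_bound => e e0.
  have k1 : 0 < k + 1 by rewrite ltr_wpDl.
  have [d d0 hd] := du t at_ tb (e / (k + 1)) (divr_gt0 e0 k1).
  exists d => // r /hd[cr H].
  have ct := cu t at_ tb; have cv := Ebd_cont (bv t at_ tb).
  rewrite -intRB; [|exact: pg|exact: pg].
  rewrite -intRZ; last exact: pg.
  rewrite -intRB; [|by apply: L1B; exact: pg|by apply: L1Z; exact: pg].
  apply: (@le_trans _ _ (intR (fun x => (e / (k + 1) * `|r - t|) * `|g x|))).
    apply: intR_norm_le => [||x].
    - by apply: L1B; [apply: L1B; exact: pg|apply: L1Z; exact: pg].
    - by apply: L1Z; exact: L1_abs.
    - have -> : g x * u r x - g x * u t x - (r - t) * (g x * v t x) =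
        g x * (u r x - u t x - (r - t) * v t x) by ring.
      by rewrite normrM mulrC ler_wpM2r.
  rewrite intRZ; last exact: L1_abs.
  rewrite -/k mulrAC ler_wpM2r// -mulrA ler_piMr ?(ltW e0)// mulrC.
  by rewrite ler_pdivrMr// mul1r lerDl.
rewrite -intRB; [|by apply: pg; exact: cu|by apply: pg; exact: cu].
have -> : intR (fun x => g x * u b x - g x * u a x) = nsq g.
  apply: eq_intR => x; rewrite -mulrBr -/(w x) /g exprMn box_sq expr2; ring.
move=> E; apply: le_of_sqr_le => //; first exact: nsq_ge0.
rewrite [X in X <= _]E mulrA ler_wpM2r//.
have hv := bv c ac cb; apply: (le_trans (ler_norm _)).
apply: cauchy_schwarz => //; [exact: (Ebd_L2 hv)| |exact: (Ebd_nsq hv)].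
by rewrite sqr_sqrtr ?nsq_ge0.
Qed.

(** Apply the mean value inequality to u q - (q - t) * v t, whose derivative v q - v t
    is small in E. *)
Lemma Ederiv_of_S u (v : R -> R -> R) t : Econt v t ->
  (exists2 d, 0 < d & forall r, `|r - t| < d -> finE (v r) /\ Sderiv u r (v r)) ->
  Ederiv u t (v t).
Proof.
move=> cv [d1 d10 H] e e0; have [d2 d20 hd] := cv e e0.
exists (Num.min d1 d2); first by rewrite lt_min d10.
move=> r; rewrite lt_min => /andP[r1 r2].
pose z q x := u q x - (q - t) * v t x.
have S q : `|q - t| <= `|r - t| -> Sderiv z q (fun x => v q x - v t x).
  move=> qr e' e'0; have [_ hq] := H q (le_lt_trans qr r1).
  have [d d0 hd'] := hq e' e'0; exists d => // p /hd'[c1 c2].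
  have [|[K [ct _ _ _]] _] := H t; first by rewrite subrr normr0.
  split; first by apply: contB => //; exact: contZ.
  move=> x; have -> : z p x - z q x - (p - q) * (v q x - v t x) =
    u p x - u q x - (p - q) * v q x by rewrite /z; ring.
  exact: c2.
have B q : `|q - t| <= `|r - t| -> Ebd e (fun x => v q x - v t x).
  by move=> qr; apply: hd; exact: le_lt_trans r2.
have [tr|rt] := leP t r.
  rewrite (ger0_norm (_ : 0 <= r - t)) ?subr_ge0//.
  apply: Ebd_eq (@E_mean_value z (fun q x => v q x - v t x) t r e tr _ _).
  - by move=> x; rewrite /z; ring.
  - by move=> q tq qr; apply: S; rewrite !ger0_norm ?subr_ge0 ?lerB.
  - by move=> q tq qr; apply: B; rewrite !ger0_norm ?subr_ge0 ?lerB.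
rewrite (ltr0_norm (_ : r - t < 0)) ?subr_lt0// opprB.
apply: Ebd_eq (EbdN (@E_mean_value z (fun q x => v q x - v t x) r t e (ltW rt) _ _)).
- by move=> x; rewrite /z; ring.
- by move=> q tq qr; apply: S; rewrite !ler0_norm ?subr_le0 ?(ltW rt)// !opprB lerB.
- by move=> q tq qr; apply: B; rewrite !ler0_norm ?subr_le0 ?(ltW rt)// !opprB lerB.
Qed.

Lemma inED f g : finE f -> finE g -> finE (fun x => f x + g x).
Proof. by move=> [A hA] [B hB]; exists (A + B); exact: EbdD. Qed.

Lemma inEB f g : finE f -> finE g -> finE (fun x => f x - g x).
Proof. by move=> [A hA] [B hB]; exists (A + B); exact: EbdB. Qed.

Lemma inEM f g : finE f -> finE g -> finE (fun x => f x * g x).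
Proof. by move=> [A hA] [B hB]; exists (A * B); exact: EbdM. Qed.

Lemma inEZ c f : finE f -> finE (fun x => c * f x).
Proof. by move=> [A hA]; exists (`|c| * A); exact: EbdZ. Qed.

Lemma inE_L2 f : finE f -> L2 f. Proof. by move=> [A /Ebd_L2]. Qed.
Lemma inE_cont f : finE f -> continuous f. Proof. by move=> [A /Ebd_cont]. Qed.
Lemma inE_Aop f : finE f -> finE (Aop f).
Proof. by move=> [A hA]; exists A; exact: Ebd_Aop. Qed.
Lemma inE_Gop f : finE f -> finE (Gop f).
Proof. by move=> [A hA]; exists A; exact: Ebd_Gop. Qed.

Lemma Econt_bd u t M : Econt u t -> Ebd M (u t) ->
  exists2 d, 0 < d & forall r, `|r - t| < d -> Ebd (M + 1) (u r).
Proof.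
move=> /(_ 1 ltr01)[d d0 hd] hM; exists d => // r /hd h.
by apply: Ebd_eq (EbdD hM h) => x; ring.
Qed.

Lemma Econt_ext u w t : (forall r, u r =1 w r) -> Econt u t -> Econt w t.
Proof. by move=> h; have -> // : w = u by apply/funext => r; apply/funext => x; rewrite h. Qed.

Lemma EcontD u w t : Econt u t -> Econt w t -> Econt (fun r x => u r x + w r x) t.
Proof.
move=> hu hw e e0; have e2 : 0 < e / 2 by rewrite divr_gt0.
have [d1 d10 h1] := hu _ e2; have [d2 d20 h2] := hw _ e2.
exists (Num.min d1 d2); first by rewrite lt_min d10.
move=> r; rewrite lt_min => /andP[/h1 k1 /h2 k2]; rewrite (splitr e).
by apply: Ebd_eq (EbdD k1 k2) => x; ring.
Qed.

Lemma EcontZ c u t : Econt u t -> Econt (fun r x => c * u r x) t.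
Proof.
move=> hu e e0; have c0 : 0 < `|c| + 1 by rewrite ltr_wpDl.
have [d d0 h] := hu _ (divr_gt0 e0 c0).
exists d => // r /h /(EbdZ c) k; apply: (@EbdW (`|c| * (e / (`|c| + 1)))).
  by rewrite mulrCA ler_piMr ?(ltW e0)// ler_pdivrMr// mul1r lerDl.
by apply: Ebd_eq k => x; ring.
Qed.

Lemma EcontM u w t : finE (u t) -> finE (w t) -> Econt u t -> Econt w t ->
  Econt (fun r x => u r x * w r x) t.
Proof.
move=> [A hA] [B hB] hu hw e e0; have A0 := Ebd_ge0 hA; have B0 := Ebd_ge0 hB.
have [d3 d30 h3] := Econt_bd hw hB.
pose q := A + B + 1; have q0 : 0 < q by rewrite /q ltr_wpDl// addr_ge0.
have [k k0 <-] : exists2 k, 0 < k & k * q = e by exists (e / q); rewrite ?divr_gt0// divfK ?gt_eqF.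
have [d1 d10 h1] := hu _ k0; have [d2 d20 h2] := hw _ k0.
exists (Num.min d3 (Num.min d1 d2)); first by rewrite !lt_min d10 d20 d30.
move=> r; rewrite !lt_min => /and3P[/h3 k3 /h1 k1 /h2 k2].
apply: (@EbdW (k * (B + 1) + A * k)); first by rewrite /q; lra.
by apply: Ebd_eq (EbdD (EbdM k1 k3) (EbdM hA k2)) => x; ring.
Qed.

Lemma inE_incr f g : finE g -> finE (fun x => f x - g x) -> finE f.
Proof.
by move=> [A hA] [B hB]; exists (A + B); apply: Ebd_eq (EbdD hA hB) => x; ring.
Qed.

Lemma inE_incr2 f g h (c : R) : finE g -> finE h -> finE (fun x => f x - g x - c * h x) -> finE f.
Proof.
move=> hg [A hA] [B hB]; apply: (inE_incr hg); exists (B + `|c| * A).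
by apply: Ebd_eq (EbdD hB (EbdZ c hA)) => x; ring.
Qed.

Lemma Econt_Aop u t : finE (u t) -> Econt u t -> Econt (fun r => Aop (u r)) t.
Proof.
move=> Eu hu e /hu[d d0 hd]; exists d => // r /hd h.
have Er : finE (u r) by apply: (inE_incr Eu); exists e.
by rewrite -AopB//; exact: Ebd_Aop.
Qed.

Lemma Ederiv_local u w t f : Ederiv u t f ->
  (exists2 d, 0 < d & forall r, `|r - t| < d -> u r = w r) -> Ederiv w t f.
Proof.
move=> hu [d1 d10 h1] e /hu[d d0 hd]; exists (Num.min d1 d); first by rewrite lt_min d10.
move=> r; rewrite lt_min => /andP[/h1 <- /hd]; rewrite -[w t]h1 ?subrr ?normr0//.
Qed.

Lemma EderivD u w t f g : Ederiv u t f -> Ederiv w t g ->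
  Ederiv (fun r x => u r x + w r x) t (fun x => f x + g x).
Proof.
move=> hu hw e e0; have e2 : 0 < e / 2 by rewrite divr_gt0.
have [d1 d10 h1] := hu _ e2; have [d2 d20 h2] := hw _ e2.
exists (Num.min d1 d2); first by rewrite lt_min d10.
move=> r; rewrite lt_min => /andP[/h1 k1 /h2 k2]; rewrite (splitr e) mulrDl.
by apply: Ebd_eq (EbdD k1 k2) => x; ring.
Qed.

Lemma EderivN u t f : Ederiv u t f -> Ederiv (fun r x => - u r x) t (fun x => - f x).
Proof. by move=> hu e /hu[d d0 hd]; exists d => // r /hd/EbdN; apply: Ebd_eq => x; ring. Qed.

Lemma Ederiv_const f t : Ederiv (fun=> f) t (fun=> 0).
Proof.
move=> e e0; exists 1 => // r _; apply: (@Ebd_eq _ (fun=> 0)) => [x|]; first by rewrite subrr mulr0 subrr.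
by apply: Ebd_0; rewrite mulr_ge0// ltW.
Qed.

Lemma Ederiv_Aop u t f : finE (u t) -> finE f -> Ederiv u t f ->
  Ederiv (fun r => Aop (u r)) t (Aop f).
Proof.
move=> Eu Ef hu e /hu[d d0 hd]; exists d => // r /hd h0; have h := Ebd_Aop h0.
have Er : finE (u r) by apply: (inE_incr2 Eu Ef); eexists; exact: h0.
have i1 : finE (fun x => u r x - u t x) by exact: inEB.
have i2 : finE (fun x => (r - t) * f x) by have [A hA] := Ef; exists (`|r - t| * A); exact: EbdZ.
by move: h; rewrite AopB// AopB// AopZ_E.
Qed.

Lemma Ebd_intR A B f g : Ebd A f -> Ebd B g -> `|intR (fun x => f x * g x)| <= A * B.
Proof.
move=> hf hg; apply: cauchy_schwarz.
- exact: Ebd_L2 hf.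
- exact: Ebd_L2 hg.
- exact: Ebd_ge0 hf.
- exact: Ebd_ge0 hg.
- exact: Ebd_nsq hf.
- exact: Ebd_nsq hg.
Qed.

Lemma EderivM u w t f g : finE (u t) -> finE (w t) -> finE f -> finE g ->
  Ederiv u t f -> Ederiv w t g ->
  Ederiv (fun r x => u r x * w r x) t (fun x => f x * w t x + u t x * g x).
Proof.
move=> [A hA] [B hB] Ef [K hK] hu hw e e0.
have A0 := Ebd_ge0 hA; have B0 := Ebd_ge0 hB; have K0 := Ebd_ge0 hK.
have cu := Ederiv_cont hu Ef; have cw := Ederiv_cont hw (ex_intro _ K hK).
pose q := A + (B + 1) + K + 1.
have q0 : 0 < q by rewrite /q ltr_wpDl// !addr_ge0.
have [k kp <-] : exists2 k, 0 < k & k * q = e by exists (e / q); rewrite ?divr_gt0// divfK ?gt_eqF.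
have [L hL] := Ef; have L0 := Ebd_ge0 hL.
have l0 : 0 < L + 1 by rewrite ltr_wpDl.
have [d1 d10 h1] := hu _ kp; have [d2 d20 h2] := hw _ kp.
have [d3 d30 h3] := Econt_bd cw hB.
have [d4 d40 h4] := cw _ (divr_gt0 kp l0).
exists (Num.min d1 (Num.min d2 (Num.min d3 d4))); first by rewrite !lt_min d10 d20 d30 d40.
move=> r; rewrite !lt_min => /and4P[/h1 k1 /h2 k2 /h3 k3 /h4 k4].
(* the increment is (du - f dt) w(r) + f dt (w(r) - w(t)) + u (dw - g dt) *)
apply: (@EbdW (k * `|r - t| * (B + 1) + `|r - t| * (L * (k / (L + 1))) + A * (k * `|r - t|))).
  have le : L * (k / (L + 1)) <= k.
    by rewrite mulrCA ler_piMr ?(ltW kp)// ler_pdivrMr// mul1r lerDl.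
  have := ler_wpM2l (normr_ge0 (r - t)) le.
  have : 0 <= k * `|r - t| * K by rewrite !mulr_ge0// ltW.
  rewrite /q; move: (`|r - t|) (L * _) => x y; lra.
by apply: Ebd_eq (EbdD (EbdD (EbdM k1 k3) (EbdZ (r - t) (EbdM hL k4))) (EbdM hA k2)) => x; ring.
Qed.

Lemma Ederiv_intR u w t f g : finE (u t) -> finE (w t) -> finE f -> finE g ->
  Ederiv u t f -> Ederiv w t g ->
  is_derive t (1:R) (fun r => intR (fun x => u r x * w r x))
    (intR (fun x => f x * w t x) + intR (fun x => u t x * g x)).
Proof.
move=> Eu Ew Ef Eg hu hw; apply: is_derive_of_bound => e e0.
have [A hA] := Eu; have [B hB] := Ew; have [L hL] := Ef; have [K hK] := Eg.
have A0 := Ebd_ge0 hA; have B0 := Ebd_ge0 hB; have K0 := Ebd_ge0 hK; have L0 := Ebd_ge0 hL.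
have cw := Ederiv_cont hw Eg.
pose q := A + (B + 1) + 1; have q0 : 0 < q by rewrite /q ltr_wpDl// !addr_ge0.
have [k kp <-] : exists2 k, 0 < k & k * q = e by exists (e / q); rewrite ?divr_gt0// divfK ?gt_eqF.
have l0 : 0 < L + 1 by rewrite ltr_wpDl.
have [d1 d10 h1] := hu _ kp; have [d2 d20 h2] := hw _ kp.
have [d3 d30 h3] := Econt_bd cw hB.
have [d4 d40 h4] := cw _ (divr_gt0 kp l0).
exists (Num.min d1 (Num.min d2 (Num.min d3 d4))); first by rewrite !lt_min d10 d20 d30 d40.
move=> r; rewrite !lt_min => /and4P[/h1 k1 /h2 k2 /h3 k3 /h4 k4].
have m (a b : R -> R) : finE a -> finE b -> L1 (fun x => a x * b x).
  by move=> /inE_L2 ha /inE_L2 hb; exact: L2_mul.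
set p1 := fun x => u r x - u t x - (r - t) * f x in k1.
set p2 := fun x => w r x - w t x - (r - t) * g x in k2.
set p4 := fun x => w r x - w t x in k4.
have i1 : finE p1 by eexists; exact: k1.
have i2 : finE p2 by eexists; exact: k2.
have i4 : finE p4 by eexists; exact: k4.
have Eur := inE_incr2 Eu Ef i1; have Ewr := inE_incr2 Ew Eg i2.
have -> : intR (fun x => u r x * w r x) - intR (fun x => u t x * w t x) -
    (r - t) * (intR (fun x => f x * w t x) + intR (fun x => u t x * g x)) =
    intR (fun x => p1 x * w r x) + (r - t) * intR (fun x => f x * p4 x) + intR (fun x => u t x * p2 x).
  have m1 := m _ _ Eur Ewr; have m2 := m _ _ Eu Ew.
  have m3 := m _ _ Ef Ew; have m4 := m _ _ Eu Eg.
  rewrite -(intRD m3 m4) -(intRZ _ (L1D m3 m4)) -(intRB m1 m2) -(intRB (L1B m1 m2) (L1Z _ (L1D m3 m4))).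
  have m5 := m _ _ i1 Ewr; have m6 := m _ _ Ef i4; have m7 := m _ _ Eu i2.
  rewrite -(intRZ _ m6) -(intRD m5 (L1Z _ m6)) -(intRD (L1D m5 (L1Z _ m6)) m7).
  by apply: eq_intR => x; rewrite /p1 /p2 /p4; ring.
have b1 := Ebd_intR k1 k3; have b2 := Ebd_intR hL k4; have b3 := Ebd_intR hA k2.
apply: (le_trans (ler_normD _ _)); apply: (le_trans (lerD (ler_normD _ _) (lexx _))).
rewrite [`|(r - t) * _|]normrM.
apply: (le_trans (lerD (lerD b1 (ler_wpM2l (normr_ge0 (r - t)) b2)) b3)).
have le : L * (k / (L + 1)) <= k.
  by rewrite mulrCA ler_piMr ?(ltW kp)// ler_pdivrMr// mul1r lerDl.
have := ler_wpM2l (normr_ge0 (r - t)) le.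
rewrite /q; move: (`|r - t|) (L * _) => x y; lra.
Qed.

End Energy.

(** * Time primitives and the mean value inequality in Sobolev spaces *)

Section Primitive.
Context {R : realType}.
Local Notation mu := (@lebesgue_measure R).
Implicit Types (f g h : R -> R) (u : R -> R -> R) (a b c t r A B M K e : R).

(** Composition with clamp extends to all times a curve known on [a, b]. *)
Definition clamp a b t : R := Num.max a (Num.min b t).

Lemma clamp_in a b t : a <= b -> a <= clamp a b t <= b.
Proof. by move=> ab; rewrite /clamp le_max lexx ge_max ab ge_min lexx. Qed.

Lemma clamp_id a b t : a <= t -> t <= b -> clamp a b t = t.
Proof. by move=> at_ tb; rewrite /clamp (min_idPr tb) (max_idPr at_). Qed.

Lemma clamp_lip a b r t : `|clamp a b r - clamp a b t| <= `|r - t|.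
Proof.
wlog rt : r t / r <= t => [H|].
  have [h|/ltW h] := leP r t; first exact: H.
  by rewrite distrC [leRHS]distrC; exact: H.
have mn : 0 <= Num.min b t - Num.min b r <= t - r.
  by case: (leP b r) => h1; case: (leP b t) => h2; lra.
have mx (p q : R) : p <= q -> 0 <= Num.max a q - Num.max a p <= q - p.
  by move=> pq; case: (leP a p) => h1; case: (leP a q) => h2; lra.
rewrite /clamp distrC [leRHS]distrC (ger0_norm (_ : 0 <= t - r)) ?subr_ge0//.
by have := mx (Num.min b r) (Num.min b t); rewrite ler_norml; lra.
Qed.

Lemma Econt_clamp u a b t : a <= b -> (forall r, a <= r -> r <= b -> Econt u r) ->
  Econt (fun r => u (clamp a b r)) t.
Proof.
move=> ab h e e0; have /andP[h1 h2] := clamp_in t ab.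
have [d d0 hd] := h _ h1 h2 e e0; exists d => // r rd; apply: hd.
exact: le_lt_trans (clamp_lip _ _ _ _) rd.
Qed.

(** The norm of a continuous curve is continuous, hence bounded on segments. *)
Lemma Ebd_segment u a b : a <= b -> (forall r, a <= r -> r <= b -> finE (u r)) ->
  (forall r, a <= r -> r <= b -> Econt u r) ->
  exists K, forall r, a <= r -> r <= b -> Ebd K (u r).
Proof.
move=> ab Eu cu; pose v r := u (clamp a b r).
have Ev r : finE (v r) by have /andP[] := clamp_in r ab; exact: Eu.
have cv r : Econt v r by exact: Econt_clamp.
pose S r := [set M | Ebd M (v r)]; pose N r := inf (S r).
have S0 r : has_inf (S r).
  by split; [exact: Ev|exists 0 => M /Ebd_ge0].
have le r t e : 0 < e -> Ebd e (fun x => v r x - v t x) -> N r <= N t + e.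
  move=> e0 h; apply/ler_addgt0Pr => d d0.
  have [M hM Md] := inf_adherent d0 (S0 t).
  apply: (@le_trans _ _ (M + e)); last by rewrite addrAC lerD2r ltW.
  apply: ge_inf; first by have [] := S0 r.
  by apply: Ebd_eq (EbdD hM h) => x; ring.
have cN : continuous N.
  move=> t; apply/cvgrPdist_le => e e0; have [d d0 hd] := cv t e e0.
  near=> r; have rd : `|r - t| < d by rewrite distrC; near: r; exact: cvgr_dist_lt.
  have h := hd r rd; have h' : Ebd e (fun x => v t x - v r x).
    by apply: Ebd_eq (EbdN h) => x; rewrite opprB.
  by have := le _ _ _ e0 h; have := le _ _ _ e0 h'; rewrite ler_norml; lra.
have [c _ hc] := EVT_max ab (continuous_subspaceT cN).
exists (N c + 1) => r ar rb; have [M hM Md] := inf_adherent ltr01 (S0 r).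
have : Ebd M (v r) by [].
rewrite {1}/v clamp_id//; apply: EbdW; apply: (le_trans (ltW Md)).
by rewrite lerD2r; apply: hc; rewrite in_itv/= ar.
Unshelve. all: by end_near. Qed.

(** The primitive in time that vanishes at c, for t on either side of c. *)
Definition prim c (g_ : R -> R -> R) t (x : R) : R :=
  intR (fun r => box c t r * g_ r x) - intR (fun r => box t c r * g_ r x).

Lemma intR_box_rev a b f : b <= a -> continuous f -> intR (fun r => box a b r * f r) = 0.
Proof.
rewrite le_eqVlt => /predU1P[<-|ba] cf.
  by have /eqP := intR_box_split (lexx b) (lexx b) cf; rewrite -subr_eq subrr eq_sym => /eqP.
rewrite -[RHS](@intR0 R); apply: eq_intR => r; rewrite box0 ?mul0r//.
by apply/negP => /andP[ar rb]; have := le_trans ar rb; rewrite leNgt ba.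
Qed.

Lemma intR_box_near a b f (l e : R) : a <= b -> continuous f ->
  (forall r, a <= r -> r <= b -> `|f r - l| <= e) ->
  `|intR (fun r => box a b r * f r) - (b - a) * l| <= e * (b - a).
Proof.
move=> ab cf h.
have K (k : R) : intR (fun r => box a b r * k) = k * (b - a).
  have d x : is_derive x (1:R) (fun x : R => k * x) k.
    by apply: is_derive_eq; rewrite /GRing.scale/=; ring.
  rewrite (intR_FTC ab d); first by rewrite mulrBr.
  by move=> x; exact: cvg_cst.
have cc (k : R) : continuous (fun _ : R => k) by move=> x; exact: cvg_cst.
rewrite [(b - a) * l]mulrC -!K -intRB; [|exact: L1_box|exact: L1_box].
apply: intR_norm_le => [||r].
- by apply: L1B; exact: L1_box.
- exact: L1_box.
- rewrite -mulrBr normrM (ger0_norm (box_ge0 _ _ _)).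
  have [/andP[ar rb]|n] := boolP ((a <= r) && (r <= b)).
    by rewrite ler_wpM2l ?box_ge0// h.
  by rewrite box0// !mul0r.
Qed.

Section primitive.
Variables (g_ : R -> R -> R) (B c : R).
Hypotheses (gB : forall t, Ebd B (g_ t)) (cg : forall t, Econt g_ t).

Let cgx x : continuous (g_^~ x).
Proof.
move=> t; apply/cvgrPdist_le => e e0; have [d d0 hd] := cg t e0.
near=> r; rewrite distrC; apply: (Ebd_sup x (hd r _)).
by rewrite distrC; near: r; exact: cvgr_dist_lt.
Unshelve. all: by end_near. Qed.

Lemma prim_incr a b x : a <= b ->
  prim c g_ b x - prim c g_ a x = intR (fun r => box a b r * g_ r x).
Proof.
move=> ab; have cf := @cgx x; rewrite /prim.
have rev p q : q <= p -> intR (fun r => box p q r * g_ r x) = 0.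
  by move=> h; exact: intR_box_rev.
have spl p q s : p <= q -> q <= s -> intR (fun r => box p s r * g_ r x) =
    intR (fun r => box p q r * g_ r x) + intR (fun r => box q s r * g_ r x).
  by move=> h1 h2; exact: intR_box_split.
have [ca|/ltW ac] := leP c a.
  by rewrite (rev b c) ?(le_trans ca)// (rev a c)// (spl c a b)//; ring.
have [cb|/ltW bc] := leP c b.
  by rewrite (rev b c)// (rev c a)// (spl a c b)//; ring.
by rewrite (rev c b)// (rev c a)// ?(le_trans ab)// (spl a b c)//; ring.
Qed.

Lemma prim_base x : prim c g_ c x = 0. Proof. by rewrite /prim subrr. Qed.

Lemma continuous_prim t : continuous (prim c g_ t).
Proof.
have B0 := Ebd_ge0 (gB 0).
have cc (k : R) : continuous (fun _ : R => k) by move=> x; exact: cvg_cst.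
have key a b : continuous (fun x => intR (fun r => box a b r * g_ r x)).
  move=> x; apply/(@cvg_nbhsP _ R^o) => y yx.
  have [] // := @intR_dominated R (fun n r => box a b r * g_ r (y n))
    (fun r => box a b r * g_ r x) (fun r => box a b r * B).
  - by move=> n; apply: L1_measurable; exact: L1_box.
  - by apply: L1_measurable; exact: L1_box.
  - apply: aeW => r; apply: cvgMl_tmp; apply: cvg_comp yx _.
    exact: (Ebd_cont (gB r)).
  - exact: L1_box.
  - move=> n r; rewrite normrM (ger0_norm (box_ge0 _ _ _)) ler_wpM2l ?box_ge0//.
    exact: (Ebd_sup _ (gB r)).
by apply: contB; exact: key.
Qed.

Lemma prim_Sderiv t : Sderiv (prim c g_) t (g_ t).
Proof.
move=> e e0; have [d d0 hd] := cg t e0; exists d => // r rd.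
split=> [|x]; first exact: continuous_prim.
have near q : `|q - t| <= `|r - t| -> `|g_ q x - g_ t x| <= e.
  by move=> qr; apply: (Ebd_sup x (hd q _)); exact: le_lt_trans rd.
have [tr|/ltW rt] := leP t r.
  rewrite prim_incr// (ger0_norm (_ : 0 <= r - t)) ?subr_ge0//.
  apply: intR_box_near => // q tq qr; apply: near.
  by rewrite !ger0_norm ?subr_ge0 ?(le_trans tq)// lerB.
rewrite (ler0_norm (_ : r - t <= 0)) ?subr_le0// [- (r - t)]opprB.
have -> : prim c g_ r x - prim c g_ t x - (r - t) * g_ t x =
  - ((prim c g_ t x - prim c g_ r x) - (t - r) * g_ t x) by ring.
rewrite normrN prim_incr//.
apply: intR_box_near => // q rq qt; apply: near.
by rewrite !ler0_norm ?subr_le0 ?(le_trans rq)// !opprB lerB.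
Qed.

Lemma prim_bound t : Ebd (B * `|t - c|) (prim c g_ t).
Proof.
have [ct|/ltW tc] := leP c t.
  rewrite ger0_norm ?subr_ge0//.
  apply: Ebd_eq (@E_mean_value R (prim c g_) g_ c t B ct _ _) => [x|r _ _|r _ _].
  - by rewrite prim_base subr0.
  - exact: prim_Sderiv.
  - exact: gB.
rewrite ler0_norm ?subr_le0// opprB.
apply: Ebd_eq (EbdN (@E_mean_value R (prim c g_) g_ t c B tc _ _)) => [x|r _ _|r _ _].
- by rewrite prim_base sub0r opprK.
- exact: prim_Sderiv.
- exact: gB.
Qed.

Lemma prim_Ederiv t : Ederiv (prim c g_) t (g_ t).
Proof.
apply: Ederiv_of_S => //; exists 1 => // r _; split; last exact: prim_Sderiv.
by exists B.
Qed.

End primitive.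

Lemma primB c (g_ k_ : R -> R -> R) B t (x : R) : (forall t, Ebd B (g_ t)) -> (forall t, Econt g_ t) ->
  (forall t, Ebd B (k_ t)) -> (forall t, Econt k_ t) ->
  prim c g_ t x - prim c k_ t x = prim c (fun r x => g_ r x - k_ r x) t x.
Proof.
move=> gB cg kB ck; have cont (w : R -> R -> R) : (forall t, Econt w t) -> continuous (w^~ x).
  move=> cw q; apply/cvgrPdist_le => e e0; have [d d0 hd] := cw q e e0.
  near=> r; rewrite distrC; apply: (Ebd_sup x (hd r _)).
  by rewrite distrC; near: r; exact: cvgr_dist_lt.
have key a b : intR (fun r => box a b r * (g_ r x - k_ r x)) =
    intR (fun r => box a b r * g_ r x) - intR (fun r => box a b r * k_ r x).
  rewrite -intRB; [|by apply: L1_box; exact: cont|by apply: L1_box; exact: cont].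
  by apply: eq_intR => r; rewrite mulrBr.
by rewrite /prim !key; ring.
Unshelve. all: by end_near. Qed.

(** Mean value inequality in H^s, by duality with the truncations of the
    transform of the increment. *)
Lemma Hs_mean_value s u (v : R -> R -> R) a b B : a <= b -> 0 <= B ->
  (forall t, finE (u t)) -> (forall t, finE (v t)) ->
  (forall t, a <= t -> t <= b -> Ederiv u t (v t)) ->
  (forall t, a <= t -> t <= b -> Hbd s B (v t)) ->
  Hbd s (B * (b - a)) (fun x => u b x - u a x).
Proof.
move=> ab B0 Eu Ev du bv.
have ba0 : 0 <= b - a by rewrite subr_ge0.
have Bba : 0 <= B * (b - a) by exact: mulr_ge0.
have [h hh] : exists h : R -> R -> R, forall t, is_hartley (u t) (h t).
  have ex t := cid (hartley_exists (inE_cont (Eu t)) (inE_L2 (Eu t))); by exists (fun t => projT1 (ex t)) => t; case: (ex t).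
have [k hk] : exists k : R -> R -> R, forall t, is_hartley (v t) (k t).
  have ex t := cid (hartley_exists (inE_cont (Ev t)) (inE_L2 (Ev t))); by exists (fun t => projT1 (ex t)) => t; case: (ex t).
have h2 t : L2 (h t) by case: (hh t).
have k2 t : L2 (k t) by case: (hk t).
pose w z := h b z + -1 * h a z.
have hw : is_hartley (fun x => u b x - u a x) w.
  have := hartleyD (inE_cont (Eu b)) (contZ (c := -1) (inE_cont (Eu a))) (hh b)
    (hartleyZ (-1) (inE_cont (Eu a)) (hh a)).
  by under [X in is_hartley X]eq_fun do rewrite mulN1r.
have w2 : L2 w by case: hw.
exists w; split => //.
have mw : measurable_fun setT (fun z => wt s z * w z).
  by apply: measurable_funM; [exact: measurable_wt|exact: L2_measurable].
have key n : L2 (fun z => box (- n%:R) n%:R z * (wt s z * w z)) /\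
    nsq (fun z => box (- n%:R) n%:R z * (wt s z * w z)) <= (B * (b - a)) ^+ 2.
  have [M1 hM1] := continuous_box_bounded (- n%:R) n%:R (@continuous_wt R s).
  have cw2 : continuous (fun z => wt s z * wt s z) by apply: contM; exact: continuous_wt.
  have [M2 hM2] := continuous_box_bounded (- n%:R) n%:R cw2.
  have b1 : L2 (fun z => box (- n%:R) n%:R z * (wt s z * w z)).
    have : L2 (fun z => (box (- n%:R) n%:R z * wt s z) * w z).
      apply: L2_boundedM hM1 w2; apply: measurable_funM; first exact: box_measurable.
      exact: measurable_wt.
    by under eq_fun do rewrite -mulrA.
  pose g z := (box (- n%:R) n%:R z * (wt s z * wt s z)) * w z.
  have g2 : L2 g.
    apply: L2_boundedM hM2 w2; apply: measurable_funM; first exact: box_measurable.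
    by apply: measurable_funM; exact: measurable_wt.
  split => //; have [|c [ac cb]] := @mean_value R (fun t => intR (fun z => h t z * g z))
      (fun t => intR (fun z => k t z * g z)) a b ab.
    move=> t at_ tb; apply: is_derive_of_bound => e e0.
    pose N := Num.sqrt (nsq g); have N0 : 0 <= N by exact: sqrtr_ge0.
    have N1 : 0 < N + 1 by rewrite ltr_wpDl.
    have [d d0 hd] := du t at_ tb (e / (N + 1)) (divr_gt0 e0 N1).
    exists d => // r /hd H.
    have m1 := L2_mul (h2 r) g2; have m2 := L2_mul (h2 t) g2; have m3 := L2_mul (k2 t) g2.
    rewrite -(intRB m1 m2) -(intRZ (r - t) m3) -(intRB (L1B m1 m2) (L1Z (r - t) m3)).
    pose D z := h r z + -1 * h t z + (- (r - t)) * k t z.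
    have -> : intR (fun z => h r z * g z - h t z * g z - (r - t) * (k t z * g z)) =
      intR (fun z => D z * g z) by apply: eq_intR => z; rewrite /D; ring.
    have cr := inE_cont (Eu r); have ct := inE_cont (Eu t); have cv := inE_cont (Ev t).
    have hD : is_hartley (fun x => u r x + -1 * u t x + (- (r - t)) * v t x) D.
      apply: hartleyD; [by apply: contD => //; exact: contZ|exact: contZ| |exact: hartleyZ].
      by apply: hartleyD => //; [exact: contZ|exact: hartleyZ].
    have [cH _ H2 Hn] := H.
    have E : (fun x => u r x + -1 * u t x + (- (r - t)) * v t x) =
      (fun x => u r x - u t x - (r - t) * v t x) by apply/funext => x; ring.
    rewrite E in hD; have [D2 _] := hD.
    apply: (@le_trans _ _ (e / (N + 1) * `|r - t| * N)).
      apply: cauchy_schwarz => //.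
      - by rewrite mulr_ge0// divr_ge0// ltW.
      - by rewrite (hartley_nsq cH H2 hD).
      - by rewrite sqr_sqrtr ?nsq_ge0.
    rewrite mulrAC ler_wpM2r// -mulrA ler_piMr ?(ltW e0)// mulrC.
    by rewrite ler_pdivrMr// mul1r lerDl.
  have m1 := L2_mul (h2 b) g2; have m2 := L2_mul (h2 a) g2.
  rewrite -(intRB m1 m2).
  have -> : intR (fun z => h b z * g z - h a z * g z) =
      nsq (fun z => box (- n%:R) n%:R z * (wt s z * w z)).
    apply: eq_intR => z; rewrite exprMn box_sq /g /w; ring.
  move=> E; apply: le_of_sqr_le => //; first exact: nsq_ge0.
  rewrite [X in X <= _]E mulrA ler_wpM2r//.
  have [kw kn] := Hbd_any (inE_cont (Ev c)) (hk c) (bv c ac cb).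
  apply: (le_trans (ler_norm _)).
  have -> : intR (fun z => k c z * g z) =
      intR (fun z => (box (- n%:R) n%:R z * (wt s z * w z)) * (wt s z * k c z)).
    by apply: eq_intR => z; rewrite /g; ring.
  by apply: cauchy_schwarz => //; rewrite sqr_sqrtr ?nsq_ge0.
have [] // := @intR_fatou R (fun n z => (box (- n%:R) n%:R z * (wt s z * w z)) ^+ 2)
  (fun z => (wt s z * w z) ^+ 2) ((B * (b - a)) ^+ 2).
- by move=> n; apply: L2_sq; case: (key n).
- by move=> n z; exact: sqr_ge0.
- exact: measurable_funX.
- by move=> z; exact: sqr_ge0.
- apply: (aeS _ (box_cvg_ae (fun z => wt s z * w z))) => x hx.
  by rewrite expr2; under eq_fun do rewrite expr2; exact: cvgM.
- by move=> n; case: (key n).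
Qed.

Lemma geometric_small (C e : R) : 0 < e -> exists n, C / 2 ^+ n < e.
Proof.
move=> e0; have c : C / 2 ^+ n @[n --> \oo] --> 0.
  rewrite -[X in _ --> X](mulr0 C); apply: cvgMl_tmp.
  under eq_fun do rewrite -exprVn; apply: cvg_expr.
  by rewrite ger0_norm// invf_lt1// ltr1n.
move/cvgrPdist_lt: c => /(_ e e0)[n _ /(_ n (leqnn n))].
by rewrite sub0r normrN => h; exists n; exact: le_lt_trans (ler_norm _) h.
Qed.

(** The bounds pass to the pointwise limit, by Fatou's lemma for the L2 part. *)
Lemma E_complete (f_ : nat -> R -> R) K C : 0 <= C -> (forall n, Ebd K (f_ n)) ->
  (forall n, Ebd (C / 2 ^+ n) (fun x => f_ n.+1 x - f_ n x)) ->
  exists f, Ebd K f /\ forall n, Ebd (2 * C / 2 ^+ n) (fun x => f_ n x - f x).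
Proof.
move=> C0 hK hC.
have incr n m : Ebd (2 * C / 2 ^+ n) (fun x => f_ n x - f_ (n + m)%N x).
  suff : Ebd (2 * C / 2 ^+ n - 2 * C / 2 ^+ (n + m)) (fun x => f_ n x - f_ (n + m)%N x).
    by apply: EbdW; rewrite gerBl divr_ge0 ?mulr_ge0// exprn_ge0.
  elim: m => [|m IH].
    rewrite addn0 subrr; apply: (@Ebd_eq _ _ (fun=> 0)) => [x|]; first by rewrite subrr.
    exact: Ebd_0.
  have -> : 2 * C / 2 ^+ n - 2 * C / 2 ^+ (n + m.+1) =
      (2 * C / 2 ^+ n - 2 * C / 2 ^+ (n + m)) + C / 2 ^+ (n + m) :> R.
    rewrite addnS exprS invfM; set z := (2 ^+ (n + m))^-1; by field.
  by apply: Ebd_eq (EbdD IH (EbdN (hC (n + m)%N))) => x; rewrite addnS; ring.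
pose f x := limn (fun n => f_ n x).
have cf x : f_ n x @[n --> \oo] --> f x.
  apply: (@absolutely_cvg_telescope R (fun n => f_ n x) (2 * C)) => k.
  suff h : \sum_(i < k) `|f_ i.+1 x - f_ i x| <= 2 * C - 2 * C / 2 ^+ k.
    by apply: (le_trans h); rewrite gerBl divr_ge0 ?mulr_ge0// exprn_ge0.
  elim: k => [|k IH]; first by rewrite big_ord0 expr0 divr1 subrr.
  rewrite big_ord_recr/=; apply: (le_trans (lerD IH (Ebd_sup x (hC k)))).
  rewrite exprS invfM le_eqVlt; apply/orP; left; apply/eqP.
  set z := (2 ^+ k)^-1; by field.
have sup n x : `|f_ n x - f x| <= 2 * C / 2 ^+ n.
  have c : `|f_ n x - f_ (n + m)%N x| @[m --> \oo] --> `|f_ n x - f x|.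
    apply: cvg_norm; apply: cvgB; first exact: cvg_cst.
    have := cf x; rewrite -(cvg_shiftn n); under eq_fun do rewrite addnC; exact.
  apply: (cvgr_to_le c); apply: nearW => m; exact: (Ebd_sup x (incr n m)).
have small e : 0 < e -> exists n, 2 * C / 2 ^+ n < e by exact: geometric_small.
have contf : continuous f.
  move=> x; apply/cvgrPdist_le => e e0.
  have e4 : 0 < e / 4 by rewrite divr_gt0.
  have [n hn] := small _ e4.
  have /cvgrPdist_le /(_ _ e4) cfn : f_ n y @[y --> x] --> f_ n x by exact: (Ebd_cont (hK n)).
  near=> y.
  have h1 : `|f_ n x - f_ n y| <= e / 4.
    near: y; exact: cfn.
  have h2 := sup n x; have h3 := sup n y.
  have -> : f x - f y = - (f_ n x - f x) + (f_ n x - f_ n y) + (f_ n y - f y) by ring.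
  apply: (le_trans (ler_normD _ _)); apply: (le_trans (lerD (ler_normD _ _) (lexx _))).
  by rewrite normrN; move: hn h1 h2 h3; lra.
have mf := continuous_measurable contf.
have sub n : L2 f /\ nsq (fun x => f_ n x - f x) <= (2 * C / 2 ^+ n) ^+ 2.
  apply: (@L2_sub_fatou R (fun m => f_ (n + m)%N)) => //.
  - by move=> m; exact: (Ebd_L2 (hK _)).
  - exact: (Ebd_L2 (hK _)).
  - apply: aeW => x; have := cf x; rewrite -(cvg_shiftn n).
    by under eq_fun do rewrite addnC; exact.
  - by move=> m; exact: (Ebd_nsq (incr n m)).
have f2 : L2 f by case: (sub 0%N).
have h n : Ebd (2 * C / 2 ^+ n) (fun x => f_ n x - f x).
  split => //; [by apply: contB => //; exact: (Ebd_cont (hK n))| |by case: (sub n)].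
  by apply: L2B => //; exact: (Ebd_L2 (hK n)).
exists f; split => //.
have K0 := Ebd_ge0 (hK 0%N).
have lim e : 0 < e -> Ebd (K + e) f.
  move=> e0; have [n hn] := small e e0; apply: (@EbdW _ (K + 2 * C / 2 ^+ n)).
    by rewrite lerD2l ltW.
  by apply: Ebd_eq (EbdB (hK n) (h n)) => x; ring.
split => // [x|].
  by apply/ler_addgt0Pr => e e0; exact: (Ebd_sup x (lim e e0)).
have -> : K ^+ 2 = (Num.sqrt (K ^+ 2)) ^+ 2 by rewrite sqr_sqrtr ?sqr_ge0.
rewrite sqr_sqrtr ?sqr_ge0//; have n0 := nsq_ge0 f.
rewrite -(sqr_sqrtr n0) lerXn2r ?nnegrE ?sqrtr_ge0//.
apply/ler_addgt0Pr => e e0; have Ke : 0 <= K + e by rewrite addr_ge0// ltW.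
by rewrite -[leRHS](ger0_norm Ke) -sqrtr_sqr ler_wsqrtr// (Ebd_nsq (lim e e0)).
Unshelve. all: by end_near. Qed.

End Primitive.

(** * Smooth bumps, and the equations tested against them *)

Section Bump.
Context {R : realType}.
Implicit Types (f g h : R -> R) (x y : R).

Fixpoint Cn n f : Prop :=
  if n is m.+1 then exists g, (forall x, is_derive x (1:R) f (g x)) /\ Cn m g else True.

Lemma CnS n f : Cn n.+1 f -> Cn n f.
Proof. by elim: n f => [//|n IH] f [g [d /IH h]]; exists g. Qed.

Lemma CnD n f g : Cn n f -> Cn n g -> Cn n (fun x => f x + g x).
Proof.
elim: n f g => [//|n IH] f g [f' [df hf]] [g' [dg hg]].
by exists (fun x => f' x + g' x); split; [move=> x; exact: is_deriveD|exact: IH].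
Qed.

Lemma CnM n f g : Cn n f -> Cn n g -> Cn n (fun x => f x * g x).
Proof.
elim: n f g => [//|n IH] f g hf hg; have [f' [df hf']] := hf; have [g' [dg hg']] := hg.
exists (fun x => f' x * g x + f x * g' x); split.
  move=> x; have d1 := df x; have d2 := dg x.
  by apply: is_derive_eq; rewrite /GRing.scale/=; ring.
by apply: CnD; apply: IH => //; exact: CnS.
Qed.

Lemma Cn_cst n (c : R) : Cn n (fun=> c).
Proof.
elim: n c => [//|n IH] c; exists (fun=> 0); split => // x; exact: is_derive_cst.
Qed.

Lemma CnZ n (c : R) f : Cn n f -> Cn n (fun x => c * f x).
Proof. by move=> hf; exact: (CnM (Cn_cst n c) hf). Qed.

Lemma affine_derive (a b : R) f (l : R) x : is_derive (a * x + b) (1:R) f l ->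
  is_derive x (1:R) (fun x => f (a * x + b)) (a * l).
Proof.
move=> d1; have d2 : is_derive x (1:R) (fun x : R => a * x + b) a.
  by apply: is_derive_eq; rewrite /GRing.scale/=; ring.
apply: (is_derive_eq (@is_derive1_comp _ f (fun x : R => a * x + b) x _ _ d1 d2)).
by rewrite /GRing.scale/=; ring.
Qed.

Lemma Cn_affine n (a b : R) f : Cn n f -> Cn n (fun x => f (a * x + b)).
Proof.
elim: n f => [//|n IH] f [g [df hg]].
exists (fun x => a * g (a * x + b)); split; first by move=> x; exact: affine_derive.
by apply: CnZ; exact: IH.
Qed.

Lemma derive1E_fun f g : (forall x, is_derive x (1:R) f (g x)) -> (f^`())%classic = g.
Proof. by move=> d; apply/funext => x; rewrite derive1E; have [] := d x. Qed.

Lemma Cn_derivable n f x : Cn n.+1 f -> derivable (derive1n n f) x 1.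
Proof.
elim: n f => [|n IH] f [g [df hg]]; first by have [] := df x.
have -> : derive1n n.+1 f = derive1n n g by rewrite /derive1n iterSr (derive1E_fun df).
exact: IH.
Qed.

Lemma is_derive_local f g x (l : R) : is_derive x (1:R) f l ->
  (exists2 d, 0 < d & forall r, `|r - x| < d -> f r = g r) -> is_derive x (1:R) g l.
Proof.
move=> h [d d0 hd]; apply: (near_eq_is_derive _ h).
near=> r; apply: hd; rewrite distrC; near: r; exact: cvgr_dist_lt.
Unshelve. all: by end_near. Qed.

(** The functions x^-k exp (-1/x) of x > 0, a family closed under differentiation. *)
Definition flat k x : R := if x <= 0 then 0 else x^-1 ^+ k * expR (- x^-1).

Lemma flat_le0 k x : x <= 0 -> flat k x = 0. Proof. by rewrite /flat => ->. Qed.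

Lemma flat_ge0 k x : 0 <= flat k x.
Proof.
rewrite /flat; case: (leP x 0) => // x0.
by rewrite mulr_ge0 ?expR_ge0// exprn_ge0// invr_ge0 ltW.
Qed.

Lemma flat_le k x : flat k x <= k.+2%:R ^+ k.+2 * x ^+ 2.
Proof.
rewrite /flat; case: (leP x 0) => x0; first by rewrite mulr_ge0 ?sqr_ge0// exprn_ge0.
set u := x^-1; have u0 : 0 < u by rewrite invr_gt0.
pose m : R := k.+2%:R; have m0 : 0 < m by rewrite ltr0n.
have le : (u / m) ^+ k.+2 <= expR u.
  have -> : expR u = expR (u / m) ^+ k.+2 by rewrite -expRM_natl -/m mulrC divfK ?gt_eqF.
  rewrite lerXn2r ?nnegrE ?expR_ge0 ?divr_ge0 ?ltW//.
  by apply: le_lt_trans (expR_gt1Dx _); rewrite ?lerDr// gt_eqF// divr_gt0.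
rewrite expRN -ler_pdivlMr ?invr_gt0 ?expR_gt0// invrK.
apply: le_trans (_ : m ^+ k.+2 * x ^+ 2 * (u / m) ^+ k.+2 <= _); last first.
  by rewrite ler_wpM2l// mulr_ge0 ?sqr_ge0// exprn_ge0// ltW.
have xu : x * u = 1 by rewrite mulfV ?gt_eqF.
have -> : m ^+ k.+2 * x ^+ 2 * (u / m) ^+ k.+2 = (m * m^-1) ^+ k.+2 * (x * u) ^+ 2 * u ^+ k.
  by rewrite !exprMn -[in u ^+ k.+2]addn2 exprD; ring.
by rewrite xu mulfV ?gt_eqF// !expr1n !mul1r.
Qed.

Lemma flat_derive k x : is_derive x (1:R) (flat k) (- k%:R * flat k.+1 x + flat k.+2 x).
Proof.
have [x0|x0|->] := ltgtP x 0.
- rewrite !flat_le0 ?ltW// mulr0 addr0.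
  have d0 : is_derive x (1:R) (fun=> 0 : R) 0 by exact: is_derive_cst.
  apply: (is_derive_local d0).
  exists (- x); rewrite ?oppr_gt0// => r; rewrite ltr_norml => /andP[_ h].
  by rewrite flat_le0//; lra.
- apply: (@is_derive_local (fun x => x^-1 ^+ k * expR (- x^-1))); last first.
    exists x => // r; rewrite ltr_norml => /andP[h _].
    by rewrite /flat leNgt (_ : 0 < r)//; lra.
  have xn : x != 0 by rewrite gt_eqF.
  have d1 : is_derive x (1:R) (fun y : R => y^-1) (- (x^-1 ^+ 2)).
    apply: (is_derive_eq (@is_deriveV R id x 1 1 xn (is_derive_id x 1))).
    by rewrite /GRing.scale/= mulr1 exprVn.
  have d2 : is_derive x (1:R) (fun y : R => y^-1 ^+ k) (k%:R * x^-1 ^+ k.-1 * - (x^-1 ^+ 2)).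
    have -> : (fun y : R => y^-1 ^+ k) = (fun y : R => y^-1) ^+ k by rewrite exprfctE.
    apply: (is_derive_eq (is_deriveX k d1)).
    by rewrite /GRing.scale/= -mulr_natl.
  have d3 : is_derive x (1:R) (fun y : R => expR (- y^-1)) (x^-1 ^+ 2 * expR (- x^-1)).
    apply: (is_derive_eq (@is_derive1_comp _ (@expR R) (fun y : R => - y^-1) x _ _ (is_derive_expR _) (is_deriveN d1))).
    by rewrite /GRing.scale/=; ring.
  apply: is_derive_eq; rewrite /GRing.scale/= /flat leNgt x0/=.
  by case: k d2 => [|k] _; rewrite /= ?mul0r ?mulr0 !exprS; ring.
- rewrite !flat_le0// mulr0 addr0.
  apply: is_derive_of_bound => e e0; pose m : R := k.+2%:R ^+ k.+2.
  have m0 : 0 < m by rewrite exprn_gt0 ?ltr0n.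
  exists (e / m); first by rewrite divr_gt0.
  move=> r; rewrite subr0 mulr0 (flat_le0 _ (lexx 0)) !subr0 => h; rewrite (ger0_norm (flat_ge0 k r)).
  apply: (le_trans (flat_le k r)); rewrite -/m -real_normK ?num_real// expr2 mulrA.
  by rewrite ler_wpM2r// mulrC -ler_pdivlMr// ltW.
Qed.

Lemma Cn_flat n k : Cn n (flat k).
Proof.
elim: n k => [//|n IH] k; exists (fun x => - k%:R * flat k.+1 x + flat k.+2 x); split.
  exact: flat_derive.
by apply: CnD => //; exact: CnZ.
Qed.

(** A bump supported in [-1, 1], together with its derivatives. *)
Definition bumps i j x : R := flat i (-1 * x + 1) * flat j (1 * x + 1).

Lemma bumps_supp i j x : 1 <= `|x| -> bumps i j x = 0.
Proof.
rewrite /bumps ler_normr => /orP[h|h]; last by rewrite (@flat_le0 j) ?mulr0//; lra.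
by rewrite (@flat_le0 i) ?mul0r//; lra.
Qed.

Lemma Cn_bumps n i j : Cn n (bumps i j).
Proof. by apply: CnM; apply: Cn_affine; exact: Cn_flat. Qed.

Lemma bumps_bounded i j : exists K, forall x, `|bumps i j x| <= K.
Proof.
have c : continuous (bumps i j).
  have [g [dg _]] : Cn 1 (bumps i j) by exact: Cn_bumps.
  exact: (derive_continuous dg).
have [K hK] := continuous_box_bounded (-1) 1 c; exists K => x.
have := hK x; have [/andP[h1 h2]|h] := boolP ((-1 <= x) && (x <= 1)).
  by rewrite box1// mul1r.
rewrite box0// mul0r bumps_supp//.
by move: h; rewrite negb_and -!ltNge ler_normr => /orP[]h; apply/orP; [right|left]; lra.
Qed.

Definition bump x : R := bumps 0 0 x.

Lemma bump_derive x : is_derive x (1:R) bump (bumps 0 2 x - bumps 2 0 x).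
Proof.
have d1 := affine_derive (@flat_derive 0 (-1 * x + 1)).
have d2 := affine_derive (@flat_derive 0 (1 * x + 1)).
by rewrite /bump /bumps; apply: is_derive_eq; rewrite /GRing.scale/=; ring.
Qed.

Lemma bump_ge0 x : 0 <= bump x. Proof. by rewrite mulr_ge0// flat_ge0. Qed.

Lemma bump_lower : exists2 b : R, 0 < b & forall x, `|x| <= 2^-1 -> b <= bump x.
Proof.
exists (expR (- 2) * expR (- 2)) => [|x]; first by rewrite mulr_gt0 ?expR_gt0.
rewrite ler_norml => /andP[h1 h2].
have fl y : 2^-1 <= y -> expR (- 2) <= flat 0 y.
  move=> hy; have y0 : 0 < y by lra.
  rewrite /flat (leNgt y) y0/= expr0 mul1r ler_expR lerN2 -[leRHS]invrK lef_pV2 ?posrE//.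
by rewrite /bump /bumps ler_pM ?expR_ge0// fl//; lra.
Qed.

Lemma derive_supp (f g : R -> R) M : (forall x, is_derive x (1:R) f (g x)) ->
  (forall x, M < `|x| -> f x = 0) -> forall x, M < `|x| -> g x = 0.
Proof.
move=> df f0 x Mx; have d0 : is_derive x (1:R) f 0.
  have dc : is_derive x (1:R) (fun=> 0 : R) 0 by exact: is_derive_cst.
  apply: (is_derive_local dc); exists (`|x| - M); rewrite ?subr_gt0// => r hr.
  rewrite f0//; have := ler_normB x (x - r); rewrite opprB addrCA subrr addr0 [`|x - r|]distrC.
  by have := lerB_dist x (x - r); rewrite opprB addrCA subrr addr0 [`|x - r|]distrC; lra.
by have [_ <-] := df x; have [_ ->] := d0.
Qed.

Lemma test_functionE (phi : R -> R) : test_function phi -> exists p1 p2 M,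
  [/\ forall x, is_derive x (1:R) phi (p1 x), forall x, is_derive x (1:R) p1 (p2 x),
      continuous p2, derive1 phi = p1 /\ derive1n 2 phi = p2 &
      forall x, M < `|x| -> [/\ phi x = 0, p1 x = 0 & p2 x = 0]].
Proof.
move=> [d [M hM]]; have D n x : is_derive x (1:R) (derive1n n phi) (derive1n n.+1 phi x).
  by rewrite derive1nS derive1E; apply: DeriveDef => //; exact: d.
exists (derive1n 1 phi), (derive1n 2 phi), M; split.
- exact: (D 0%N).
- exact: (D 1%N).
- exact: (derive_continuous (D 2%N)).
- by [].
- move=> x Mx; have h1 := derive_supp (D 0%N) hM.
  by split; [exact: hM|exact: h1|exact: (derive_supp (D 1%N) h1)].
Qed.

Lemma L1_supp (f : R -> R) M : continuous f -> (forall x, M < `|x| -> f x = 0) -> L1 f.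
Proof.
move=> cf f0; apply: L1_eq (L1_box (- M) M cf) => x.
have [/andP[h1 h2]|h] := boolP ((- M <= x) && (x <= M)); first by rewrite box1// mul1r.
rewrite box0// mul0r f0//; move: h; rewrite negb_and -!ltNge ltr_normr ltrNr orbC.
by case/orP => ->; rewrite ?orbT.
Qed.

(** A f solves z - z'' = - f'. The integrand of the difference is the derivative of
    A f * phi' + G f * phi. *)
Lemma Aop_test (f phi : R -> R) : finE f -> test_function phi ->
  intR (fun x => f x * derive1 phi x) =
  intR (fun x => Aop f x * (phi x - derive1n 2 phi x)).
Proof.
move=> [K hf] /test_functionE[p1 [p2 [M [d1 d2 c2 [-> ->] supp]]]].
have [cf fK _ _] := hf; have cA := Ebd_cont (Ebd_Aop hf); have cG := Ebd_cont (Ebd_Gop hf).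
have c0 := derive_continuous d1; have c1 := derive_continuous d2.
have h1 : L1 (fun x => f x * p1 x).
  by apply: (@L1_supp _ M) => [|x /supp[_ -> _]]; [exact: contM|rewrite mulr0].
have h2 : L1 (fun x => Aop f x * (phi x - p2 x)).
  apply: (@L1_supp _ M) => [|x /supp[-> _ ->]]; last by rewrite subrr mulr0.
  by apply: contM => //; exact: contB.
apply/eqP; rewrite -subr_eq0 -intRB//; apply/eqP.
apply: (@intR_derive0 R (fun x => Aop f x * p1 x + Gop f x * phi x)).
- move=> x; have a1 := Aop_derive cf fK x; have a2 := Gop_derive cf fK x.
  have a3 := d1 x; have a4 := d2 x.
  by apply: is_derive_eq; rewrite /GRing.scale/=; ring.
- by apply: contB; apply: contM => //; exact: contB.
- apply: (@L1_supp _ M) => [|x /supp[-> -> _]]; last by rewrite !mulr0 addr0.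
  by apply: contD; exact: contM.
- exact: L1B.
Qed.

Lemma Ebd_abs A (f : R -> R) : Ebd A f -> Ebd A (fun x => `|f x|).
Proof.
move=> [cf fA f2 fn]; split.
- by move=> x; apply: continuous_comp; [exact: cf|exact: norm_continuous].
- by move=> x; rewrite normr_id.
- exact: L2_abs.
- by rewrite nsq_abs.
Qed.

(** A function w whose pairings with phi - phi'' are dominated by those of functions
    bounded by e is itself bounded by e: take for phi the product of G rho, which
    solves phi - phi'' = rho, with a cutoff at a large distance N, where rho is a
    bump at a point at which w > e.  The error terms are of order 1/N. *)
Lemma resolvent_dual (w : R -> R) e : finE w -> 0 <= e ->
  (forall phi, test_function phi -> exists2 Y, Ebd e Y &
    intR (fun x => w x * (phi x - derive1n 2 phi x)) <=
    intR (fun x => Y x * (phi x - derive1n 2 phi x))) ->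
  forall x, w x <= e.
Proof.
move=> [A hw] e0 H x0; rewrite leNgt; apply/negP => we.
pose k := (w x0 - e) / 2; have k0 : 0 < k by rewrite divr_gt0// subr_gt0.
have [d d0 hd] : exists2 d, 0 < d & forall x, `|x - x0| < d -> e + k <= w x.
  have : w x @[x --> x0] --> w x0 by exact: (Ebd_cont hw).
  move=> /cvgrPdist_lt/(_ k k0); rewrite -nbhs_ballE => -[d /= d0 hd]; exists d => // x xd.
  have := hd x; rewrite /ball/= distrC => /(_ xd); rewrite ltr_norml => /andP[_].
  rewrite /k; lra.
have [b b0 hb] := bump_lower.
pose rho x := bump (d^-1 * x + - (d^-1 * x0)).
have rhoE x : rho x = bump ((x - x0) / d) by rewrite /rho; congr bump; ring.
have rho0 x : 0 <= rho x by exact: bump_ge0.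
have rho_supp x : d <= `|x - x0| -> rho x = 0.
  move=> h; rewrite rhoE; apply: bumps_supp.
  by rewrite normrM normfV (gtr0_norm d0) ler_pdivlMr// mul1r.
have Crho n : Cn n rho by apply: Cn_affine; exact: Cn_bumps.
have crho : continuous rho by have [g [dg _]] := Crho 1%N; exact: (derive_continuous dg).
pose M := `|x0| + d.
have rho_far x : M < `|x| -> rho x = 0.
  move=> h; apply: rho_supp; have := lerB_dist x x0; rewrite /M in h; lra.
have [B hrho] : exists B, Ebd B rho.
  have [B1 hB1] := bumps_bounded 0 0; pose B2 := Num.sqrt (nsq rho).
  have B10 : 0 <= B1 by exact: (le_trans (normr_ge0 _) (hB1 0)).
  have r2 : L2 rho.
    split; first exact: continuous_measurable.
    by apply: (@L1_supp _ M) => [|x /rho_far ->]; [exact: contX|rewrite expr0n].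
  exists (B1 + B2); split => //.
    by move=> x; apply: (le_trans (hB1 _)); rewrite lerDl sqrtr_ge0.
  rewrite -(sqr_sqrtr (nsq_ge0 rho)) lerXn2r ?nnegrE ?addr_ge0 ?sqrtr_ge0//.
  by rewrite lerDr.
have [rc rB _ _] := hrho.
have hA := Ebd_Aop hrho; have hG := Ebd_Gop hrho.
pose q x := `|Gop rho x| + 2 * `|Aop rho x|.
have hq : Ebd (B + `|2| * B) q by exact: (EbdD (Ebd_abs hG) (EbdZ 2 (Ebd_abs hA))).
pose Q := B + `|2| * B; have Q0 : 0 <= Q := Ebd_ge0 hq.
have [K1 hK1] := bumps_bounded 0 2; have [K2 hK2] := bumps_bounded 2 0.
have CGA n : Cn n (Gop rho) /\ Cn n (Aop rho).
  elim: n => [//|n [IG IA]]; split.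
    exists (fun x => -1 * Aop rho x); split; last exact: CnZ.
    by move=> x; apply: is_derive_eq (Gop_derive rc rB x) _; rewrite mulN1r.
  exists (fun x => rho x + -1 * Gop rho x); split; last by apply: CnD => //; exact: CnZ.
  by move=> x; apply: is_derive_eq (Aop_derive rc rB x) _; rewrite mulN1r.
pose b1 (x : R) := bumps 0 2 x - bumps 2 0 x.
have [b2 [db1 [b3 [db2 _]]]] : Cn 2 b1.
  have -> : b1 = fun x => bumps 0 2 x + -1 * bumps 2 0 x.
    by apply/funext => x; rewrite mulN1r.
  by apply: CnD; [|apply: CnZ]; exact: Cn_bumps.
have b1s x : 1 < `|x| -> b1 x = 0 by move=> /ltW h; rewrite /b1 !bumps_supp ?subrr.
have b2s := derive_supp db1 b1s.
have [K3 hK3] := continuous_box_bounded (-1) 1 (derive_continuous db2).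
have b2K x : `|b2 x| <= K3.
  have := hK3 x; have [/andP[h1 h2]|h] := boolP ((-1 <= x) && (x <= 1)).
    by rewrite box1// mul1r.
  rewrite box0// mul0r b2s//.
  by move: h; rewrite negb_and -!ltNge ltr_normr => /orP[]h; apply/orP; [right|left]; lra.
pose L := K1 + K2 + K3.
have K10 : 0 <= K1 := le_trans (normr_ge0 _) (hK1 0).
have K20 : 0 <= K2 := le_trans (normr_ge0 _) (hK2 0).
have K30 : 0 <= K3 := le_trans (normr_ge0 _) (b2K 0).
have L0 : 0 <= L by rewrite /L !addr_ge0.
have A0 := Ebd_ge0 hw.
(* N is large enough for the error terms, of size L (A + e) Q / N, to stay below
   k times the integral of cut * rho, which is at least b (b d) *)
pose N := 1 + 2 * M + L * (A + e) * Q / (k * (b * (b * d))).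
have M0 : 0 <= M by rewrite /M addr_ge0// ltW.
have den0 : 0 < k * (b * (b * d)) by exact: mulr_gt0 k0 (mulr_gt0 b0 (mulr_gt0 b0 d0)).
have frac0 : 0 <= L * (A + e) * Q / (k * (b * (b * d))).
  by rewrite divr_ge0 ?(ltW den0)// !mulr_ge0// addr_ge0.
have N1 : 1 <= N by rewrite /N; lra.
have N0 : 0 < N by exact: lt_le_trans N1.
have NM : 2 * M <= N by rewrite /N; lra.
pose cut x := bump (N^-1 * x + 0).
have cut0 x : 0 <= cut x by exact: bump_ge0.
pose r x := 2 * N^-1 * b1 (N^-1 * x + 0) * Aop rho x - N^-1 ^+ 2 * b2 (N^-1 * x + 0) * Gop rho x.
pose phi x := cut x * Gop rho x.
pose phi1 x := N^-1 * b1 (N^-1 * x + 0) * Gop rho x - cut x * Aop rho x.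
have dcut x : is_derive x (1:R) cut (N^-1 * b1 (N^-1 * x + 0)).
  by apply: affine_derive; exact: bump_derive.
have dphi x : is_derive x (1:R) phi (phi1 x).
  have h1 := dcut x; have h2 := Gop_derive rc rB x.
  by apply: is_derive_eq; rewrite /GRing.scale/= /phi1; ring.
have dphi1 x : is_derive x (1:R) phi1 (phi x - (cut x * rho x + r x)).
  have h1 := dcut x; have h2 := Gop_derive rc rB x; have h3 := Aop_derive rc rB x.
  have h4 := affine_derive (db1 (N^-1 * x + 0)).
  by apply: is_derive_eq; rewrite /GRing.scale/= /phi1 /r /phi; ring.
have test : test_function phi.
  split=> [n x|].
    apply: Cn_derivable; apply: CnM; last by case: (CGA n.+1).
    by apply: Cn_affine; exact: Cn_bumps.
  exists N => x Nx; rewrite /phi /cut /bump bumps_supp ?mul0r//.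
  by rewrite addr0 normrM normfV (gtr0_norm N0) mulrC ler_pdivlMr// mul1r ltW.
have [Y hY] := H phi test.
have psiE x : phi x - derive1n 2 phi x = cut x * rho x + r x.
  rewrite derive1nS derive1n1 (derive1E_fun dphi) (derive1E_fun dphi1); ring.
have rq x : `|r x| <= L / N * q x.
  have iN : 0 <= N^-1 by rewrite invr_ge0 ltW.
  have iN1 : N^-1 <= 1 by rewrite invf_le1.
  have hb1 : `|b1 (N^-1 * x + 0)| <= L.
    apply: (le_trans (ler_normB _ _)); rewrite /L.
    by have := hK1 (N^-1 * x + 0); have := hK2 (N^-1 * x + 0); lra.
  have hb2 : `|b2 (N^-1 * x + 0)| <= L by apply: (le_trans (b2K _)); rewrite /L; lra.
  rewrite /r /q; move: (Aop rho x) (Gop rho x) => a g.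
  apply: (le_trans (ler_normB _ _)); rewrite !normrM (ger0_norm (_ : 0 <= 2))// (ger0_norm iN).
  rewrite -expr2.
  move: (`|b1 _|) (`|b2 _|) hb1 hb2 (normr_ge0 (b1 (N^-1 * x + 0))) (normr_ge0 (b2 (N^-1 * x + 0))).
  move: (`|a|) (`|g|) (normr_ge0 a) (normr_ge0 g) N^-1 iN iN1.
  move=> aa gg aa0 gg0 n n0 n1 u v uL vL u0 v0.
  have h1 : 2 * n * u * aa <= 2 * n * L * aa by rewrite ler_wpM2r// ler_wpM2l// mulr_ge0.
  have h2 : n ^+ 2 * v * gg <= n * L * gg.
    by rewrite ler_wpM2r// ler_pM ?sqr_ge0// expr2 ler_piMr.
  by apply: (le_trans (lerD h1 h2)); rewrite le_eqVlt; apply/orP; left; apply/eqP; ring.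
have cphi1 := derive_continuous dphi1; have ccut := derive_continuous dcut.
have cr : continuous r.
  have E : r = fun x => (phi x - derive1n 2 phi x) - cut x * rho x by apply/funext => x; rewrite psiE; ring.
  have [p1 [p2 [M' [t1 t2 t3 [_ t4] _]]]] := test_functionE test.
  rewrite E t4; apply: contB; last exact: contM.
  by apply: contB => //; exact: (derive_continuous t1).
have mr := continuous_measurable cr.
have rL2 : L2 r.
  apply: (sq_L1_of_le mr (L2Z (L / N) (Ebd_L2 hq))) => x.
  by apply: (le_trans (rq x)); exact: ler_norm.
have err (Z : R -> R) C : Ebd C Z -> `|intR (fun x => Z x * r x)| <= L / N * (C * Q).
  move=> hy; have hya := Ebd_abs hy.
  have l1 := L2_mul (Ebd_L2 hya) (Ebd_L2 hq).
  apply: (@le_trans _ _ (intR (fun x => L / N * (`|Z x| * q x)))).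
    apply: intR_norm_le => [||x]; [by apply: L2_mul => //; exact: Ebd_L2 hy|exact: L1Z|].
    by rewrite normrM mulrCA ler_wpM2l.
  rewrite intRZ// ler_wpM2l ?divr_ge0 ?(ltW N0)//.
  by apply: (le_trans (ler_norm _)); exact: Ebd_intR.
have hcr : L2 (fun x => cut x * rho x).
  have [Kc hKc] := bumps_bounded 0 0.
  apply: L2_boundedM (Ebd_L2 hrho); first exact: continuous_measurable.
  by move=> x; exact: hKc.
have split (Z : R -> R) C : Ebd C Z -> intR (fun x => Z x * (phi x - derive1n 2 phi x)) =
    intR (fun x => Z x * (cut x * rho x)) + intR (fun x => Z x * r x).
  move=> hy; rewrite -intRD; [|exact: L2_mul (Ebd_L2 hy) hcr|exact: L2_mul (Ebd_L2 hy) rL2].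
  by apply: eq_intR => x; rewrite psiE mulrDr.
rewrite (split w A hw) (split Y e hY) => main.
have ir : L1 (fun x => cut x * rho x).
  apply: (@L1_supp _ M) => [|x /rho_far ->]; [exact: contM|by rewrite mulr0].
set S := intR (fun x => cut x * rho x).
have lowS : b * (b * d) <= S.
  have -> : b * (b * d) = intR (fun x => box (x0 - d / 2) (x0 + d / 2) x * (b * b)).
    have dd x : is_derive x (1:R) (fun x : R => (b * b) * x) (b * b).
      by apply: is_derive_eq; rewrite /GRing.scale/=; ring.
    rewrite (intR_FTC _ dd); [by field|by lra|by move=> x; exact: cvg_cst].
  apply: intR_le => //; first by apply: L1_box => x; exact: cvg_cst.
  move=> x; have [/andP[h1 h2]|h] := boolP ((x0 - d / 2 <= x) && (x <= x0 + d / 2)); last first.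
    by rewrite box0// mul0r mulr_ge0.
  rewrite box1// mul1r ler_pM ?(ltW b0)//; apply: hb.
    rewrite addr0 normrM normfV (gtr0_norm N0) mulrC ler_pdivrMr//.
    have : `|x - x0| <= d / 2 by rewrite ler_norml; lra.
    by have := lerB_dist x x0; rewrite /M in NM; lra.
  have -> : d^-1 * x + - (d^-1 * x0) = (x - x0) / d by ring.
  rewrite normrM normfV (gtr0_norm d0) ler_pdivrMr// ler_norml; lra.
have lowW : (e + k) * S <= intR (fun x => w x * (cut x * rho x)).
  rewrite -intRZ//; apply: intR_le; [exact: L1Z|exact: L2_mul (Ebd_L2 hw) hcr|move=> x].
  have [xd|xd] := ltP `|x - x0| d; last by rewrite rho_supp// !mulr0.
  by apply: ler_wpM2r; [exact: mulr_ge0|exact: hd].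
have upY : intR (fun x => Y x * (cut x * rho x)) <= e * S.
  rewrite -intRZ//; apply: intR_le; [exact: L2_mul (Ebd_L2 hY) hcr|exact: L1Z|move=> x].
  apply: ler_wpM2r; first exact: mulr_ge0.
  exact: le_trans (ler_norm _) (Ebd_sup x hY).
have e1 := err w A hw; have e2 := err Y e hY.
have fin : k * (b * (b * d)) <= L / N * ((A + e) * Q).
  have : k * (b * (b * d)) <= k * S by rewrite ler_wpM2l// ltW.
  move: e1 e2; rewrite !ler_norml => /andP[e1 _] /andP[_ e2].
  have E1 : (e + k) * S = e * S + k * S by ring.
  have -> : L / N * ((A + e) * Q) = L / N * (A * Q) + L / N * (e * Q) by ring.
  move: lowW upY main e1 e2; rewrite E1.
  move: (intR (fun x => w x * _)) (intR (fun x => w x * r x)) (intR (fun x => Y x * (_ * _)))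
    (intR (fun x => Y x * r x)) (k * S) (e * S) (L / N * (A * Q)) (L / N * (e * Q)) (k * _).
  by move=> p1 p2 p3 p4 p5 p6 p7 p8 p9; lra.
have : L * (A + e) * Q / (k * (b * (b * d))) < N by rewrite /N; lra.
rewrite ltr_pdivrMr// => h; move: fin.
have -> : L / N * ((A + e) * Q) = L * (A + e) * Q / N by ring.
by rewrite ler_pdivlMr// [k * _ * N]mulrC leNgt h.
Qed.

Lemma mean_value_near (F G : R -> R) t r :
  (forall q, `|q - t| <= `|r - t| -> is_derive q (1:R) F (G q)) ->
  exists2 c, `|c - t| <= `|r - t| & F r - F t = G c * (r - t).
Proof.
move=> H; have [tr|/ltW rt] := leP t r.
  have [|c [tc cr E]] := @mean_value R F G t r tr.
    by move=> q tq qr; apply: H; rewrite !ger0_norm ?subr_ge0 ?lerB.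
  by exists c => //; rewrite !ger0_norm ?subr_ge0 ?lerB.
have [|c [rc ct E]] := @mean_value R F G r t rt.
  by move=> q rq qt; apply: H; rewrite !ler0_norm ?subr_le0// !opprB lerB.
exists c; first by rewrite !ler0_norm ?subr_le0// !opprB lerB.
by rewrite -opprB E -mulrN opprB.
Qed.

(** On test functions the mean value theorem compares z r - z t - (r - t) A F(t) with
    (r - t) (A F(c) - A F(t)), which is small in E; resolvent_dual turns this into a
    bound in the supremum norm. *)
Lemma Ederiv_of_weak (z F : R -> R -> R) T : 
  (forall t, 0 < t -> t < T -> [/\ finE (z t), finE (F t) & Econt F t]) ->
  (forall phi t, test_function phi -> 0 < t -> t < T ->
    is_derive t (1:R) (fun r => intR (fun x => z r x * (phi x - derive1n 2 phi x)))
      (intR (fun x => F t x * derive1 phi x))) ->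
  forall t, 0 < t -> t < T -> Ederiv z t (Aop (F t)).
Proof.
move=> H W; have S t : 0 < t -> t < T -> Sderiv z t (Aop (F t)).
  move=> t0 tT e e0; have [zt Ft cF_] := H t t0 tT.
  have [d d0 hd] := Econt_Aop Ft cF_ e0.
  exists (Num.min d (Num.min t (T - t))); first by rewrite !lt_min d0 t0 subr_gt0.
  move=> r; rewrite !lt_min => /and3P[rd rt rT].
  have inT q : `|q - t| <= `|r - t| -> 0 < q /\ q < T.
    move=> qr; have := le_lt_trans qr rt; have := le_lt_trans qr rT.
    by rewrite !ltr_norml; lra.
  have [r0 r1] := inT r (lexx _); have [zr Fr _] := H r r0 r1.
  split; first exact: inE_cont zr.
  pose w x := z r x - z t x - (r - t) * Aop (F t) x.
  have wE : finE w by apply: inEB; [exact: inEB|apply: inEZ; exact: inE_Aop].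
  have key phi : test_function phi -> exists2 Y, Ebd (e * `|r - t|) Y &
      intR (fun x => w x * (phi x - derive1n 2 phi x)) =
      intR (fun x => Y x * (phi x - derive1n 2 phi x)).
    move=> tphi; have [p1 [p2 [M [d1 d2 c2 [e1 e2] supp]]]] := test_functionE tphi.
    pose psi x := phi x - derive1n 2 phi x.
    have Lpsi f : finE f -> L1 (fun x => f x * psi x).
      move=> /inE_cont cf; apply: (@L1_supp _ M) => [|x /supp[h1 _ h3]].
        by rewrite /psi e2; apply: contM => //; apply: contB => //; exact: derive_continuous d1.
      by rewrite /psi e2 h1 h3 subrr mulr0.
    have EA := inE_Aop Ft.
    have [|c ct E] := @mean_value_near (fun q => intR (fun x => z q x * psi x))
        (fun q => intR (fun x => Aop (F q) x * psi x)) t r.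
      move=> q /inT[q0 q1]; have [_ Fq _] := H q q0 q1.
      by rewrite -Aop_test//; exact: W.
    have [c0 c1] := inT c ct; have [_ Fc _] := H c c0 c1.
    have EAc := inE_Aop Fc.
    exists (fun x => (r - t) * (Aop (F c) x - Aop (F t) x)).
      by rewrite mulrC; apply: EbdZ; apply: hd; exact: le_lt_trans rd.
    rewrite /w.
    transitivity (intR (fun x => z r x * psi x) - intR (fun x => z t x * psi x) -
      (r - t) * intR (fun x => Aop (F t) x * psi x)).
      rewrite -intRB; [|exact: Lpsi|exact: Lpsi].
      rewrite -intRZ; last exact: Lpsi.
      rewrite -intRB; [|by apply: L1B; exact: Lpsi|by apply: L1Z; exact: Lpsi].
      by apply: eq_intR => x; rewrite /psi; ring.
    rewrite E mulrC -mulrBr -intRB; [|exact: Lpsi|exact: Lpsi].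
    rewrite -intRZ; last by apply: L1B; exact: Lpsi.
    by apply: eq_intR => x; rewrite /psi; ring.
  have er0 : 0 <= e * `|r - t| by rewrite mulr_ge0// ltW.
  move=> x; rewrite ler_norml; apply/andP; split; last first.
    apply: (@resolvent_dual w) => // phi /key[Y hY E]; exists Y => //.
    by rewrite E.
  rewrite lerNl; apply: (@resolvent_dual (fun x => - w x)) => //.
    by have [K hK] := wE; exists K; exact: EbdN.
  move=> phi tphi; have [Y hY E] := key phi tphi.
  have [p1 [p2 [M [d1 d2 c2 [e1 e2] supp]]]] := test_functionE tphi.
  exists (fun x => - Y x); first exact: EbdN.
  have L f : finE f -> L1 (fun x => f x * (phi x - derive1n 2 phi x)).
    move=> /inE_cont cf; apply: (@L1_supp _ M) => [|x' /supp[h1 _ h3]].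
      by rewrite e2; apply: contM => //; apply: contB => //; exact: derive_continuous d1.
    by rewrite e2 h1 h3 subrr mulr0.
  under eq_intR do rewrite mulNr; under [X in _ <= X]eq_intR do rewrite mulNr.
  by rewrite !intRN ?E//; apply: L => //; exists (e * `|r - t|).
move=> t t0 tT; have [zt Ft cF_] := H t t0 tT.
apply: (@Ederiv_of_S R z (fun r => Aop (F r))); first exact: Econt_Aop.
exists (Num.min t (T - t)); first by rewrite lt_min t0 subr_gt0.
move=> r; rewrite lt_min !ltr_norml => /andP[/andP[r0 _] /andP[_ r1]].
have r0' : 0 < r by lra. have r1' : r < T by lra.
by have [_ Fr _] := H r r0' r1'; split; [exact: inE_Aop|exact: S].
Qed.

End Bump.

(** * A priori bound from a lower bound on eta *)

Section Apriori.
Context {R : realType}.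
Implicit Types (f g h : R -> R) (u eta v : R -> R -> R) (a b t r x A B M K e : R).

Definition ip f g : R := intR (fun x => f x * g x).

Lemma ipC f g : ip f g = ip g f.
Proof. by apply: eq_intR => x; rewrite mulrC. Qed.

Lemma ip_L1 f g : finE f -> finE g -> L1 (fun x => f x * g x).
Proof. by move=> /inE_L2 hf /inE_L2 hg; exact: L2_mul. Qed.

Lemma ipDl f g h : finE f -> finE g -> finE h -> ip (fun x => f x + g x) h = ip f h + ip g h.
Proof.
move=> hf hg hh; rewrite /ip -intRD; [|exact: ip_L1|exact: ip_L1].
by apply: eq_intR => x; rewrite mulrDl.
Qed.

Lemma ipZl c f h : finE f -> finE h -> ip (fun x => c * f x) h = c * ip f h.
Proof.
by move=> hf hh; rewrite /ip -intRZ; [apply: eq_intR => x; rewrite mulrA|exact: ip_L1].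
Qed.

Lemma ip_le f g : finE f -> finE g -> 2 * ip f g <= nsq f + nsq g.
Proof.
move=> /inE_L2 hf /inE_L2 hg.
have h : nsq (fun x => f x + -1 * g x) = nsq f + 2 * intR (fun x => f x * (-1 * g x)) + nsq g.
  rewrite nsqD//; last exact: L2Z.
  by congr (_ + _); rewrite nsqZ// sqrrN expr1n mul1r.
have := nsq_ge0 (fun x => f x + -1 * g x); rewrite h.
have -> : intR (fun x => f x * (-1 * g x)) = -1 * ip f g.
  by rewrite /ip -intRZ; [apply: eq_intR => x; ring|exact: L2_mul].
by move: (nsq f) (nsq g) (ip f g) => p q s; lra.
Qed.

Lemma AopD_E f g : finE f -> finE g -> Aop (fun x => f x + g x) = fun x => Aop f x + Aop g x.
Proof. by move=> [A [cf fA _ _]] [B [cg gB _ _]]; apply/funext => x; rewrite (AopD cf cg fA gB). Qed.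

Lemma GopD_E f g : finE f -> finE g -> Gop (fun x => f x + g x) = fun x => Gop f x + Gop g x.
Proof.
move=> [A [cf fA _ _]] [B [cg gB _ _]]; apply/funext => x.
rewrite /Gop /Rop (LopD x cf cg fA gB).
rewrite (LopD (- x) (continuous_opp cf) (continuous_opp cg) (fun y => fA (- y)) (fun y => gB (- y))).
by field.
Qed.

Lemma GopZ_E c f : finE f -> Gop (fun x => c * f x) = fun x => c * Gop f x.
Proof.
move=> [A [cf fA _ _]]; apply/funext => x.
rewrite /Gop /Rop (LopZ c x cf fA) (LopZ c (- x) (continuous_opp cf) (fun y => fA (- y))).
by field.
Qed.

Lemma GopB_E f g : finE f -> finE g -> Gop (fun x => f x - g x) = fun x => Gop f x - Gop g x.
Proof.
move=> hf hg; have -> : (fun x => f x - g x) = fun x => f x + -1 * g x.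
  by apply/funext => x; rewrite mulN1r.
by rewrite (GopD_E hf (inEZ (-1) hg)) (GopZ_E _ hg); apply/funext => x; rewrite mulN1r.
Qed.

Lemma Ederiv_Gop u t f : finE (u t) -> finE f -> Ederiv u t f ->
  Ederiv (fun r => Gop (u r)) t (Gop f).
Proof.
move=> Eu Ef hu e /hu[d d0 hd]; exists d => // r /hd h0; have h := Ebd_Gop h0.
have Er : finE (u r) by apply: (inE_incr2 Eu Ef); eexists; exact: h0.
have i1 : finE (fun x => u r x - u t x) by exact: inEB.
have i2 := inEZ (r - t) Ef.
by move: h; rewrite GopB_E// GopB_E// GopZ_E.
Qed.

(** The difference of the integrands is the derivative of Af * Gg - Ag * Gf. *)
Lemma Gop_sym f g : finE f -> finE g -> ip f (Gop g) = ip g (Gop f).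
Proof.
move=> Ef Eg; have [A [cf fA _ _]] := Ef; have [B [cg gB _ _]] := Eg.
have hAf := inE_Aop Ef; have hAg := inE_Aop Eg; have hGf := inE_Gop Ef; have hGg := inE_Gop Eg.
apply/eqP; rewrite -subr_eq0 /ip -intRB; [|exact: ip_L1|exact: ip_L1]; apply/eqP.
apply: (@intR_derive0 R (fun x => Aop f x * Gop g x - Aop g x * Gop f x)).
- move=> x; have a1 := Aop_derive cf fA x; have a2 := Gop_derive cf fA x.
  have a3 := Aop_derive cg gB x; have a4 := Gop_derive cg gB x.
  by apply: is_derive_eq; rewrite /GRing.scale/=; ring.
- by apply: contB; apply: contM => //; exact: inE_cont.
- by apply: L1B; exact: ip_L1.
- by apply: L1B; exact: ip_L1.
Qed.

Definition F1 f g : R -> R := fun x => g x + f x * g x.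
Definition F2 f g : R -> R := fun x => f x + 2^-1 * (g x * g x).

Lemma finE_F1 f g : finE f -> finE g -> finE (F1 f g).
Proof. by move=> hf hg; apply: inED => //; exact: inEM. Qed.

Lemma finE_F2 f g : finE f -> finE g -> finE (F2 f g).
Proof. by move=> hf hg; apply: inED => //; apply: inEZ; exact: inEM. Qed.

Lemma Econt_F1 eta v t : finE (eta t) -> finE (v t) -> Econt eta t -> Econt v t ->
  Econt (fun r => F1 (eta r) (v r)) t.
Proof. by move=> h1 h2 c1 c2; apply: EcontD => //; exact: EcontM. Qed.

Lemma Econt_F2 eta v t : finE (eta t) -> finE (v t) -> Econt eta t -> Econt v t ->
  Econt (fun r => F2 (eta r) (v r)) t.
Proof. by move=> h1 h2 c1 c2; apply: EcontD => //; apply: EcontZ; exact: EcontM. Qed.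

(** The equations, solved for the time derivatives. *)
Definition flow a b eta v := forall t, a < t -> t < b ->
  [/\ finE (eta t), finE (v t), Ederiv eta t (Aop (F1 (eta t) (v t))) &
      Ederiv v t (Aop (F2 (eta t) (v t)))].

Lemma Ederiv_S u t f : finE (u t) -> finE f -> Ederiv u t f -> Sderiv u t f.
Proof. by move=> h1 h2; apply: Sderiv_of_E; exact: inE_cont. Qed.

Let balance (p q r s : R) : p + 2^-1 * r = - (q + s) ->
  p + p + (q + q) + (r + s + s) = 0.
Proof. by lra. Qed.

(** The energy is conserved, since A is antisymmetric and the time derivatives
    are A applied to the partial gradients of the energy. *)
Lemma energy_conserved eta v a b t0 t1 : flow a b eta v -> a < t0 -> t0 <= t1 -> t1 < b ->
  ip (eta t1) (eta t1) + ip (v t1) (v t1) + ip (fun x => eta t1 x * v t1 x) (v t1) =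
  ip (eta t0) (eta t0) + ip (v t0) (v t0) + ip (fun x => eta t0 x * v t0 x) (v t0).
Proof.
move=> fl a0 t01 t1b.
pose H t := ip (eta t) (eta t) + ip (v t) (v t) + ip (fun x => eta t x * v t x) (v t).
have [|c [_ _]] := @mean_value R H (fun=> 0) t0 t1 t01; last first.
  by rewrite mul0r => /eqP; rewrite subr_eq0 => /eqP.
move=> t h0 h1; have [E1 E2 D1 D2] := fl t (lt_le_trans a0 h0) (le_lt_trans h1 t1b).
set f := eta t in E1 D1 D2; set g := v t in E2 D1 D2.
have G1 := finE_F1 E1 E2; have G2 := finE_F2 E1 E2.
have A1 := inE_Aop G1; have A2 := inE_Aop G2.
set p := Aop (F1 f g) in D1 A1; set q := Aop (F2 f g) in D2 A2.
have M1 := inEM E1 E2; have M2 := inEM E2 E2.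
have d1 := Ederiv_intR E1 E1 A1 A1 D1 D1.
have d2 := Ederiv_intR E2 E2 A2 A2 D2 D2.
have D3 := EderivM E1 E2 A1 A2 D1 D2.
have M3 : finE (fun x => p x * g x + f x * q x) by apply: inED; exact: inEM.
have d3 := Ederiv_intR M1 E2 M3 A2 D3 D2.
have key : ip (F2 f g) p = - ip (F1 f g) q.
  have [K1 [c1 b1 l1 _]] := G1; have [K2 [c2 b2 l2 _]] := G2.
  exact: (Aop_antisym c2 c1 b2 b1 l2 l1).
apply: (is_derive_eq (is_deriveD (is_deriveD d1 d2) d3)).
have e1 : ip (F2 f g) p = ip f p + 2^-1 * ip (fun x => g x * g x) p.
  by rewrite /F2 ipDl ?ipZl//; exact: inEZ.
have e2 : ip (F1 f g) q = ip g q + ip (fun x => f x * g x) q by rewrite /F1 ipDl.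
have e3 : ip (fun x => p x * g x + f x * q x) g = ip (fun x => g x * g x) p + ip (fun x => f x * g x) q.
  rewrite ipDl; [|exact: inEM|exact: inEM|by []].
  by congr (_ + _); apply: eq_intR => x; ring.
rewrite -[X in _ + _ + (X + _)]/(ip (fun x => p x * g x + f x * q x) g) e3.
rewrite -[intR (fun x => p x * f x)]/(ip p f) -[intR (fun x => f x * p x)]/(ip f p).
rewrite -[intR (fun x => q x * g x)]/(ip q g) -[intR (fun x => g x * q x)]/(ip g q).
rewrite -[intR (fun x => f x * g x * q x)]/(ip (fun x => f x * g x) q).
rewrite (ipC p f) (ipC q g); move: key; rewrite e1 e2.
exact: balance.
Qed.

(** The derivative of (1 + Q) exp (- C (t - t0)) is not positive. *)
Lemma gronwall (Q q : R -> R) C t0 t1 : 0 <= C -> t0 <= t1 ->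
  (forall t, t0 <= t -> t <= t1 -> is_derive t (1:R) Q (q t)) ->
  (forall t, t0 <= t -> t <= t1 -> q t <= C * (1 + Q t)) ->
  1 + Q t1 <= (1 + Q t0) * expR (C * (t1 - t0)).
Proof.
move=> C0 t01 dQ qC; pose F t := (1 + Q t) * expR (- (C * (t - t0))).
have dF t : t0 <= t -> t <= t1 ->
    is_derive t (1:R) F ((q t - C * (1 + Q t)) * expR (- (C * (t - t0)))).
  move=> h0 h1; have d1 := dQ t h0 h1.
  have d2 : is_derive t (1:R) (fun t : R => - (C * (t - t0))) (- C).
    by apply: is_derive_eq; rewrite /GRing.scale/=; ring.
  have d3 : is_derive t (1:R) (fun t : R => expR (- (C * (t - t0)))) (- C * expR (- (C * (t - t0)))).
    by apply: (is_derive_eq (@is_derive1_comp _ (@expR R) (fun t : R => - (C * (t - t0))) t _ _ (is_derive_expR _) d2)); rewrite /GRing.scale/=; ring.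
  by apply: is_derive_eq; rewrite /GRing.scale/=; ring.
have [c [c0 c1 E]] := mean_value t01 dF.
have : F t1 <= F t0.
  rewrite -subr_le0 E mulr_le0_ge0 ?subr_ge0// mulr_le0_ge0 ?expR_ge0// subr_le0.
  exact: qC.
rewrite /F subrr mulr0 oppr0 expR0 mulr1 expRN.
by rewrite ler_pdivrMr ?expR_gt0.
Qed.

Let growth_arith (H0 M p1 p2 p3 ne ny nw m1 m2 nv k2 k4 : R) : 0 <= H0 -> 0 <= M ->
  2 * p1 <= ne + ny -> 2 * p2 <= m1 + ny -> 2 * p3 <= m2 + ny -> m1 <= k4 ->
  m2 <= k2 * nw -> ne <= H0 + M * nv -> M * nv <= M * (2 * k2 + 2 * nw) ->
  0 <= nw -> 0 <= ny -> 0 <= k2 -> 0 <= k4 ->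
  2 * (p1 + 2^-1 * p2 + p3) <= (H0 + 2 * M * k2 + k4 + 2 * M + k2 + 3) * (1 + (nw + ny)).
Proof.
move=> h0 m0 l1 l2 l3 n1 n2 n4 n5 w0 y0 k20 k40.
have h : 0 <= (H0 + 2 * M * k2 + k4) * (nw + ny) by rewrite !(mulr_ge0, addr_ge0).
have h1 : 0 <= M * ny by exact: mulr_ge0.
have h2 : 0 <= k2 * ny by exact: mulr_ge0.
have h3 : 0 <= M * k2 by exact: mulr_ge0.
have -> : (H0 + 2 * M * k2 + k4 + 2 * M + k2 + 3) * (1 + (nw + ny)) =
  (H0 + 2 * M * k2 + k4) * (nw + ny) + (H0 + 2 * (M * k2) + k4 + 2 * M + k2 + 3) +
  2 * (M * nw) + 2 * (M * ny) + k2 * nw + k2 * ny + 3 * nw + 3 * ny by ring.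
have e : M * (2 * k2 + 2 * nw) = 2 * (M * k2) + 2 * (M * nw) by ring.
rewrite e in n5; move: (_ * (nw + ny)) (M * k2) (M * nw) (M * ny) (k2 * nw) (k2 * ny) (M * nv)
  h h1 h2 h3 n2 n4 n5 => z1 z2 z3 z4 z5 z6 z7; lra.
Qed.

(** Growth of the square integral of v.  The H^1 norm Q of w = v - v(t0) = A P is
    controlled because w^2 is orthogonal to the space derivative P - G P of w; the H^1
    norm of v itself need not be finite. *)
Lemma v_growth eta v a b t0 T1 M K H0 : flow a b eta v -> a < t0 -> 0 <= M ->
  (forall t, t0 <= t -> t < b -> nsq (eta t) <= H0 + M * nsq (v t)) -> 0 <= H0 ->
  Ebd K (v t0) -> b - t0 <= T1 ->
  forall t, t0 <= t -> t < b ->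
  nsq (v t) <= 2 * K ^+ 2 + 2 * expR ((H0 + 2 * M * K ^+ 2 + K ^+ 4 + 2 * M + K ^+ 2 + 3) * T1).
Proof.
move=> fl a0 M0 hM H00 hK hT t1 t01 t1b.
have K0 := Ebd_ge0 hK; set C := H0 + _ + _ + _ + _ + _.
have C0 : 0 <= C by rewrite /C !addr_ge0 ?mulr_ge0 ?exprn_ge0.
have inab r : t0 <= r -> r <= t1 -> a < r /\ r < b.
  by move=> h1 h2; split; [exact: lt_le_trans a0 h1|exact: le_lt_trans h2 t1b].
pose g0 r := F2 (eta r) (v r).
have Eg0 r : t0 <= r -> r <= t1 -> finE (g0 r).
  by move=> h1 h2; have [r1 r2] := inab r h1 h2; have [] := fl r r1 r2 => *; exact: finE_F2.
have cg0 r : t0 <= r -> r <= t1 -> Econt g0 r.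
  move=> h1 h2; have [r1 r2] := inab r h1 h2; have [e1 e2 D1 D2] := fl r r1 r2.
  apply: Econt_F2 => //.
    by apply: Ederiv_cont D1 _; apply: inE_Aop; exact: finE_F1.
  by apply: Ederiv_cont D2 _; apply: inE_Aop; exact: finE_F2.
have [B hB] := Ebd_segment t01 Eg0 cg0.
pose g r := g0 (clamp t0 t1 r).
have gB r : Ebd B (g r) by have /andP[] := clamp_in r t01; exact: hB.
have cg r : Econt g r by exact: Econt_clamp.
have Eg r : finE (g r) by exists B.
have gE r : t0 <= r -> r <= t1 -> g r = F2 (eta r) (v r).
  by move=> h1 h2; rewrite /g clamp_id.
pose P := prim t0 g.
have DP r : Ederiv P r (g r) by exact: (prim_Ederiv t0 gB cg r).
have EP r : finE (P r) by eexists; exact: (prim_bound t0 gB cg r).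
have vE r : t0 <= r -> r <= t1 -> v r = fun x => v t0 x + Aop (P r) x.
  move=> h0 h1; pose z q x := v q x - Aop (P q) x.
  have dz q : t0 <= q -> q <= r -> Sderiv z q (fun=> 0).
    move=> q0 q1; have q2 := le_trans q1 h1; have [i1 i2] := inab q q0 q2.
    have [e1 e2 _ D2] := fl q i1 i2; have e3 := inE_Aop (EP q).
    have D3 := Ederiv_Aop (EP q) (Eg q) (DP q).
    apply: Ederiv_S; [exact: inEB|by exists 0; exact: Ebd_0|].
    have := EderivD D2 (EderivN D3); rewrite gE//.
    by under [X in Ederiv _ _ X -> _]eq_fun do rewrite subrr.
  have h := E_mean_value h0 dz (fun _ _ _ => Ebd_0 (lexx 0)).
  apply/funext => x; have := Ebd_sup x h; rewrite mul0r normr_le0 subr_eq0 /z => /eqP.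
  have -> : Aop (P t0) x = 0.
    have : Ebd 0 (P t0) by have := prim_bound t0 gB cg t0; rewrite subrr normr0 mulr0.
    by move=> /Ebd_Aop /(Ebd_sup x); rewrite normr_le0 => /eqP.
  by rewrite subr0 => <-; ring.
pose y r x := P r x - Gop (P r) x.
have Ey r : finE (y r) by apply: inEB => //; exact: inE_Gop.
pose Q r := ip (P r) (y r).
have QE r : Q r = nsq (Aop (P r)) + nsq (y r).
  by have [A [c1 c2 c3 _]] := EP r; exact: (Aop_energy c1 c2 c3).
have dQ r : is_derive r (1:R) Q (2 * ip (g r) (y r)).
  have Dy : Ederiv y r (fun x => g r x - Gop (g r) x).
    by apply: EderivD (DP r) (EderivN (Ederiv_Gop (EP r) (Eg r) (DP r))).
  have Egy : finE (fun x => g r x - Gop (g r) x) by apply: inEB => //; exact: inE_Gop.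
  apply: (is_derive_eq (Ederiv_intR (EP r) (Ey r) (Eg r) Egy (DP r) Dy)).
  have e1 : ip (P r) (fun x => g r x - Gop (g r) x) = ip (P r) (g r) - ip (P r) (Gop (g r)).
    rewrite /ip -intRB; [|exact: ip_L1|by apply: ip_L1 => //; exact: inE_Gop].
    by apply: eq_intR => x; rewrite mulrBr.
  have e2 : ip (g r) (y r) = ip (g r) (P r) - ip (g r) (Gop (P r)).
    rewrite /ip -intRB; [|exact: ip_L1|by apply: ip_L1 => //; exact: inE_Gop].
    by apply: eq_intR => x; rewrite mulrBr.
  rewrite -[X in X + _]/(ip (g r) (y r)) -[X in _ + X]/(ip (P r) (fun x => g r x - Gop (g r) x)).
  rewrite e1 e2 (ipC (P r) (g r)) (Gop_sym (EP r) (Eg r)); ring.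
have qC r : t0 <= r -> r <= t1 -> 2 * ip (g r) (y r) <= C * (1 + Q r).
  move=> h0 h1; have [r1 r2] := inab r h0 h1; have [E1 E2 _ _] := fl r r1 r2.
  have Ev0 : finE (v t0) by exists K.
  pose w := Aop (P r); have Ew : finE w := inE_Aop (EP r).
  have vr := vE r h0 h1.
  have cub : ip (fun x => w x * w x) (y r) = 0.
    have [A [c1 c2 c3 _]] := EP r; rewrite -(Aop_cubic c1 c2 c3).
    by apply: eq_intR => x; rewrite expr2.
  have E00 := inEM Ev0 Ev0; have E0w := inEM Ev0 Ew; have Eww := inEM Ew Ew.
  have -> : ip (g r) (y r) = ip (eta r) (y r) + 2^-1 * ip (fun x => v t0 x * v t0 x) (y r)
      + ip (fun x => v t0 x * w x) (y r).
    have gx : g r = fun x => (eta r x + 2^-1 * (v t0 x * v t0 x)) +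
        (v t0 x * w x + 2^-1 * (w x * w x)).
      by rewrite gE//; apply/funext => x; rewrite /F2 vr -/w; field.
    have i1 := inEZ 2^-1 E00; have i2 := inEZ 2^-1 Eww.
    rewrite gx ipDl//; [|exact: inED|exact: inED].
    by rewrite !ipDl// !ipZl// cub; ring.
  have l1 := ip_le E1 (Ey r); have l2 := ip_le E00 (Ey r); have l3 := ip_le E0w (Ey r).
  have n1 : nsq (fun x => v t0 x * v t0 x) <= K ^+ 4.
    have -> : K ^+ 4 = (K * K) ^+ 2 by ring.
    exact: Ebd_nsq (EbdM hK hK).
  have n2 : nsq (fun x => v t0 x * w x) <= K ^+ 2 * nsq w.
    have lw := inE_L2 Ew; rewrite -nsqZ//; apply: nsq_le; [exact: inE_L2|exact: L2Z|move=> x].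
    by rewrite !normrM (ger0_norm K0) ler_wpM2r// (Ebd_sup x hK).
  have n3 : nsq (v r) <= 2 * K ^+ 2 + 2 * nsq w.
    rewrite vr; apply: (le_trans (nsqD_le (inE_L2 Ev0) (inE_L2 Ew))).
    by rewrite lerD2r ler_wpM2l// (Ebd_nsq hK).
  have n4 := hM r h0 r2.
  have n5 : M * nsq (v r) <= M * (2 * K ^+ 2 + 2 * nsq w) by rewrite ler_wpM2l.
  rewrite QE -/w /C; have w0 := nsq_ge0 w; have y0 := nsq_ge0 (y r).
  have k20 : 0 <= K ^+ 2 by exact: exprn_ge0.
  have k40 : 0 <= K ^+ 4 by exact: exprn_ge0.
  exact: (growth_arith H00 M0 l1 l2 l3 n1 n2 n4 n5 w0 y0 k20 k40).
have gr := gronwall C0 t01 (fun r _ _ => dQ r) qC.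
have Q0 : Q t0 = 0.
  rewrite /Q /ip -[RHS](@intR0 R); apply: eq_intR => x.
  by rewrite /P prim_base mul0r.
rewrite Q0 addr0 mul1r in gr.
have n3 : nsq (v t1) <= 2 * K ^+ 2 + 2 * nsq (Aop (P t1)).
  rewrite (vE t1)//; apply: (le_trans (nsqD_le (Ebd_L2 hK) (inE_L2 (inE_Aop (EP t1))))).
  by rewrite lerD2r ler_wpM2l// (Ebd_nsq hK).
apply: (le_trans n3); rewrite lerD2l ler_wpM2l//.
apply: (@le_trans _ _ (expR (C * (t1 - t0)))).
  apply: le_trans gr; rewrite QE addrCA lerDl.
  by rewrite addr_ge0// nsq_ge0.
by rewrite ler_expR ler_wpM2l//; apply: le_trans hT; rewrite lerD2r ltW.
Qed.

Let half_norm x : `|2^-1 * x| <= `|x|.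
Proof. by rewrite normrM (ger0_norm (_ : 0 <= 2^-1))// ler_piMl// invf_le1// ler1n. Qed.

(** Conservation of the energy and the lower bound on eta bound the square integral of
    eta by that of v, which grows at most exponentially by v_growth. Then A F1 and
    A F2 are bounded, because A maps L1 and L2 to bounded functions, and so are the
    solutions on a bounded time interval. *)
Lemma apriori eta v T t0 M : flow 0 T eta v -> 0 < t0 -> t0 < T ->
  (forall t x, t0 <= t -> t < T -> - M <= eta t x) ->
  exists K, forall t, t0 <= t -> t < T -> Ebd K (eta t) /\ Ebd K (v t).
Proof.
move=> fl t00 t0T lowM; have [[K1 hK1] [K2 hK2] _ _] := fl t0 t00 t0T.
pose K := K1 + K2; have K10 := Ebd_ge0 hK1; have K20 := Ebd_ge0 hK2.
have he : Ebd K (eta t0) by apply: EbdW hK1; rewrite /K; lra.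
have hv : Ebd K (v t0) by apply: EbdW hK2; rewrite /K; lra.
pose M' := `|M|; have M'0 : 0 <= M' by exact: normr_ge0.
pose H0 := `|ip (eta t0) (eta t0) + ip (v t0) (v t0) + ip (fun x => eta t0 x * v t0 x) (v t0)|.
have H00 : 0 <= H0 by exact: normr_ge0.
have bd_eta t : t0 <= t -> t < T -> nsq (eta t) <= H0 + M' * nsq (v t).
  move=> h0 h1; have := energy_conserved fl t00 h0 h1.
  have [E1 E2 _ _] := fl t (lt_le_trans t00 h0) h1.
  have sq f : ip f f = nsq f by apply: eq_intR => x; rewrite expr2.
  have : - M' * nsq (v t) <= ip (fun x => eta t x * v t x) (v t).
    rewrite /nsq -intRZ; last exact: L2_sq (inE_L2 E2).
    apply: intR_le; [by apply: L1Z; exact: L2_sq (inE_L2 E2)|by apply: ip_L1 => //; exact: inEM|].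
    move=> x; rewrite -mulrA -expr2 ler_wpM2r ?sqr_ge0//.
    by apply: le_trans (lowM t x h0 h1); rewrite lerN2 ler_norm.
  have := nsq_ge0 (v t); rewrite !sq => nv lo E.
  have : nsq (eta t) + nsq (v t) + ip (fun x => eta t x * v t x) (v t) <= H0.
    by rewrite E /H0 !sq ler_norm.
  lra.
have gv := v_growth fl t00 M'0 bd_eta H00 hv (lexx (T - t0)).
set V := 2 * K ^+ 2 + _ in gv.
have V0 : 0 <= V by rewrite /V addr_ge0// mulr_ge0 ?sqr_ge0 ?expR_ge0.
pose N := H0 + M' * V; have N0 : 0 <= N by rewrite addr_ge0// mulr_ge0.
have ge t : t0 <= t -> t < T -> nsq (eta t) <= N.
  by move=> h0 h1; apply: (le_trans (bd_eta t h0 h1)); rewrite lerD2l ler_wpM2l// gv.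
pose D := 3 * Num.sqrt V + 3 * Num.sqrt N + N + V.
have sV := sqrtr_ge0 V; have sN := sqrtr_ge0 N.
have D0 : 0 <= D by rewrite /D; lra.
have K0 := Ebd_ge0 he.
have b1 f x W : finE f -> 0 <= W -> nsq f <= W -> `|Aop f x| <= 3 * Num.sqrt W.
  move=> [A [c1 c2 c3 _]] W0 nW; apply: (Aop_bound2 c1 c2 c3 x (sqrtr_ge0 W)).
  by rewrite sqr_sqrtr.
have b2 f g x : finE f -> finE g -> nsq f <= N + V -> nsq g <= N + V ->
    `|Aop (fun x => f x * g x) x| <= N + V.
  move=> Ef Eg nf ng; have [A [c1 c2 c3 _]] := inEM Ef Eg.
  have l1 := ip_L1 Ef Eg.
  apply: (le_trans (Aop_bound1 c1 c2 x l1)).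
  have hf := L2_abs (inE_L2 Ef); have hg := L2_abs (inE_L2 Eg).
  have S0 := sqrtr_ge0 (N + V); have SE : Num.sqrt (N + V) ^+ 2 = N + V by exact: (sqr_sqrtr (addr_ge0 N0 V0)).
  have := cauchy_schwarz hf hg S0 S0; rewrite !nsq_abs -expr2 SE => /(_ nf ng).
  apply: le_trans; apply: (le_trans _ (ler_norm _)); rewrite le_eqVlt; apply/orP; left; apply/eqP.
  by apply: eq_intR => y; rewrite normrM.
pose KK := K + D * (T - t0) + Num.sqrt N + Num.sqrt V.
have DT : 0 <= D * (T - t0) by rewrite mulr_ge0// subr_ge0 ltW.
have final (u : R -> R -> R) (p : R -> R -> R) : Ebd K (u t0) ->
    (forall t, t0 <= t -> t < T -> finE (u t) /\ (nsq (u t) <= N \/ nsq (u t) <= V)) ->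
    (forall t, t0 <= t -> t < T -> Ederiv u t (p t) /\ finE (p t)) ->
    (forall t x, t0 <= t -> t < T -> `|p t x| <= D) ->
    forall t, t0 <= t -> t < T -> Ebd KK (u t).
  move=> hu En dp pD t h0 h1; have [Et nt] := En t h0 h1; split.
  - exact: inE_cont.
  - move=> x; have [|c [c0 c1 E]] := @mean_value R (fun r => u r x) (fun r => p r x) t0 t h0.
      move=> r r0 r1; have rT := le_lt_trans r1 h1.
      have [D1 D2] := dp r r0 rT; have [E1 _] := En r r0 rT.
      exact: Sderiv_pt (Ederiv_S E1 D2 D1).
    have cT := le_lt_trans c1 h1; have pc := pD c x c0 cT; have u0 := Ebd_sup x hu.
    have -> : u t x = u t0 x + (u t x - u t0 x) by ring.
    apply: (le_trans (ler_normD _ _)); rewrite E normrM (ger0_norm (_ : 0 <= t - t0)) ?subr_ge0//.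
    have : `|p c x| * (t - t0) <= D * (T - t0).
      by rewrite ler_pM// ?subr_ge0// lerD2r ltW.
    by rewrite /KK; lra.
  - exact: inE_L2.
  - have le (W : R) : 0 <= W -> Num.sqrt W <= KK -> W <= KK ^+ 2.
      by move=> W0 h; rewrite -{1}(sqr_sqrtr W0) lerXn2r ?nnegrE ?(le_trans _ h).
    case: nt => nt; apply: (le_trans nt); apply: le => //; rewrite /KK; lra.
exists KK => t h0 h1; split.
- apply: (final eta (fun r => Aop (F1 (eta r) (v r)))) => // r r0.
  + move=> r1; have [E1 E2 _ _] := fl r (lt_le_trans t00 r0) r1; split => //.
    by left; exact: ge.
  + move=> r1; have [E1 E2 D1 _] := fl r (lt_le_trans t00 r0) r1; split => //.
    by apply: inE_Aop; exact: finE_F1.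
  + move=> r1 r2; have [E1 E2 _ _] := fl r (lt_le_trans t00 r1) r2.
    rewrite /F1 AopD_E//; last exact: inEM.
    apply: (le_trans (ler_normD _ _)).
    have := b1 (v r) r0 V E2 V0 (gv r r1 r2).
    have g1 : nsq (eta r) <= N + V by have := ge r r1 r2; lra.
    have g2 : nsq (v r) <= N + V by have := gv r r1 r2; lra.
    have := b2 (eta r) (v r) r0 E1 E2 g1 g2; rewrite /D; lra.
- apply: (final v (fun r => Aop (F2 (eta r) (v r)))) => // r r0.
  + move=> r1; have [E1 E2 _ _] := fl r (lt_le_trans t00 r0) r1; split => //.
    by right; exact: gv.
  + move=> r1; have [E1 E2 _ D1] := fl r (lt_le_trans t00 r0) r1; split => //.
    by apply: inE_Aop; exact: finE_F2.
  + move=> r1 r2; have [E1 E2 _ _] := fl r (lt_le_trans t00 r1) r2.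
    have E22 := inEM E2 E2.
    rewrite /F2 AopD_E//; last exact: inEZ.
    rewrite AopZ_E//; apply: (le_trans (ler_normD _ _)).
    have := half_norm (Aop (fun x => v r x * v r x) r0).
    have := b1 (eta r) r0 N E1 N0 (ge r r1 r2).
    have g2 : nsq (v r) <= N + V by have := gv r r1 r2; lra.
    have := b2 (v r) (v r) r0 E2 E2 g2 g2; rewrite /D; lra.
Qed.

End Apriori.

(** * Local existence, uniqueness and persistence of regularity *)

Section Local.
Context {R : realType}.
Implicit Types (f g h : R -> R) (u eta v p q : R -> R -> R) (a b c t r A B D M K e s : R).

Lemma EcontB u v t : Econt u t -> Econt v t -> Econt (fun r x => u r x - v r x) t.
Proof.
move=> hu hv; apply: (@Econt_ext _ (fun r x => u r x + -1 * v r x)).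
  by move=> r x; rewrite mulN1r.
by apply: EcontD => //; exact: EcontZ.
Qed.

Lemma F_bound K f g : Ebd K f -> Ebd K g ->
  Ebd ((1 + 2 * K) * K) (Aop (F1 f g)) /\ Ebd ((1 + 2 * K) * K) (Aop (F2 f g)).
Proof.
move=> hf hg; have K0 := Ebd_ge0 hf; have KK : 0 <= K * K by exact: mulr_ge0.
split; apply: Ebd_Aop.
  by apply: EbdW (EbdD hg (EbdM hf hg)); lra.
apply: EbdW (EbdD hf (EbdZ 2^-1 (EbdM hg hg))); rewrite ger0_norm//.
by move: KK; rewrite mulrDl mul1r -mulrA; move: (K * K) => z; lra.
Qed.

Lemma F_lip K D (e1 v1 e2 v2 : R -> R) : Ebd K e1 -> Ebd K v1 -> Ebd K e2 -> Ebd K v2 ->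
  Ebd D (fun x => e1 x - e2 x) -> Ebd D (fun x => v1 x - v2 x) ->
  Ebd ((1 + 2 * K) * D) (fun x => Aop (F1 e1 v1) x - Aop (F1 e2 v2) x) /\
  Ebd ((1 + 2 * K) * D) (fun x => Aop (F2 e1 v1) x - Aop (F2 e2 v2) x).
Proof.
move=> h1 h2 h3 h4 d1 d2; have K0 := Ebd_ge0 h1; have D0 := Ebd_ge0 d1.
have KD : 0 <= K * D by exact: mulr_ge0.
have E1 : finE e1 by exists K. have E2 : finE v1 by exists K.
have E3 : finE e2 by exists K. have E4 : finE v2 by exists K.
split.
- rewrite -AopB; [|exact: finE_F1|exact: finE_F1]; apply: Ebd_Aop.
  apply: (@EbdW _ (D + (D * K + K * D))); first by rewrite mulrDl mul1r lerD2l; lra.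
  by apply: Ebd_eq (EbdD d2 (EbdD (EbdM d1 h2) (EbdM h3 d2))) => x; rewrite /F1; ring.
- rewrite -AopB; [|exact: finE_F2|exact: finE_F2]; apply: Ebd_Aop.
  apply: (@EbdW _ (D + `|2^-1| * (D * (K + K)))).
    rewrite ger0_norm// mulrDl mul1r lerD2l.
    have -> : 2^-1 * (D * (K + K)) = K * D by field.
    by rewrite -mulrA; move: (K * D) KD => z; lra.
  by apply: Ebd_eq (EbdD d1 (EbdZ 2^-1 (EbdM d2 (EbdD h2 h4)))) => x; rewrite /F2; field.
Qed.

Lemma prim_contract c p q B D t : (forall r, Ebd B (p r)) -> (forall r, Econt p r) ->
  (forall r, Ebd B (q r)) -> (forall r, Econt q r) ->
  (forall r, Ebd D (fun x => p r x - q r x)) ->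
  Ebd (D * `|t - c|) (fun x => prim c p t x - prim c q t x).
Proof.
move=> pB cp qB cq pqD.
have cpq r : Econt (fun r x => p r x - q r x) r by exact: EcontB.
apply: Ebd_eq (prim_bound c pqD cpq t) => x.
by rewrite (primB c t x pB cp qB cq).
Qed.

Section picard.
Variables (K tau c : R) (f0 g0 : R -> R).
Hypotheses (hf : Ebd (K / 2) f0) (hg : Ebd (K / 2) g0) (tau0 : 0 < tau).
Hypothesis small : (1 + 2 * K) * tau <= 1 / 2.

Let K0 : 0 <= K. Proof. by have := Ebd_ge0 hf; lra. Qed.
Let ctau : c - tau <= c + tau. Proof. by have := tau0; lra. Qed.
Let cl := clamp (c - tau) (c + tau).

Let cl_c r : `|cl r - c| <= tau.
Proof. by have := clamp_in r ctau; rewrite -/(cl r) ler_norml; lra. Qed.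

Definition good u := (forall t, Ebd K (u t)) /\ forall t, Econt u t.

(** Times are clamped so that all the iterates are defined and bounded on the line. *)
Definition picard (w : (R -> R -> R) * (R -> R -> R)) : (R -> R -> R) * (R -> R -> R) :=
  (fun t x => f0 x + prim c (fun r => Aop (F1 (w.1 r) (w.2 r))) (cl t) x,
   fun t x => g0 x + prim c (fun r => Aop (F2 (w.1 r) (w.2 r))) (cl t) x).

Let L := 1 + 2 * K.
Let L0 : 0 <= L. Proof. by rewrite /L; have := K0; lra. Qed.
Let EK f : Ebd K f -> finE f. Proof. by exists K. Qed.

Let rhs_good w : good w.1 -> good w.2 ->
  [/\ forall r, Ebd (L * K) (Aop (F1 (w.1 r) (w.2 r))),
      forall r, Econt (fun r => Aop (F1 (w.1 r) (w.2 r))) r,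
      forall r, Ebd (L * K) (Aop (F2 (w.1 r) (w.2 r))) &
      forall r, Econt (fun r => Aop (F2 (w.1 r) (w.2 r))) r].
Proof.
move=> [w1 c1] [w2 c2]; split => r.
- by case: (F_bound (w1 r) (w2 r)).
- have E1 := EK (w1 r); have E2 := EK (w2 r).
  by apply: Econt_Aop; [exact: finE_F1|exact: Econt_F1].
- by case: (F_bound (w1 r) (w2 r)).
- have E1 := EK (w1 r); have E2 := EK (w2 r).
  by apply: Econt_Aop; [exact: finE_F2|exact: Econt_F2].
Qed.

Let step_good (h0 : R -> R) p : Ebd (K / 2) h0 -> (forall r, Ebd (L * K) (p r)) ->
  (forall r, Econt p r) -> good (fun t x => h0 x + prim c p (cl t) x).
Proof.
move=> h0K pB cp; split => t.
  apply: EbdW (EbdD h0K (prim_bound c pB cp (cl t))).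
  have : L * K * `|cl t - c| <= L * K * tau by rewrite ler_wpM2l// mulr_ge0.
  have -> : L * K * tau = K * ((1 + 2 * K) * tau) by rewrite /L; ring.
  have : K * ((1 + 2 * K) * tau) <= K * (1 / 2) by rewrite ler_wpM2l.
  by move: (_ * `|_|) (K * (_ * tau)) => y z; lra.
have h : Econt (fun r => prim c p (cl r)) t.
  apply: Econt_clamp => // r _ _; apply: Ederiv_cont (prim_Ederiv c pB cp r) _.
  by exists (L * K).
by move=> e /h[d d0 hd]; exists d => // r /hd; apply: Ebd_eq => x; ring.
Qed.

Let picard_good w : good w.1 -> good w.2 -> good (picard w).1 /\ good (picard w).2.
Proof. by move=> h1 h2; have [b1 c1 b2 c2] := rhs_good h1 h2; split; exact: step_good. Qed.

Definition close D (w z : (R -> R -> R) * (R -> R -> R)) := forall t,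
  Ebd D (fun x => w.1 t x - z.1 t x) /\ Ebd D (fun x => w.2 t x - z.2 t x).

Let add_cancel (x y z : R) : y - z = (x + y) - (x + z).
Proof. by ring. Qed.

Let triangle (x y z : R) : x - y = - (z - x) + (z - y).
Proof. by ring. Qed.

Let picard_contract w z D : good w.1 -> good w.2 -> good z.1 -> good z.2 ->
  close D w z -> close (D / 2) (picard w) (picard z).
Proof.
move=> w1 w2 z1 z2 wz t; have D0 : 0 <= D by case: (wz 0) => /Ebd_ge0.
have [b1 c1 b2 c2] := rhs_good w1 w2; have [b1' c1' b2' c2'] := rhs_good z1 z2.
have lip r := F_lip (w1.1 r) (w2.1 r) (z1.1 r) (z2.1 r) (wz r).1 (wz r).2.
have le : L * D * `|cl t - c| <= D / 2.
  apply: (@le_trans _ _ (L * D * tau)); first by rewrite ler_wpM2l// mulr_ge0.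
  have -> : L * D * tau = D * ((1 + 2 * K) * tau) by rewrite /L; ring.
  by rewrite -[D / 2]/(D * 2^-1) ler_wpM2l//; have := small; lra.
split; apply: (EbdW le).
  have h := @prim_contract c _ _ (L * K) (L * D) (cl t) b1 c1 b1' c1' (fun r => (lip r).1).
  by apply: Ebd_eq h => x; exact: add_cancel.
have h := @prim_contract c _ _ (L * K) (L * D) (cl t) b2 c2 b2' c2' (fun r => (lip r).2).
by apply: Ebd_eq h => x; exact: add_cancel.
Qed.

Definition picard_iter n := iter n picard (fun=> f0, fun=> g0).
Local Notation it := picard_iter.

Let itS n : it n.+1 = picard (it n). Proof. by []. Qed.

Let it_good n : good (it n).1 /\ good (it n).2.
Proof.
elim: n => [|n [h1 h2]]; last exact: picard_good.
have k h : Ebd (K / 2) h -> good (fun=> h).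
  move=> hh; split => t; first by apply: EbdW hh; have := K0; lra.
  move=> e e0; exists 1 => // r _; apply: (@Ebd_eq _ _ (fun=> 0)) => [x|].
    by rewrite subrr.
  by apply: Ebd_0; exact: ltW.
by split; exact: k.
Qed.

Let it_close n : close (2 * K / 2 ^+ n) (it n.+1) (it n).
Proof.
elim: n => [|n IH].
  have [[h1 _] [h2 _]] := it_good 1; have [[h3 _] [h4 _]] := it_good 0.
  by move=> t; rewrite expr0 divr1 (_ : 2 * K = K + K); [split; exact: EbdB|ring].
have [h1 h2] := it_good n.+1; have [h3 h4] := it_good n.
have -> : 2 * K / 2 ^+ n.+1 = 2 * K / 2 ^+ n / 2.
  by rewrite exprS invfM [2^-1 * _]mulrC mulrA.
rewrite (itS n.+1) {2}(itS n); exact: (picard_contract h1 h2 h3 h4 IH).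
Qed.

Let limit (z_ : nat -> R -> R -> R) : (forall n, good (z_ n)) ->
  (forall n t, Ebd (2 * K / 2 ^+ n) (fun x => z_ n.+1 t x - z_ n t x)) ->
  exists z, good z /\ forall n t, Ebd (4 * K / 2 ^+ n) (fun x => z_ n t x - z t x).
Proof.
move=> zg zc; have K2 : 0 <= 2 * K by rewrite mulr_ge0.
have ex t := cid (@E_complete R (fun n => z_ n t) K (2 * K) K2 (fun n => (zg n).1 t) (fun n => zc n t)).
pose z t := projT1 (ex t).
have hz n t : Ebd (4 * K / 2 ^+ n) (fun x => z_ n t x - z t x).
  by rewrite /z; case: (ex t) => y [_ /(_ n)] /=; rewrite mulrA -natrM.
exists z; split => //; split=> t; first by rewrite /z; case: (ex t) => y [].
move=> e e0; have e3 : 0 < e / 3 by rewrite divr_gt0.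
have [n hn] := geometric_small (4 * K) e3.
have [d d0 hd] := (zg n).2 t _ e3; exists d => // r /hd h.
apply: (@EbdW _ (4 * K / 2 ^+ n + e / 3 + 4 * K / 2 ^+ n)); first by lra.
by apply: Ebd_eq (EbdD (EbdD (EbdN (hz n r)) h) (hz n t)) => x; ring.
Qed.

(** The existence time depends on the E norm of the initial data only. *)
Lemma local_existence : exists u1 u2 : R -> R -> R,
  [/\ u1 c = f0, u2 c = g0, forall t, Ebd K (u1 t) /\ Ebd K (u2 t) &
      flow (c - tau) (c + tau) u1 u2].
Proof.
have [u1 [g1 l1]] := limit (fun n => (it_good n).1) (fun n t => (it_close n t).1).
have [u2 [g2 l2]] := limit (fun n => (it_good n).2) (fun n t => (it_close n t).2).
pose w := (u1, u2); have [p1 p2] := picard_good (w := w) g1 g2.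
have fixed : (forall t, u1 t = (picard w).1 t) /\ forall t, u2 t = (picard w).2 t.
  have cl_ n : close (4 * K / 2 ^+ n / 2) (it n.+1) (picard w).
    have [h1 h2] := it_good n; rewrite itS.
    apply: (@picard_contract (it n) w (4 * K / 2 ^+ n) h1 h2 g1 g2) => t.
    by split; [exact: (l1 n t)|exact: (l2 n t)].
  have eq0 (y : R) : (forall n, `|y| <= 4 * K / 2 ^+ n.+1 + 4 * K / 2 ^+ n / 2) -> y = 0.
    move=> hy; apply/eqP; rewrite -normr_le0; apply/ler_addgt0Pr => e e0; rewrite add0r.
    have [n hn] := geometric_small (4 * K) e0; apply: (le_trans (hy n)).
    rewrite exprS invfM; move: hn; move: (2 ^+ n)^-1 => y'; rewrite mulrA => hn.
    by rewrite (_ : 4 * K * 2^-1 * y' + 4 * K * y' / 2 = 4 * K * y'); [exact: ltW|field].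
  split=> t; apply/funext => x; apply/eqP; rewrite -subr_eq0; apply/eqP; apply: eq0 => n.
    have a1 := Ebd_sup x (l1 n.+1 t); have a2 := Ebd_sup x (cl_ n t).1.
    rewrite (triangle _ _ ((it n.+1).1 t x)).
    by apply: (le_trans (ler_normD _ _)); rewrite normrN; exact: lerD.
  have a1 := Ebd_sup x (l2 n.+1 t); have a2 := Ebd_sup x (cl_ n t).2.
  rewrite (triangle _ _ ((it n.+1).2 t x)).
  by apply: (le_trans (ler_normD _ _)); rewrite normrN; exact: lerD.
have [x1 x2] := fixed; have [b1 c1 b2 c2] := rhs_good (w := w) g1 g2.
have clc : cl c = c by have := tau0; rewrite /cl => h; apply: clamp_id; lra.
have y1 t : u1 t = fun x => f0 x + prim c (fun r => Aop (F1 (u1 r) (u2 r))) (cl t) x.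
  by rewrite {1}x1.
have y2 t : u2 t = fun x => g0 x + prim c (fun r => Aop (F2 (u1 r) (u2 r))) (cl t) x.
  by rewrite {1}x2.
exists u1, u2; split.
- by rewrite y1 clc; apply/funext => x; rewrite prim_base addr0.
- by rewrite y2 clc; apply/funext => x; rewrite prim_base addr0.
- by move=> t; split; [exact: g1.1|exact: g2.1].
move=> t t1 t2; have E1 := EK (g1.1 t); have E2 := EK (g2.1 t).
have near r : `|r - t| < Num.min (t - (c - tau)) (c + tau - t) -> cl r = r.
  by rewrite lt_min !ltr_norml => h; rewrite /cl clamp_id//; lra.
have m0 : 0 < Num.min (t - (c - tau)) (c + tau - t) by rewrite lt_min; apply/andP; split; lra.
have add0 (f : R -> R) : (fun x => 0 + f x) = f by apply/funext => x; rewrite add0r.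
split => //.
- have := EderivD (Ederiv_const f0 t) (prim_Ederiv c b1 c1 t); rewrite add0.
  move=> /Ederiv_local; apply; eexists; first exact: m0.
  by move=> r /near h; rewrite y1 h.
- have := EderivD (Ederiv_const g0 t) (prim_Ederiv c b2 c2 t); rewrite add0.
  move=> /Ederiv_local; apply; eexists; first exact: m0.
  by move=> r /near h; rewrite y2 h.
Qed.

End picard.

(** Integrating the equations from c halves any bound on the differences. *)
Lemma flow_unique K a b a' b' c T eta v eta' v' : flow a b eta v -> flow a' b' eta' v' ->
  a < c -> a' < c -> T <= b -> T <= b' -> (1 + 2 * K) * (T - c) <= 1 / 2 ->
  (forall t, c <= t -> t < T -> [/\ Ebd K (eta t), Ebd K (v t), Ebd K (eta' t) & Ebd K (v' t)]) ->
  eta c = eta' c -> v c = v' c ->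
  forall t, c <= t -> t < T -> eta t = eta' t /\ v t = v' t.
Proof.
move=> fl fl' ac ac' Tb Tb' small hK ec vc.
have key n t : c <= t -> t < T -> Ebd (2 * K / 2 ^+ n) (fun x => eta t x - eta' t x) /\
    Ebd (2 * K / 2 ^+ n) (fun x => v t x - v' t x).
  elim: n t => [|n IH] t ct tT.
    have [h1 h2 h3 h4] := hK t ct tT.
    by rewrite expr0 divr1 (_ : 2 * K = K + K); [split; exact: EbdB|ring].
  have K0 : 0 <= K by have [/Ebd_ge0] := hK t ct tT.
  set D := 2 * K / 2 ^+ n in IH; have D0 : 0 <= D by rewrite divr_ge0 ?exprn_ge0// mulr_ge0.
  have -> : 2 * K / 2 ^+ n.+1 = D / 2 by rewrite exprS invfM [2^-1 * _]mulrC mulrA.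
  have le : (1 + 2 * K) * D * (t - c) <= D / 2.
    apply: (@le_trans _ _ (D * ((1 + 2 * K) * (T - c)))).
      rewrite mulrAC [leRHS]mulrC ler_wpM2r// ler_wpM2l//; first by lra.
      by rewrite lerD2r ltW.
    by rewrite -[D / 2]/(D * 2^-1) ler_wpM2l//; lra.
  have lip r : c <= r -> r <= t ->
      Ebd ((1 + 2 * K) * D) (fun x => Aop (F1 (eta r) (v r)) x - Aop (F1 (eta' r) (v' r)) x) /\
      Ebd ((1 + 2 * K) * D) (fun x => Aop (F2 (eta r) (v r)) x - Aop (F2 (eta' r) (v' r)) x).
    move=> h1 h2; have rT := le_lt_trans h2 tT.
    have [k1 k2 k3 k4] := hK r h1 rT; have [i1 i2] := IH r h1 rT; exact: F_lip.
  have dd r : c <= r -> r <= t ->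
      Sderiv (fun r x => eta r x - eta' r x) r
        (fun x => Aop (F1 (eta r) (v r)) x - Aop (F1 (eta' r) (v' r)) x) /\
      Sderiv (fun r x => v r x - v' r x) r
        (fun x => Aop (F2 (eta r) (v r)) x - Aop (F2 (eta' r) (v' r)) x).
    move=> h1 h2; have rT := le_lt_trans h2 tT.
    have [e1 e2 d1 d2] := fl r (lt_le_trans ac h1) (lt_le_trans rT Tb).
    have [e1' e2' d1' d2'] := fl' r (lt_le_trans ac' h1) (lt_le_trans rT Tb').
    have A1 := inE_Aop (finE_F1 e1 e2); have A2 := inE_Aop (finE_F2 e1 e2).
    have A1' := inE_Aop (finE_F1 e1' e2'); have A2' := inE_Aop (finE_F2 e1' e2').
    split; apply: Ederiv_S; try exact: inEB.
      exact: EderivD d1 (EderivN d1').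
    exact: EderivD d2 (EderivN d2').
  split; apply: (EbdW le).
    have h := E_mean_value ct (fun r k1 k2 => (dd r k1 k2).1) (fun r k1 k2 => (lip r k1 k2).1).
    by apply: Ebd_eq h => x; rewrite ec subrr subr0.
  have h := E_mean_value ct (fun r k1 k2 => (dd r k1 k2).2) (fun r k1 k2 => (lip r k1 k2).2).
  by apply: Ebd_eq h => x; rewrite vc subrr subr0.
have eq0 (y : R) : (forall n, `|y| <= 2 * K / 2 ^+ n) -> y = 0.
  move=> hy; apply/eqP; rewrite -normr_le0; apply/ler_addgt0Pr => e e0; rewrite add0r.
  by have [n hn] := geometric_small (2 * K) e0; exact: le_trans (hy n) (ltW hn).
move=> t ct tT; split; apply/funext => x; apply/eqP; rewrite -subr_eq0; apply/eqP; apply: eq0 => n.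
  exact: Ebd_sup x (key n t ct tT).1.
exact: Ebd_sup x (key n t ct tT).2.
Qed.

Section persistence.
Variables (K s a b c t1 C0 : R) (u1 u2 : R -> R -> R).
Hypotheses (hs : 1 / 2 < s) (hK : forall t, Ebd K (u1 t) /\ Ebd K (u2 t)).
Hypotheses (fl : flow a b u1 u2) (ac : a < c) (ct1 : c <= t1) (t1b : t1 < b).
Hypotheses (C00 : 0 <= C0) (h1 : Hbd s C0 (u1 c)) (h2 : Hbd s C0 (u2 c)).

Definition reg sg (w1 w2 : R -> R -> R) := exists2 B, 0 <= B & forall t, c <= t -> t <= t1 ->
  Hbd sg B (w1 t) /\ Hbd sg B (w2 t).

Let p1 t := Aop (F1 (u1 t) (u2 t)).
Let p2 t := Aop (F2 (u1 t) (u2 t)).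
Let Eu1 t : finE (u1 t). Proof. by exists K; case: (hK t). Qed.
Let Eu2 t : finE (u2 t). Proof. by exists K; case: (hK t). Qed.
Let Ep1 t : finE (p1 t). Proof. by apply: inE_Aop; exact: finE_F1. Qed.
Let Ep2 t : finE (p2 t). Proof. by apply: inE_Aop; exact: finE_F2. Qed.
Let dd t : c <= t -> t <= t1 -> Ederiv u1 t (p1 t) /\ Ederiv u2 t (p2 t).
Proof. by move=> h h'; have [] := fl (lt_le_trans ac h) (le_lt_trans h' t1b). Qed.

Let reg_Aop sg M f : finE f -> Hbd sg M f -> Hbd (sg + 1) M (Aop f).
Proof. by move=> [B [c1 c2 c3 _]]; exact: (Hbd_Aop c1 c2 c3). Qed.

(** One space derivative is gained by A. *)
Let reg_rhs sg : 1 / 2 < sg -> reg sg u1 u2 -> reg (sg + 1) p1 p2.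
Proof.
move=> hsg [B B0 hB]; have a0 := algC_ge0 sg.
have q0 : 0 <= algC sg * B * B by exact: mulr_ge0 (mulr_ge0 a0 B0) B0.
exists (B + algC sg * B * B) => [|t h h']; first exact: addr_ge0.
have [r1 r2] := hB t h h'; have cu1 := inE_cont (Eu1 t); have cu2 := inE_cont (Eu2 t).
have m1 := Hbd_mul hsg B0 B0 cu1 cu2 (inE_L2 (Eu1 t)) r1 r2.
have m2 := Hbd_mul hsg B0 B0 cu2 cu2 (inE_L2 (Eu2 t)) r2 r2.
split; apply: reg_Aop.
- exact: finE_F1.
- by apply: HbdD => //; exact: contM.
- exact: finE_F2.
- apply: (@HbdW _ _ _ (B + `|2^-1| * (algC sg * B * B)) _ _ (lexx sg)).
    rewrite (ger0_norm (_ : 0 <= 2^-1))//; apply: le_sqr_norm.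
    have i2 : 0 <= (2 : R)^-1 by rewrite invr_ge0.
    rewrite (ger0_norm (addr_ge0 B0 (mulr_ge0 i2 q0))) (ger0_norm (addr_ge0 B0 q0)).
    by rewrite lerD2l ler_piMl// invf_le1// ler1n.
  apply: HbdD => //; [by apply: contZ; exact: contM|exact: mulr_ge0|].
  by apply: HbdZ => //; exact: contM.
Qed.

Let reg_rhs0 : reg 1 p1 p2.
Proof.
have K0 : 0 <= K by case: (hK 0) => /Ebd_ge0.
exists (K + K * K) => [|t h h']; first by rewrite addr_ge0// mulr_ge0.
have [r1 r2] := hK t.
have b1 : Ebd (K + K * K) (F1 (u1 t) (u2 t)) by apply: EbdD => //; exact: EbdM.
have b2 : Ebd (K + K * K) (F2 (u1 t) (u2 t)).
  apply: EbdW (EbdD r1 (EbdZ 2^-1 (EbdM r2 r2))).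
  by rewrite ger0_norm// lerD2l ler_piMl ?mulr_ge0// invf_le1// ler1n.
rewrite -[1]add0r; split; apply: reg_Aop.
- exact: finE_F1.
- by case: b1 => z1 _ z3 z4; exact: Hbd0_of_L2.
- exact: finE_F2.
- by case: b2 => z1 _ z3 z4; exact: Hbd0_of_L2.
Qed.

Let incr sg B (u p : R -> R -> R) : 0 <= B -> (forall t, finE (u t)) -> (forall t, finE (p t)) ->
  (forall t, c <= t -> t <= t1 -> Ederiv u t (p t)) ->
  (forall t, c <= t -> t <= t1 -> Hbd sg B (p t)) ->
  forall q r : R, c <= q -> q <= r -> r <= t1 -> Hbd sg (B * (r - q)) (fun x => u r x - u q x).
Proof.
move=> B0 Eu Ep du hp q r cq qr rt1; apply: (Hs_mean_value qr B0 Eu Ep) => t qt tr.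
  by apply: du; [exact: le_trans cq qt|exact: le_trans tr rt1].
by apply: hp; [exact: le_trans cq qt|exact: le_trans tr rt1].
Qed.

Let reg_sol sg : sg <= s -> reg sg p1 p2 -> reg sg u1 u2.
Proof.
move=> sgs [B B0 hB]; have t1c : 0 <= t1 - c by rewrite subr_ge0.
exists (C0 + B * (t1 - c)) => [|t h h']; first by rewrite addr_ge0// mulr_ge0.
have tc : 0 <= t - c by rewrite subr_ge0.
have le : (C0 + B * (t - c)) ^+ 2 <= (C0 + B * (t1 - c)) ^+ 2.
  apply: le_sqr_norm; rewrite !ger0_norm ?addr_ge0 ?mulr_ge0//.
  by rewrite lerD2l ler_wpM2l// lerD2r.
have go (u p : R -> R -> R) : (forall t, finE (u t)) -> (forall t, finE (p t)) ->
    (forall t, c <= t -> t <= t1 -> Ederiv u t (p t)) ->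
    (forall t, c <= t -> t <= t1 -> Hbd sg B (p t)) -> Hbd s C0 (u c) ->
    Hbd sg (C0 + B * (t - c)) (u t).
  move=> Eu Ep du hp h0; have i := incr B0 Eu Ep du hp (lexx c) h h'.
  have -> : u t = fun x => u c x + (u t x - u c x) by apply/funext => x; ring.
  exact: (HbdD (inE_cont (Eu c)) (contB (inE_cont (Eu t)) (inE_cont (Eu c))) C00
    (mulr_ge0 B0 tc) (HbdW sgs (lexx _) h0) i).
split; apply: (HbdW (lexx sg) le).
  by apply: (go u1 p1) => // r r1 r2; [case: (dd r1 r2)|case: (hB r r1 r2)].
by apply: (go u2 p2) => // r r1 r2; [case: (dd r1 r2)|case: (hB r r1 r2)].
Qed.

Let reg_all n : reg (Num.min s n.+1%:R) p1 p2.
Proof.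
have down sg sg' : sg' <= sg -> reg sg p1 p2 -> reg sg' p1 p2.
  move=> le [B B0 hB]; exists B => // t h h'; have [r1 r2] := hB t h h'.
  by split; apply: HbdW le (lexx _) _.
elim: n => [|n IH]; first by apply: down reg_rhs0; rewrite ge_min lexx orbT.
have n1 : (1 : R) <= n.+1%:R by rewrite ler1n.
apply: down (reg_rhs _ (reg_sol _ IH)); last 2 first.
- by rewrite lt_min hs/=; lra.
- by rewrite ge_min lexx.
rewrite -(natr1 n.+1); move: (n.+1%:R : R) n1 => m m1.
by case: (leP s (m + 1)) => q1; case: (leP s m) => q2; lra.
Qed.

(** The regularity H^s of the data persists, for as long as the E norm is bounded:
    the norms in H^1, H^2, ... are bounded one after the other. *)
Lemma persistence : reg s u1 u2 /\ exists2 B, 0 <= B & forall q r : R, c <= q -> q <= r -> r <= t1 ->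
  Hbd s (B * (r - q)) (fun x => u1 r x - u1 q x) /\
  Hbd s (B * (r - q)) (fun x => u2 r x - u2 q x).
Proof.
have s0 : 0 <= s by have := hs; lra.
have hp : reg s p1 p2.
  have := reg_all (Num.bound s); have := archi_boundP s0 => lt.
  rewrite (min_idPl _)//; apply: ltW; apply: (lt_le_trans lt).
  by rewrite ler_nat.
split; first exact: reg_sol.
have [B B0 hB] := hp; exists B => // q r cq qr rt; split.
  by apply: (incr B0 Eu1 Ep1) => // t r1 r2; [case: (dd r1 r2)|case: (hB t r1 r2)].
by apply: (incr B0 Eu2 Ep2) => // t r1 r2; [case: (dd r1 r2)|case: (hB t r1 r2)].
Qed.

End persistence.

End Local.

(** * The Fourier transform in terms of the Hartley transform *)

Section Bridge.
Context {R : realType}.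
Local Notation mu := (@lebesgue_measure R).
Implicit Types (f g h d : R -> R) (M s : R).

Lemma Lnorm2E d : measurable_fun setT d ->
  Lnorm mu 2%:E (fun x => (d x)%:E) = ((\int[mu]_x (d x ^+ 2)%:E) `^ 2^-1)%E.
Proof.
move=> md; rewrite unlock /=; congr (_ `^ _)%E; apply: eq_integral => x _.
by rewrite powR_mulrn// real_normK ?num_real.
Qed.

Lemma sqr_int_ge0 d : (0 <= \int[mu]_x (d x ^+ 2)%:E)%E.
Proof. by apply: integral_ge0 => x _; rewrite lee_fin sqr_ge0. Qed.

Lemma root_le (I : \bar R) M : (0 <= I)%E -> 0 <= M ->
  ((I `^ 2^-1 <= M%:E) <-> (I <= (M ^+ 2)%:E))%E.
Proof.
move=> I0 M0; case: I I0 => [r||] //=.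
  rewrite !lee_fin => r0; rewrite powR12_sqrt//; split=> h.
    by rewrite -(sqr_sqrtr r0) lerXn2r ?nnegrE ?sqrtr_ge0.
  by rewrite -[leRHS](ger0_norm M0) -sqrtr_sqr ler_wsqrtr.
by move=> _; rewrite invr_eq0 pnatr_eq0/=; split; rewrite leye_eq.
Qed.

Lemma L2_of_sqr_int d M : measurable_fun setT d -> 0 <= M ->
  (\int[mu]_x (d x ^+ 2)%:E <= (M ^+ 2)%:E)%E -> L2 d /\ nsq d <= M ^+ 2.
Proof.
move=> md M0 h; have [] := @ge0_L1P R (fun x => d x ^+ 2) (M ^+ 2) _ _ h.
- exact: measurable_funX.
- by move=> x; exact: sqr_ge0.
- by split.
Qed.

Lemma L2_sqr_int d : L2 d -> (\int[mu]_x (d x ^+ 2)%:E)%E = (nsq d)%:E.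
Proof. by move=> hd; rewrite -EFin_intR//; exact: L2_sq. Qed.

Lemma Lnorm2_le d M : measurable_fun setT d -> 0 <= M ->
  (Lnorm mu 2%:E (fun x => (d x)%:E) <= M%:E)%E -> L2 d /\ nsq d <= M ^+ 2.
Proof.
move=> md M0; rewrite Lnorm2E// => /(root_le (sqr_int_ge0 d) M0).1.
exact: L2_of_sqr_int.
Qed.

Lemma Lfun2P f : measurable_fun setT f -> (f \in Lfun mu 2%:E <-> L2 f).
Proof.
move=> mf; have E : f \in Lfun mu 2%:E <-> (Lnorm mu 2%:E (EFin \o f) < +oo)%E.
  split=> [/andP[_]|h]; first by rewrite inE.
  by apply/andP; split; rewrite inE.
rewrite E Lnorm2E//; split=> [h|hf]; last first.
  by rewrite L2_sqr_int// poweR_EFin ltry.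
have I0 := sqr_int_ge0 f; case: (\int[mu]_x _)%E (L2_of_sqr_int (d := f)) I0 h => [r||] //=.
- move=> H; rewrite lee_fin => r0 _.
  by have [] := H (Num.sqrt r) mf (sqrtr_ge0 _); rewrite // sqr_sqrtr.
- by move=> _ _; rewrite invr_eq0 pnatr_eq0/= ltxx.
Qed.

(** A limit in the mean of square integrable functions is unique; square integrability
    of the limit is a consequence of the convergence of the norms. *)
Lemma is_fourier_ae f (G G' : (R -> R) * (R -> R)) :
  (forall n, L2 (truncated_fourier f n).1) -> (forall n, L2 (truncated_fourier f n).2) ->
  is_fourier f G -> is_fourier f G' ->
  {ae mu, forall x, G.1 x = G'.1 x} /\ {ae mu, forall x, G.2 x = G'.2 x}.
Proof.
move=> t1 t2.
have key (u : nat -> R -> R) (g : R -> R) : (forall n, L2 (u n)) -> measurable_fun setT g ->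
    Lnorm mu 2%:E (fun xi => (u n xi - g xi)%:E) @[n --> \oo] --> 0%E -> L2 g /\ L2cvg u g.
  move=> u2 mg cv; have md n : measurable_fun setT (fun xi => u n xi - g xi).
    by apply: measurable_funB => //; exact: L2_measurable.
  have near e : 0 < e -> exists N, forall n, (N <= n)%N ->
      L2 (fun xi => u n xi - g xi) /\ nsq (fun xi => u n xi - g xi) <= e ^+ 2.
    move=> e0; have : \forall n \near \oo, (Lnorm mu 2%:E (fun xi => (u n xi - g xi)%:E) <= e%:E)%E.
      move/fine_cvgP: cv => [fin] /cvgrPdist_le /(_ e e0) c0.
      apply: filterS2 fin c0 => n fn; rewrite sub0r normrN => h.
      by rewrite -(fineK fn) lee_fin; exact: le_trans (ler_norm _) h.
    by move=> [N _ hN]; exists N => n /hN; apply: Lnorm2_le => //; exact: ltW.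
  have [N hN] := near 1 ltr01; have [h _] := hN N (leqnn N).
  have g2 : L2 g.
    have := L2B (u2 N) h; congr L2; apply/funext => x; ring.
  split => //; apply/L2cvgP => e e0.
  have [|N' hN'] := near (Num.sqrt e); first by rewrite sqrtr_gt0.
  exists N' => n /hN'[_].
  by rewrite sqr_sqrtr// ltW.
move=> [m1 m2 c1 c2] [m1' m2' c1' c2'].
have [a1 b1] := key _ _ t1 m1 c1; have [a2 b2] := key _ _ t2 m2 c2.
have [a1' b1'] := key _ _ t1 m1' c1'; have [a2' b2'] := key _ _ t2 m2' c2'.
by split; [exact: L2cvg_unique t1 a1 a1' b1 b1'|exact: L2cvg_unique t2 a2 a2' b2 b2'].
Qed.

(** If h is the Hartley transform of f, then evp h and odp h are the real and the
    imaginary part of its Fourier transform. *)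
Definition evp h z : R := 2^-1 * (h z + h (- z)).
Definition odp h z : R := - 2^-1 * (h z + -1 * h (- z)).

Lemma truncated_fourierE f n : continuous f ->
  (truncated_fourier f n).1 = evp (hart (trunc n f)) /\
  (truncated_fourier f n).2 = odp (hart (trunc n f)).
Proof.
move=> cf; have lc (z : R) : L1 (fun x => trunc n f x * cos (x * z)).
  have cc : continuous (fun x : R => cos (x * z)).
    move=> x; apply: (continuous_comp (f := fun x : R => x * z)); last exact: continuous_cos.
    by apply: cvgMr_tmp; exact: cvg_id.
  by apply: L1_eq (L1_box (- n%:R) n%:R (contM cf cc)) => x; rewrite /trunc mulrA.
have ls (z : R) : L1 (fun x => trunc n f x * sin (x * z)).
  have cc : continuous (fun x : R => sin (x * z)).
    move=> x; apply: (continuous_comp (f := fun x : R => x * z)); last exact: continuous_sin.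
    by apply: cvgMr_tmp; exact: cvg_id.
  by apply: L1_eq (L1_box (- n%:R) n%:R (contM cf cc)) => x; rewrite /trunc mulrA.
have E z : hart (trunc n f) z = cF * (intR (fun x => trunc n f x * cos (x * z)) +
    intR (fun x => trunc n f x * sin (x * z))).
  by rewrite /hart -intRD//; congr (_ * _); apply: eq_intR => x; rewrite /cas mulrDr.
have E' z : hart (trunc n f) (- z) = cF * (intR (fun x => trunc n f x * cos (x * z)) -
    intR (fun x => trunc n f x * sin (x * z))).
  rewrite /hart -intRB//; congr (_ * _); apply: eq_intR => x.
  by rewrite /cas mulrN cosN sinN mulrDr mulrN.
have B (g : R -> R) : \int[mu]_(x in `[- n%:R, n%:R]) (f x * g x) =
    intR (fun x => trunc n f x * g x).
  rewrite -intR_box; apply: eq_intR => x; by rewrite /trunc mulrA.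
split; apply/funext => z; rewrite /truncated_fourier/= B -/cF.
  by rewrite /evp E E'; field.
by rewrite /odp E E'; field.
Qed.

Lemma L2_evp h : L2 h -> L2 (evp h).
Proof. by move=> hh; apply: L2Z; apply: L2D => //; exact: L2_opp. Qed.

Lemma L2_odp h : L2 h -> L2 (odp h).
Proof. by move=> hh; apply: L2Z; apply: L2D => //; apply: L2Z; exact: L2_opp. Qed.

Lemma is_fourier_hartley f h : continuous f -> L2 f -> is_hartley f h ->
  is_fourier f (evp h, odp h).
Proof.
move=> cf f2 [h2 ch]; have t2 n := L2_hart_trunc n cf.
have t2o n := L2_opp (t2 n); have h2o := L2_opp h2.
have co := L2cvg_opp t2 h2 ch.
have key (u : nat -> R -> R) (g : R -> R) : (forall n, L2 (u n)) -> L2 g -> L2cvg u g ->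
    Lnorm mu 2%:E (fun xi => (u n xi - g xi)%:E) @[n --> \oo] --> 0%E.
  move=> u2 g2 c; have d2 n := L2B (u2 n) g2.
  have E n : Lnorm mu 2%:E (fun xi => (u n xi - g xi)%:E) = (Num.sqrt (nsq (fun x => u n x - g x)))%:E.
    rewrite Lnorm2E; last exact: L2_measurable.
    by rewrite L2_sqr_int// poweR_EFin powR12_sqrt ?nsq_ge0.
  rewrite (funext E); apply: cvg_EFin; first exact: nearW.
  rewrite -[X in _ --> X]sqrtr0; apply: continuous_cvg; [exact: sqrt_continuous|exact: c].
split.
- by apply: L2_measurable; exact: L2_evp.
- by apply: L2_measurable; exact: L2_odp.
- have -> : (fun n => Lnorm mu 2%:E (fun xi => ((truncated_fourier f n).1 xi - (evp h, odp h).1 xi)%:E)) =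
      fun n => Lnorm mu 2%:E (fun xi => (evp (hart (trunc n f)) xi - evp h xi)%:E).
    by apply/funext => n; have [-> _] := truncated_fourierE n cf.
  apply: (key (fun n => evp (hart (trunc n f)))).
  + by move=> n; exact: L2_evp.
  + exact: L2_evp.
  + apply: L2cvgZ; [by move=> n; exact: L2D|exact: L2D|].
    exact: (L2cvgD t2 h2 t2o h2o ch co).
- have -> : (fun n => Lnorm mu 2%:E (fun xi => ((truncated_fourier f n).2 xi - (evp h, odp h).2 xi)%:E)) =
      fun n => Lnorm mu 2%:E (fun xi => (odp (hart (trunc n f)) xi - odp h xi)%:E).
    by apply/funext => n; have [_ ->] := truncated_fourierE n cf.
  apply: (key (fun n => odp (hart (trunc n f)))).
  + by move=> n; exact: L2_odp.
  + exact: L2_odp.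
  + apply: L2cvgZ; [by move=> n; apply: L2D => //; exact: L2Z|by apply: L2D => //; exact: L2Z|].
    apply: (L2cvgD t2 h2 (fun n => L2Z (-1) (t2o n)) (L2Z (-1) h2o) ch).
    exact: (L2cvgZ (-1) t2o h2o co).
Qed.

Lemma fourier_ae f h : continuous f -> L2 f -> is_hartley f h ->
  [/\ measurable_fun setT (fourier f).1, measurable_fun setT (fourier f).2,
   {ae mu, forall x, (fourier f).1 x = evp h x} & {ae mu, forall x, (fourier f).2 x = odp h x}].
Proof.
move=> cf f2 fh; have F := is_fourier_hartley cf f2 fh.
have G : is_fourier f (fourier f).
  exact: (@xgetPex _ (cst 0, cst 0) [set g | is_fourier f g] (ex_intro _ _ F)).
have [|n|a1 a2] := @is_fourier_ae f (fourier f) (evp h, odp h) _ _ G F.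
- by move=> n; have [-> _] := truncated_fourierE n cf; apply: L2_evp; exact: L2_hart_trunc.
- by have [_ ->] := truncated_fourierE n cf; apply: L2_odp; exact: L2_hart_trunc.
- by case: G.
Qed.

(** The squared modulus of the Fourier transform at z is the average of h^2 over z and
    - z, and the weight is even. *)
Lemma Hs_normE f h s : continuous f -> L2 f -> is_hartley f h ->
  Hs_norm s f = ((\int[mu]_x ((wt s x * h x) ^+ 2)%:E) `^ 2^-1)%E.
Proof.
move=> cf f2 fh; have [m1 m2 a1 a2] := fourier_ae cf f2 fh; have [h2 _] := fh.
have mh := L2_measurable h2; have mw := @measurable_wt R s.
pose k (x : R) := (wt s x * h x) ^+ 2.
have mk : measurable_fun setT k by apply: measurable_funX; exact: measurable_funM.
have k0 x : 0 <= k x by exact: sqr_ge0.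
have mko : measurable_fun setT (fun x : R => k (- x)).
  have mo : measurable_fun setT (fun x : R => - x).
    by apply: continuous_measurable => x; exact: opp_continuous.
  exact: (measurableT_comp mk mo).
rewrite /Hs_norm; congr (_ `^ _)%E.
have -> : (\int[mu]_x ((1 + x ^+ 2) `^ s * ((fourier f).1 x ^+ 2 + (fourier f).2 x ^+ 2))%:E =
    \int[mu]_x (2^-1 * (k x + k (- x)))%:E)%E.
  apply: ae_eq_integral => //.
  - apply/measurable_EFinP; apply: measurable_funM.
      have -> : (fun x : R => (1 + x ^+ 2) `^ s) = fun x => wt s x ^+ 2.
        by apply/funext => x; rewrite wt_sq.
      exact: measurable_funX.
    by apply: measurable_funD; exact: measurable_funX.
  - apply/measurable_EFinP; apply: measurable_funM => //; exact: measurable_funD.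
  - apply: (aeS _ (aeI a1 a2)) => x [e1 e2] _.
    by rewrite e1 e2 -wt_sq /evp /odp /k wt_opp; congr (_%:E); field.
under eq_integral do rewrite EFinM.
rewrite ge0_integralZl//; try (by move=> x _; rewrite lee_fin addr_ge0);
  try (by apply/measurable_EFinP; exact: measurable_funD); try (by rewrite lee_fin invr_ge0).
under eq_integral do rewrite EFinD.
rewrite ge0_integralD//; try (by move=> x _; rewrite lee_fin); try (exact/measurable_EFinP).
have -> : (\int[mu]_x (k (- x))%:E = \int[mu]_x (k x)%:E)%E.
  have := @ge0_integral_opp R (fun x => (k x)%:E).
  by apply => [|x]; [exact/measurable_EFinP|rewrite lee_fin].
rewrite -[RHS]/(\int[mu]_x (k x)%:E)%E.
have : (0 <= \int[mu]_x (k x)%:E)%E by apply: integral_ge0 => x _; rewrite lee_fin.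
case: (\int[mu]_x _)%E => [r||] //= r0.
  by rewrite -EFinD -EFinM; congr (_%:E); field.
by rewrite addye// gt0_muley// lte_fin invr_gt0.
Qed.

(** The bridge between the norm defined by the complex Fourier transform and the
    weighted bounds on the Hartley transform. *)
Lemma Hs_norm_le f s M : continuous f -> L2 f -> 0 <= M ->
  ((Hs_norm s f <= M%:E)%E <-> Hbd s M f).
Proof.
move=> cf f2 M0; have [h fh] := hartley_exists cf f2; have [h2 _] := fh.
have mwh : measurable_fun setT (fun x => wt s x * h x).
  by apply: measurable_funM; [exact: measurable_wt|exact: L2_measurable].
rewrite (Hs_normE s cf f2 fh) (root_le (sqr_int_ge0 _) M0); split=> [H|H].
  by exists h; split => //; exact: L2_of_sqr_int.
by have [w2 wn] := Hbd_any cf fh H; rewrite L2_sqr_int// lee_fin.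
Qed.

Lemma Hs_norm_ge0 s f : (0 <= Hs_norm s f)%E.
Proof. exact: poweR_ge0. Qed.

Lemma HsP f s : continuous f -> (Hs s f <-> L2 f /\ exists2 M, 0 <= M & Hbd s M f).
Proof.
move=> cf; have mf := continuous_measurable cf; split=> [[/(Lfun2P mf) f2 h]|[f2 [M M0 hM]]].
  split => //; have h0 := Hs_norm_ge0 s f.
  have fin : Hs_norm s f \is a fin_num by rewrite ge0_fin_numE.
  have M0 : 0 <= fine (Hs_norm s f) by exact: fine_ge0.
  by exists (fine (Hs_norm s f)) => //; apply/(Hs_norm_le s cf f2 M0); rewrite fineK.
split; first exact/(Lfun2P mf).
by apply: le_lt_trans (ltry M); apply/(Hs_norm_le s cf f2 M0).
Qed.

Lemma Ebd_of_Hbd s M f : 1 / 2 < s -> continuous f -> L2 f -> 0 <= M -> Hbd s M f ->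
  Ebd ((sobC s + 1) * M) f.
Proof.
move=> hs cf f2 M0 hM; have S0 := @sobC_ge0 R s; have SM := mulr_ge0 S0 M0; split => //.
  by move=> x; rewrite mulrDl mul1r (le_trans (sobolev x hs cf f2 M0 hM))// lerDl.
have s0 : 0 <= s by move: hs; lra.
have [h fh] := hartley_exists cf f2.
have [w2 wn] := Hbd_any cf fh (HbdW s0 (lexx _) hM).
have E : (fun x => wt 0 x * h x) = h by apply/funext => x; rewrite wt0 mul1r.
rewrite -(hartley_nsq cf f2 fh) -E; apply: (le_trans wn).
by rewrite lerXn2r ?nnegrE ?mulr_ge0 ?addr_ge0// mulrDl mul1r lerDr.
Qed.

End Bridge.

(** * Solutions, their extension, and the blow-up criterion *)

Section Blowup.
Context {R : realType}.
Local Notation mu := (@lebesgue_measure R).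
Implicit Types (f g h phi : R -> R) (eta v u : R -> R -> R) (s T t r c e B K M : R).

Lemma Xs_close s T eta v t e : continuous_Xs s T eta v ->
  (forall t, t \in `[0, T[ -> continuous (eta t) /\ continuous (v t)) ->
  0 <= t -> t < T -> 0 < e -> exists2 d, 0 < d & forall r, `|r - t| < d -> 0 <= r -> r < T ->
    Hbd s e (fun x => eta r x - eta t x) /\ Hbd s e (fun x => v r x - v t x).
Proof.
move=> cX rep t0 tT e0; have tI : t \in `[0, T[ by rewrite in_itv/= t0.
have stat r : 0 <= r -> r < T -> [/\ continuous (eta r), continuous (v r), L2 (eta r) & L2 (v r)].
  move=> r0 rT; have rI : r \in `[0, T[ by rewrite in_itv/= r0.
  have [c1 c2] := rep r rI; have [[x1 x2] _] := cX r rI.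
  by have [/(HsP s c1)[l1 _] /(HsP s c2)[l2 _]] := conj x1 x2.
have [_ /fine_cvgP[fin /cvgrPdist_le /(_ e e0) cv]] := cX t tI.
have : \forall r \near within [set` `[0, T[] (nbhs t),
    (Xs_norm s (eta r \- eta t)%R (v r \- v t)%R <= e%:E)%E.
  apply: filterS2 fin cv => r fr; rewrite sub0r normrN => h.
  by rewrite -(fineK fr) lee_fin; exact: le_trans (ler_norm _) h.
rewrite near_withinE -nbhs_ballE => -[d /= d0 hd]; exists d => // r rd r0 rT.
have := hd r; rewrite /ball/= distrC => /(_ rd) /(_ _); rewrite in_itv/= r0 rT => /(_ isT) le.
have [c1 c2 l1 l2] := stat r r0 rT; have [c3 c4 l3 l4] := stat t t0 tT.
have e0' := ltW e0.
split.
  apply/(Hs_norm_le s (contB c1 c3) (L2B l1 l3) e0'); apply: le_trans le.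
  by rewrite /Xs_norm leeDl// Hs_norm_ge0.
apply/(Hs_norm_le s (contB c2 c4) (L2B l2 l4) e0'); apply: le_trans le.
by rewrite /Xs_norm leeDr// Hs_norm_ge0.
Qed.

Lemma continuous_Xs_of s T eta v :
  (forall t, 0 <= t -> t < T -> [/\ continuous (eta t), continuous (v t),
    L2 (eta t) /\ (exists2 M, 0 <= M & Hbd s M (eta t)) &
    L2 (v t) /\ (exists2 M, 0 <= M & Hbd s M (v t))]) ->
  (forall t e, 0 <= t -> t < T -> 0 < e -> exists2 d, 0 < d &
    forall r, `|r - t| < d -> 0 <= r -> r < T ->
    Hbd s e (fun x => eta r x - eta t x) /\ Hbd s e (fun x => v r x - v t x)) ->
  continuous_Xs s T eta v.
Proof.
move=> stat close t; rewrite in_itv/= => /andP[t0 tT].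
have [c1 c2 h1 h2] := stat t t0 tT; split.
  by split; [exact/(HsP s c1)|exact/(HsP s c2)].
have near e : 0 < e -> \forall r \near within [set` `[0, T[] (nbhs t),
    (Xs_norm s (eta r \- eta t)%R (v r \- v t)%R <= e%:E)%E.
  move=> e0; have e2 : 0 < e / 2 by rewrite divr_gt0.
  have [d d0 hd] := close t (e / 2) t0 tT e2.
  rewrite near_withinE -nbhs_ballE; exists d => //= r; rewrite /ball/= distrC => rd.
  rewrite in_itv/= => /andP[r0 rT]; have [a1 a2] := hd r rd r0 rT.
  have [c3 c4 [l3 _] [l4 _]] := stat r r0 rT; have e2' := ltW e2.
  have k1 := (Hs_norm_le s (contB c3 c1) (L2B l3 h1.1) e2').2 a1.
  have k2 := (Hs_norm_le s (contB c4 c2) (L2B l4 h2.1) e2').2 a2.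
  by rewrite (splitr e) EFinD; apply: leeD; [exact: k1|exact: k2].
have X0 r : (0 <= Xs_norm s (eta r \- eta t)%R (v r \- v t)%R)%E.
  by rewrite adde_ge0// Hs_norm_ge0.
apply/fine_cvgP; split.
  apply: filterS (near 1 ltr01) => r h; rewrite ge0_fin_numE//.
  by apply: le_lt_trans h _; rewrite ltry.
apply/cvgrPdist_le => e e0; apply: filterS (near e e0) => r h /=.
have fr : Xs_norm s (eta r \- eta t)%R (v r \- v t)%R \is a fin_num.
  by rewrite ge0_fin_numE//; apply: le_lt_trans h _; rewrite ltry.
by rewrite sub0r normrN ger0_norm ?fine_ge0// -lee_fin fineK.
Qed.

Lemma solution_static s T (eta0 v0 : R -> R) eta v t : solution s T eta0 v0 eta v -> 0 <= t -> t < T ->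
  [/\ continuous (eta t), continuous (v t),
    L2 (eta t) /\ (exists2 M, 0 <= M & Hbd s M (eta t)) &
    L2 (v t) /\ (exists2 M, 0 <= M & Hbd s M (v t))].
Proof.
move=> [cX rep _ _] t0 tT; have tI : t \in `[0, T[ by rewrite in_itv/= t0.
have [c1 c2] := rep t tI; have [[x1 x2] _] := cX t tI.
by split => //; [exact/(HsP s c1)|exact/(HsP s c2)].
Qed.

Lemma solution_finE s T (eta0 v0 : R -> R) eta v t : 1 / 2 < s -> solution s T eta0 v0 eta v ->
  0 <= t -> t < T -> finE (eta t) /\ finE (v t).
Proof.
move=> hs sol t0 tT; have [c1 c2 [l1 [M1 m1 h1]] [l2 [M2 m2 h2]]] := solution_static sol t0 tT.
split; first by exists ((sobC s + 1) * M1); exact: Ebd_of_Hbd.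
by exists ((sobC s + 1) * M2); exact: Ebd_of_Hbd.
Qed.

Lemma solution_Econt s T (eta0 v0 : R -> R) eta v t : 1 / 2 < s -> solution s T eta0 v0 eta v ->
  0 < t -> t < T -> Econt eta t /\ Econt v t.
Proof.
move=> hs sol t0 tT; have [cX rep _ _] := sol.
have S1 : 0 < sobC s + 1 by rewrite ltr_wpDl// sobC_ge0.
have [c1 c2 [l1 _] [l2 _]] := solution_static sol (ltW t0) tT.
have main e : 0 < e -> exists2 d, 0 < d & forall r, `|r - t| < d ->
    Ebd e (fun x => eta r x - eta t x) /\ Ebd e (fun x => v r x - v t x).
  move=> e0; have k0 : 0 < e / (sobC s + 1) by rewrite divr_gt0.
  have [d d0 hd] := Xs_close cX rep (ltW t0) tT k0.
  exists (Num.min d (Num.min t (T - t))); first by rewrite !lt_min d0 t0 subr_gt0.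
  move=> r; rewrite !lt_min => /and3P[rd rt rT].
  have r0 : 0 <= r by move: rt; rewrite ltr_norml; lra.
  have rT' : r < T by move: rT; rewrite ltr_norml; lra.
  have [h1 h2] := hd r rd r0 rT'.
  have [c3 c4 [l3 _] [l4 _]] := solution_static sol r0 rT'.
  have E : (sobC s + 1) * (e / (sobC s + 1)) = e by rewrite mulrC divfK ?gt_eqF.
  rewrite -E; split; apply: Ebd_of_Hbd => //; try exact: ltW; try exact: contB; exact: L2B.
by split=> e /main[d d0 hd]; exists d => // r /hd[].
Qed.

Lemma flow_of_solution s T (eta0 v0 : R -> R) eta v : 1 / 2 < s -> solution s T eta0 v0 eta v ->
  flow 0 T eta v.
Proof.
move=> hs sol; have [_ _ _ W] := sol.
have H t : 0 < t -> t < T -> [/\ finE (eta t), finE (v t), Econt eta t & Econt v t].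
  move=> t0 tT; have [e1 e2] := solution_finE hs sol (ltW t0) tT.
  by have [e3 e4] := solution_Econt hs sol t0 tT.
have tI t : 0 < t -> t < T -> t \in `]0, T[ by move=> t0 tT; rewrite in_itv/= t0.
move=> t t0 tT; have [e1 e2 _ _] := H t t0 tT; split => //.
- apply: (@Ederiv_of_weak R eta (fun t => F1 (eta t) (v t)) T) => //.
    move=> r r0 rT; have [h1 h2 h3 h4] := H r r0 rT; split => //.
      exact: finE_F1.
    exact: Econt_F1.
  by move=> phi r tphi r0 rT; have [h _] := W phi r tphi (tI r r0 rT).
- apply: (@Ederiv_of_weak R v (fun t => F2 (eta t) (v t)) T) => //.
    move=> r r0 rT; have [h1 h2 h3 h4] := H r r0 rT; split => //.
      exact: finE_F2.
    exact: Econt_F2.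
  move=> phi r tphi r0 rT; have [_ h] := W phi r tphi (tI r r0 rT).
  apply: (is_derive_eq h); apply: eq_intR => x.
  by rewrite /F2 expr2; congr (_ * _); congr (_ + _); rewrite mulrC.
Qed.

Lemma finE_test phi : test_function phi -> finE (fun x => phi x - derive1n 2 phi x).
Proof.
move=> /test_functionE[p1 [p2 [M [d1 d2 c2 [_ ->] supp]]]].
have c : continuous (fun x => phi x - p2 x) by apply: contB => //; exact: derive_continuous d1.
have z x : M < `|x| -> phi x - p2 x = 0 by move=> /supp[-> _ ->]; rewrite subrr.
have l2 : L2 (fun x => phi x - p2 x).
  split; first exact: continuous_measurable.
  by apply: (@L1_supp _ _ M) => [|x /z ->]; [exact: contX|rewrite expr0n].
have [B hB] := continuous_box_bounded (- M) M c.
have B0 : 0 <= B by exact: le_trans (normr_ge0 _) (hB 0).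
have N0 := nsq_ge0 (fun x => phi x - p2 x); set N := nsq _ in N0.
exists (B + Num.sqrt N); split => // [x|].
  apply: (@le_trans _ _ B); last by rewrite lerDl sqrtr_ge0.
  have := hB x; have [/andP[h1 h2]|h] := boolP ((- M <= x) && (x <= M)).
    by rewrite box1// mul1r.
  rewrite z ?normr0//; move: h; rewrite negb_and -!ltNge ltr_normr ltrNr orbC.
  by case/orP => ->; rewrite ?orbT.
by rewrite -/N -{1}(sqr_sqrtr N0) lerXn2r ?nnegrE ?addr_ge0 ?sqrtr_ge0// lerDr.
Qed.

(** Pair the curve with the constant curve phi - phi''. *)
Lemma weak_of_Ederiv u t f phi : finE (u t) -> finE f -> Ederiv u t (Aop f) -> test_function phi ->
  is_derive t (1:R) (fun r => intR (fun x => u r x * (phi x - derive1n 2 phi x)))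
    (intR (fun x => f x * derive1 phi x)).
Proof.
move=> Eu Ef D tphi; have Ep := finE_test tphi.
have E0 : finE (fun _ : R => 0 : R) by exists 0; exact: Ebd_0.
have C := Ederiv_const (fun x => phi x - derive1n 2 phi x) t.
apply: (is_derive_eq (Ederiv_intR Eu Ep (inE_Aop Ef) E0 D C)).
rewrite Aop_test// -[RHS]addr0; congr (_ + _).
by rewrite -[RHS](@intR0 R); apply: eq_intR => x; rewrite mulr0.
Qed.

(** A solution which is bounded in E extends beyond T: the existence time of the
    local solution started at a time c close to T is bounded below. *)
Lemma extension s T (eta0 v0 : R -> R) eta v K t0 : 1 / 2 < s -> solution s T eta0 v0 eta v ->
  0 < t0 -> t0 < T -> (forall t, t0 <= t -> t < T -> Ebd K (eta t) /\ Ebd K (v t)) ->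
  ~ blows_up_at s T eta0 v0 eta v.
Proof.
move=> hs sol t00 t0T hK; apply; have fl := flow_of_solution hs sol.
have K0 : 0 <= K by have [/Ebd_ge0] := hK t0 (lexx _) t0T.
have T0 : 0 < T := lt_trans t00 t0T.
pose K2 := 2 * K; have q0 : 0 < 4 * (1 + 2 * K2) by rewrite /K2; lra.
pose tau := (4 * (1 + 2 * K2))^-1; have tau0 : 0 < tau by rewrite invr_gt0.
have tauE : (1 + 2 * K2) * tau = 4^-1.
  by rewrite /tau invfM mulrCA mulfV ?mulr1// gt_eqF//; move: q0; lra.
have small : (1 + 2 * K2) * tau <= 1 / 2 by rewrite tauE; lra.
pose c := T - Num.min (tau / 2) ((T - t0) / 2).
have [c_t0 c_T c_tau] : [/\ t0 < c, c < T & T - c <= tau / 2].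
  rewrite /c; case: (leP (tau / 2) ((T - t0) / 2)) => h; split; move: t0T tau0 h; lra.
have c0 : 0 < c := lt_trans t00 c_t0.
have [b1 b2] := hK c (ltW c_t0) c_T.
have hf : Ebd (K2 / 2) (eta c) by apply: EbdW b1; rewrite /K2; lra.
have hg : Ebd (K2 / 2) (v c) by apply: EbdW b2; rewrite /K2; lra.
have [u1 [u2 [u1c u2c uK fl']]] :=
  @local_existence R K2 tau c (eta c) (v c) hf hg tau0 small.
pose T' := T + tau / 4.
have TT' : T < T' by rewrite /T'; move: tau0; lra.
have T'c : T' < c + tau by rewrite /T'; move: tau0 c_tau; lra.
have c_tau' : c - tau < c by move: tau0; lra.
have uniq t : c <= t -> t < T -> eta t = u1 t /\ v t = u2 t.
  apply: (@flow_unique R K2 0 T (c - tau) (c + tau) c T eta v u1 u2 fl fl') => //.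
  - by apply: ltW; exact: lt_trans TT' T'c.
  - apply: (@le_trans _ _ ((1 + 2 * K2) * tau)) => //.
    by apply: ler_wpM2l; [move: K0; rewrite /K2; lra|move: tau0 c_tau; lra].
  - move=> r cr rT; have [k1 k2] := hK r (le_trans (ltW c_t0) cr) rT; have [k3 k4] := uK r.
    by split => //; [apply: EbdW k1|apply: EbdW k2]; rewrite /K2; move: K0; lra.
have [cc1 cc2 [_ [M1 m1 h1]] [_ [M2 m2 h2]]] := solution_static sol (ltW c0) c_T.
have M12 : 0 <= M1 + M2 by exact: addr_ge0.
have h1' : Hbd s (M1 + M2) (u1 c).
  by rewrite u1c; apply: HbdW h1 => //; apply: le_sqr_norm; rewrite !ger0_norm// lerDl.
have h2' : Hbd s (M1 + M2) (u2 c).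
  by rewrite u2c; apply: HbdW h2 => //; apply: le_sqr_norm; rewrite !ger0_norm// lerDr.
have cT' : c <= T' by apply: ltW; exact: lt_trans c_T TT'.
have [[C C0 reg_] [B B0 lip]] := persistence hs uK fl' c_tau' cT' T'c M12 h1' h2'.
pose eta' t := if t < T then eta t else u1 t.
pose v' t := if t < T then v t else u2 t.
have lo t : t < T -> eta' t = eta t /\ v' t = v t by rewrite /eta' /v' => ->.
have hi t : c <= t -> eta' t = u1 t /\ v' t = u2 t.
  by move=> ct; rewrite /eta' /v'; case: ltP => // tT; exact: uniq.
have Eu t : finE (u1 t) /\ finE (u2 t) by have [k3 k4] := uK t; split; exists K2.
have stat' t : 0 <= t -> t < T' -> [/\ continuous (eta' t), continuous (v' t),
    L2 (eta' t) /\ (exists2 M, 0 <= M & Hbd s M (eta' t)) &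
    L2 (v' t) /\ (exists2 M, 0 <= M & Hbd s M (v' t))].
  move=> t_0 tT'; have [tT|Tt] := ltP t T.
    by have [-> ->] := lo t tT; exact: solution_static sol t_0 tT.
  have ct := le_trans (ltW c_T) Tt; have [-> ->] := hi t ct.
  have [e1 e2] := Eu t; have [r1 r2] := reg_ t ct (ltW tT').
  by split; [exact: inE_cont|exact: inE_cont|split; [exact: inE_L2|exists C]|split; [exact: inE_L2|exists C]].
exists T', eta', v'; split => //; last first.
  by move=> t; rewrite in_itv/= => /andP[_]; exact: lo.
split.
- apply: continuous_Xs_of => // t e t_0 tT' e0; have [tT|Tt] := ltP t T.
    have [cX rep _ _] := sol; have [d d0 hd] := Xs_close cX rep t_0 tT e0.
    exists (Num.min d (T - t)); first by rewrite lt_min d0 subr_gt0.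
    move=> r; rewrite lt_min => /andP[rd]; rewrite ltr_norml => /andP[_ rT] r0 _.
    have rT' : r < T by move: rT; lra.
    by have [-> ->] := lo r rT'; have [-> ->] := lo t tT; exact: hd.
  have ct : c < t by exact: lt_le_trans c_T Tt.
  have B1 : 0 < B + 1 by rewrite ltr_wpDl.
  exists (Num.min (t - c) (e / (B + 1))); first by rewrite lt_min subr_gt0 ct divr_gt0.
  move=> r; rewrite lt_min => /andP[rc re] r0 rT'.
  have cr : c <= r by move: rc; rewrite ltr_norml; lra.
  have [-> ->] := hi r cr; have [-> ->] := hi t (ltW ct).
  have le : B * `|r - t| <= e.
    apply: (@le_trans _ _ ((B + 1) * `|r - t|)); first by rewrite ler_wpM2r// lerDl.
    by rewrite mulrC -ler_pdivlMr// ltW.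
  have le2 (y : R) : `|y| = `|r - t| -> (B * y) ^+ 2 <= e ^+ 2.
    by move=> ey; apply: le_sqr_norm; rewrite normrM ey (ger0_norm B0) (gtr0_norm e0).
  have [tr|/ltW rt] := leP t r.
    have [l1 l2] := lip t r (ltW ct) tr (ltW rT').
    by split; apply: HbdW (lexx s) (le2 _ (erefl _)) _.
  have [l1 l2] := lip r t cr rt (ltW tT').
  have [e1 e2] := Eu r; have [e3 e4] := Eu t.
  have neg u : continuous (u t) -> continuous (u r) -> Hbd s (B * (t - r)) (fun x => u t x - u r x) ->
      Hbd s e (fun x => u r x - u t x).
    move=> cu1 cu2 /(HbdZ (-1) (contB cu1 cu2)); rewrite normrN1 mul1r.
    under [X in Hbd _ _ X]eq_fun do rewrite mulN1r opprB.
    by apply: HbdW => //; apply: le2; rewrite distrC.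
  by split; apply: neg => //; exact: inE_cont.
- by move=> t; rewrite in_itv/= => /andP[t_0 tT']; have [] := stat' t t_0 tT'.
- by have [_ _ i _] := sol; have [-> ->] := lo 0 T0.
- move=> phi t tphi; rewrite in_itv/= => /andP[t_0 tT'].
  have [tT|Tt] := ltP t T.
    have [_ _ _ W] := sol; have tI : t \in `]0, T[ by rewrite in_itv/= t_0.
    have [w1 w2] := W phi t tphi tI; have [-> ->] := lo t tT.
    have Tt0 : 0 < T - t by rewrite subr_gt0.
    have near r : `|r - t| < T - t -> eta' r = eta r /\ v' r = v r.
      by rewrite ltr_norml => /andP[_ h]; apply: lo; move: h; lra.
    split; [apply: (is_derive_local w1)|apply: (is_derive_local w2)]; exists (T - t) => // r /near.
      by move=> [-> _].
    by move=> [_ ->].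
  have ct : c < t by exact: lt_le_trans c_T Tt.
  have [e1 e2 d1 d2] := fl' t (lt_trans c_tau' ct) (lt_trans tT' T'c).
  have w1 := weak_of_Ederiv e1 (finE_F1 e1 e2) d1 tphi.
  have w2 := weak_of_Ederiv e2 (finE_F2 e1 e2) d2 tphi.
  have [-> ->] := hi t (ltW ct).
  have tc0 : 0 < t - c by rewrite subr_gt0.
  have near r : `|r - t| < t - c -> eta' r = u1 r /\ v' r = u2 r.
    by rewrite ltr_norml => /andP[h _]; apply: hi; move: h; lra.
  split.
    by apply: (is_derive_local w1); exists (t - c) => // r /near[-> _].
  have w3 : is_derive t (1:R) (fun r => intR (fun x => u2 r x * (phi x - derive1n 2 phi x)))
      (intR (fun x => (u1 t x + u2 t x ^+ 2 / 2) * derive1 phi x)).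
    apply: (is_derive_eq w2); apply: eq_intR => x.
    by rewrite /F2 expr2 [_ / 2]mulrC.
  by apply: (is_derive_local w3); exists (t - c) => // r /near[_ ->].
Qed.

Lemma liminf_bounded_below (F : R -> \bar R) T : limf_einf F T^'- <> -oo%E ->
  exists M d : R, 0 < d /\ forall t, T - d < t -> t < T -> (- M%:E <= F t)%E.
Proof.
rewrite limf_einfE => h; apply: contrapT => H; apply: h; apply/eqP.
rewrite eq_le leNye andbT; apply: ge_ereal_sup => _ [V hV <-].
rewrite leeNy_eq; apply/eqP; apply: contrapT => inf; apply: H.
have [M hM] : exists M : R, (- M%:E <= ereal_inf (F @` V))%E.
  move: inf; case: (ereal_inf (F @` V)) => [m _||] //.
  - by exists (- m); rewrite EFinN oppeK.
  - by exists 0; rewrite leey.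
have : nbhs T [set t | t < T -> V t] by exact: hV.
rewrite -nbhs_ballE => -[d /= d0 hd].
exists M, d; split => // t td tT; apply: (le_trans hM); apply: ereal_inf_lbound.
exists t => //; apply: hd => //; rewrite /ball/= ger0_norm; first by move: td; lra.
by rewrite subr_ge0 ltW.
Qed.

Lemma liminf_of_bounded_below (F : R -> \bar R) T M d : 0 < d ->
  (forall t, T - d < t -> t < T -> (- M%:E <= F t)%E) -> limf_einf F T^'- <> -oo%E.
Proof.
move=> d0 H; rewrite limf_einfE => E.
have : (- M%:E <= -oo)%E.
  rewrite -E; apply: (@le_trans _ _ (ereal_inf (F @` `]T - d, T[))).
    by apply: le_ereal_inf_tmp => _ [t + <-]; rewrite /= in_itv/= => /andP[]; exact: H.
  apply: ereal_sup_ubound; exists `]T - d, T[%classic => //.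
  suff : nbhs T [set t | t < T -> `]T - d, T[%classic t] by [].
  rewrite -nbhs_ballE; exists d => //= t.
  rewrite /ball/= ltr_norml => /andP[_ h] tT; rewrite in_itv/= tT andbT; move: h; lra.
by rewrite leeNy_eq.
Qed.

End Blowup.

Theorem theorem5p2 (R : realType) (s T : R) (eta0 v0 : R -> R)
    (eta v : R -> R -> R) (hs : 1 / 2 < s) (hT : 0 < T)
    (h0 : Xs s eta0 v0) (hsol : solution s T eta0 v0 eta v) :
  blows_up_at s T eta0 v0 eta v <->
  limf_einf (fun t => ereal_inf (range (fun x => (eta t x)%:E))) T^'- = -oo%E.
Proof.
split=> [blow|liminf [T' [eta' [v' [TT' sol' same]]]]].
  apply: contrapT => /liminf_bounded_below[M [d [d0 low]]].
  pose t0 := T - Num.min (d / 2) (T / 2).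
  have [t00 t0T t0d] : [/\ 0 < t0, t0 < T & T - d < t0].
    by rewrite /t0; case: (leP (d / 2) (T / 2)) => h; split; move: d0 hT h; lra.
  have fl := flow_of_solution hs hsol.
  have [t x t0t tT|K hK] := @apriori R eta v T t0 M fl t00 t0T.
    rewrite -lee_fin EFinN; apply: (le_trans (low t (lt_le_trans t0d t0t) tT)).
    by apply: ereal_inf_lbound; exists x.
  exact: (extension hs hsol t00 t0T hK).
(* an extension is continuous at T with values in E, hence bounded near T *)
have [c _] := solution_Econt hs sol' hT TT'.
have [[M hM] _] := solution_finE hs sol' (ltW hT) TT'.
have [d d0 hd] := Econt_bd c hM.
apply: (@liminf_of_bounded_below R _ T (M + 1) (Num.min d T)) liminf; first by rewrite lt_min d0.
move=> t td tT; apply: le_ereal_inf_tmp => _ [x _ <-].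
have tI : t \in `[0, T[.
  by rewrite in_itv/= tT andbT; move: td; case: (leP d T) => h; lra.
have [<- _] := same t tI; rewrite -EFinN lee_fin.
have near : `|t - T| < d.
  by rewrite ltr_norml; apply/andP; split; move: td d0; case: (leP d T) => h; lra.
by have := Ebd_sup x (hd t near); rewrite ler_norml => /andP[].
Qed.
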